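(* Let $t(z)$, $t^*(z)$, $\alpha(z)$, $\beta(z)$ be the currents built from the Ding–Iohara algebra $\mathcal U(q,t)$ as in the context, and $p=q/t$. (1) The currents $t(z)$ and $t^*(z)$ commute with $\alpha(w)$, $\beta(w)$ and $\psi^\pm(w)$: $$[t(z),\alpha(w)]=[t(z),\beta(w)]=[t^*(z),\alpha(w)]=[t^*(z),\beta(w)]=0,\qquad [t(z),\psi^\pm(w)]=[t^*(z),\psi^\pm(w)]=0.$$ (2) Set $$A(z)=\exp\Big(\sum_{n\ge1}\frac1n\frac{(1-q^n)(1-t^{-n})(1-p^{-n}\gamma^{-2n})}{1-\gamma^{-2n}}z^n\Big).$$ Then $$A(\tfrac wz)t(z)t(w)-A(\tfrac zw)t(w)t(z)=\frac{(1-q)(1-t^{-1})}{1-p}\Big[\delta(p^{-1}\tfrac wz)t^{(2)}(z)-\delta(p\tfrac wz)t^{(2)}(w)\Big],$$ $$A(\tfrac wz)t^*(z)t^*(w)-A(\tfrac zw)t^*(w)t^*(z)=\frac{(1-q^{-1})(1-t)}{1-p^{-1}}\Big[\delta(p\tfrac wz)t^{*(2)}(z)-\delta(p^{-1}\tfrac wz)t^{*(2)}(w)\Big],$$ where $$t^{(2)}(z)=\alpha(pz)\alpha(z)\,x^+(pz)x^+(z)\,\beta(pz)\beta(z),$$ $$t^{*(2)}(z)=\alpha(\gamma pz)^{-1}\alpha(\gamma z)^{-1}\,x^-(pz)x^-(z)\,\beta(\gamma^{-1}pz)^{-1}\beta(\gamma^{-1}z)^{-1}.$$ (3) Set $$B(z)=\exp\Big(\sum_{n\ge1}\frac1n\frac{(1-q^n)(1-t^{-n})(p^{-2n}\gamma^{-2n}-p^{-n}\gamma^{-2n})}{1-\gamma^{-2n}}z^n\Big).$$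 Then $$B(\tfrac wz)t(z)t^*(w)-B(\gamma^2p^2\tfrac zw)t^*(w)t(z)=\frac{(1-q)(1-t^{-1})}{1-p}\Big(\delta(p^{-1}\tfrac wz)\psi_0^+-\delta(\gamma^{-2}p^{-1}\tfrac wz)\psi_0^-\Big).$$
   Context: Let $q,t$ be independent indeterminates, $p=q/t$, base field $\mathbb Q(q^{1/2},t^{1/2})$. Put $$g(z)=\frac{G^+(z)}{G^-(z)},\qquad G^\pm(z)=(1-q^{\pm1}z)(1-t^{\mp1}z)(1-q^{\mp1}t^{\pm1}z),$$ and let $\delta(z)=\sum_{n\in\mathbb Z}z^n$ be the formal delta function. The algebra $\mathcal U(q,t)$ is the unital associative algebra generated by the coefficients of $x^\pm(z)=\sum_{n\in\mathbb Z}x^\pm_nz^{-n}$, $\psi^\pm(z)=\sum_{\pm n\ge0}\psi^\pm_nz^{-n}$ and a central element $\gamma^{\pm1/2}$, with relations $$\psi^\pm(z)\psi^\pm(w)=\psi^\pm(w)\psi^\pm(z),\qquad \psi^+(z)\psi^-(w)=\frac{g(\gamma w/z)}{g(\gamma^{-1}w/z)}\psi^-(w)\psi^+(z),$$ $$\psi^+(z)x^\pm(w)=g(\gamma^{\mp1/2}w/z)^{\mp1}x^\pm(w)\psi^+(z),\qquad \psi^-(z)x^\pm(w)=g(\gamma^{\mp1/2}z/w)^{\pm1}x^\pm(w)\psi^-(z),$$ $$[x^+(z),x^-(w)]=\frac{(1-q)(1-1/t)}{1-q/t}\big(\delta(\gamma^{-1}z/w)\psi^+(\gamma^{1/2}w)-\delta(\gamma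 z/w)\psi^-(\gamma^{-1/2}w)\big),$$ $$G^\mp(z/w)x^\pm(z)x^\pm(w)=G^\pm(z/w)x^\pm(w)x^\pm(z).$$ Elements $b_n$ ($n\neq0$) are defined by the expansions $$\psi^+(z)=\psi_0^+\exp\Big(\sum_{n>0}b_n\gamma^{n/2}z^{-n}\Big),\qquad \psi^-(z)=\psi_0^-\exp\Big(-\sum_{n>0}b_{-n}\gamma^{n/2}z^n\Big).$$ Set $$\alpha(z)=\exp\Big(-\sum_{n\ge1}\frac{1}{\gamma^n-\gamma^{-n}}b_{-n}z^n\Big),\qquad \beta(z)=\exp\Big(\sum_{n\ge1}\frac1{\gamma^n-\gamma^{-n}}b_nz^{-n}\Big),$$ $$t(z)=\alpha(z)x^+(z)\beta(z),\qquad t^*(z)=\alpha(p^{-1}z)^{-1}\,x^-(p^{-1}\gamma^{-1}z)\,\beta(\gamma^{-2}p^{-1}z)^{-1}.$$ Here $1/(\gamma^n-\gamma^{-n})$ is understood as the formal power sum $\sum_{i\ge0}\gamma^{-(2i+1)n}$ and $1/(1-\gamma^{-2n})$ as $\sum_{i\ge0}\gamma^{-2in}$.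
   Formalization: The printed t*^(2)(z) is ill-defined, since x^-(z)x^-(w) may have a pole at z=pw (G^+(p)=0), and its arguments do not match t*(z); it is replaced by the printed formula with p changed to p^{-1}, evaluated at p^{-1}γ^{-1}z, the only current for which the t*t* relation can hold. *)

(* Defs.v *)
From HB Require Import structures.
From mathcomp Require Import all_boot all_order all_algebra fraction.
From mathcomp Require Import finmap boolp classical_sets.
From mathcomp Require Import zify.

Set Implicit Arguments.
Unset Strict Implicit.
Unset Printing Implicit Defensive.

Import GRing.Theory.
Local Open Scope ring_scope.

(** * Formal power series over a possibly noncommutative ring *)

Record fps (R : Type) := Fps { coefs :> nat -> R }.

HB.instance Definition _ (R : Type) := gen_eqMixin (fps R).
HB.instance Definition _ (R : Type) := gen_choiceMixin (fps R).

Lemma fpsP (R : Type) (f g : fps R) : f =1 g -> f = g.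
Proof. by case: f => f; case: g => g /= /funext ->. Qed.

Section FpsRing.
Variable R : nzRingType.
Implicit Types f g h : fps R.

Definition fps_const (c : R) : fps R := Fps (fun n => if n == 0 then c else 0).
Definition fps_add f g : fps R := Fps (fun n => f n + g n).
Definition fps_opp f : fps R := Fps (fun n => - f n).
Definition fps_mul f g : fps R :=
  Fps (fun n => \sum_(i < n.+1) f i * g (n - i)%N).

Let T n f : {poly R} := \poly_(i < n.+1) f i.

Let mulE n m f g : (m <= n)%N -> fps_mul f g m = (T n f * T n g)`_m.
Proof.
move=> mn; rewrite coefM /=; apply: eq_bigr => i _; rewrite !coef_poly.
have im : (i <= m)%N by rewrite -ltnS.
by rewrite !ltnS (leq_trans im mn) (leq_trans (leq_subr _ _) mn).
Qed.

Let coefMT n (p p' : {poly R}) (q q' : {poly R}) :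
  (forall i, (i <= n)%N -> p`_i = p'`_i) ->
  (forall i, (i <= n)%N -> q`_i = q'`_i) -> (p * q)`_n = (p' * q')`_n.
Proof.
move=> pp qq; rewrite !coefM; apply: eq_bigr => i _.
by rewrite pp ?qq ?leq_subr // -ltnS.
Qed.

Let coefT n f i : (i <= n)%N -> (T n f)`_i = f i.
Proof. by move=> le_in; rewrite coef_poly ltnS le_in. Qed.

Fact fps_addA : associative fps_add.
Proof. by move=> f g h; apply: fpsP => n /=; rewrite addrA. Qed.
Fact fps_addC : commutative fps_add.
Proof. by move=> f g; apply: fpsP => n /=; rewrite addrC. Qed.
Fact fps_add0 : left_id (fps_const 0) fps_add.
Proof. by move=> f; apply: fpsP => n /=; rewrite if_same add0r. Qed.
Fact fps_addN : left_inverse (fps_const 0) fps_opp fps_add.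
Proof. by move=> f; apply: fpsP => n /=; rewrite if_same addNr. Qed.
Fact fps_mulA : associative fps_mul.
Proof.
move=> f g h; apply: fpsP => n; rewrite !(@mulE n n) //.
have E a b i : (i <= n)%N -> (T n (fps_mul a b))`_i = (T n a * T n b)`_i.
  by move=> le_in; rewrite coefT // (@mulE n).
transitivity ((T n f * (T n g * T n h))`_n); first by apply: coefMT => // i; apply: E.
by rewrite mulrA; apply: coefMT => // i le_in; rewrite E.
Qed.
Let T1 n i : (i <= n)%N -> (T n (fps_const 1))`_i = (1 : {poly R})`_i.
Proof. by move=> le_in; rewrite coefT //= coef1; case: eqP. Qed.
Fact fps_mul1 : left_id (fps_const 1) fps_mul.
Proof.
move=> f; apply: fpsP => n; rewrite (@mulE n n) // -[RHS](@coefT n) //.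
by rewrite -[in RHS](mul1r (T n f)); apply: coefMT => // i; apply: T1.
Qed.
Fact fps_mulr1 : right_id (fps_const 1) fps_mul.
Proof.
move=> f; apply: fpsP => n; rewrite (@mulE n n) // -[RHS](@coefT n) //.
by rewrite -[in RHS](mulr1 (T n f)); apply: coefMT => // i; apply: T1.
Qed.
Fact fps_mulDl : left_distributive fps_mul fps_add.
Proof.
move=> f g h; apply: fpsP => n /=; rewrite -big_split /=.
by apply: eq_bigr => i _; rewrite mulrDl.
Qed.
Fact fps_mulDr : right_distributive fps_mul fps_add.
Proof.
move=> f g h; apply: fpsP => n /=; rewrite -big_split /=.
by apply: eq_bigr => i _; rewrite mulrDr.
Qed.
Fact fps_1neq0 : fps_const 1 != fps_const 0.
Proof.
apply/eqP => /(congr1 (fun f : fps R => f 0)) /= /eqP.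
by rewrite oner_eq0.
Qed.

HB.instance Definition _ := GRing.isZmodule.Build (fps R)
  fps_addA fps_addC fps_add0 fps_addN.
HB.instance Definition _ := GRing.Zmodule_isNzRing.Build (fps R)
  fps_mulA fps_mul1 fps_mulr1 fps_mulDl fps_mulDr fps_1neq0.

Definition fpsX : fps R := Fps (fun n => (n == 1)%:R).

(** For [f] with constant coefficient 1, the inverse is the geometric series
    of [1 - f], whose [j]-th term only involves exponents [>= j]. *)
Definition fps_inv f : fps R :=
  Fps (fun n => \sum_(j < n.+1) ((1 - f) ^+ j) n).

End FpsRing.

Section FpsDomain.
Variable F : fieldType.
Implicit Types f g : fps F.

Fact fps_mulC : commutative (@fps_mul F).
Proof.
move=> f g; apply: fpsP => n /=.
rewrite (reindex_inj rev_ord_inj) /=; apply: eq_bigr => i _.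
by rewrite subSS subKn 1?mulrC // -ltnS.
Qed.
HB.instance Definition _ :=
  GRing.PzRing_hasCommutativeMul.Build (fps F) fps_mulC.

Let fps_unit : {pred fps F} := fun f => `[< exists g, g * f = 1 >].
Let fps_inverse f : fps F :=
  if pselect (exists g, g * f = 1) is left e then projT1 (cid e) else f.

Fact fps_mulVr : {in fps_unit, left_inverse 1 fps_inverse *%R}.
Proof.
move=> f /asboolP ex; rewrite /fps_inverse; case: pselect => // e.
by case: cid.
Qed.
Fact fps_unitP f g : g * f = 1 -> fps_unit f.
Proof. by move=> e; apply/asboolP; exists g. Qed.
Fact fps_inv_out : {in [predC fps_unit], fps_inverse =1 id}.
Proof.
by move=> f /asboolP; rewrite /fps_inverse; case: pselect.
Qed.
HB.instance Definition _ := GRing.ComNzRing_hasMulInverse.Build (fps F)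
  fps_mulVr fps_unitP fps_inv_out.

Fact fps_neq0 f : f != 0 -> exists2 n, f n != 0 & forall i, (i < n)%N -> f i = 0.
Proof.
move=> f0; have ex : exists n, f n != 0.
  apply: contrapT => H; case/eqP: f0; apply: fpsP => n /=; rewrite if_same.
  by apply: contrapT => /eqP fn; apply: H; exists n.
case: (ex_minnP ex) => n fn min; exists n => // i lt_in; apply/eqP.
by apply: contraLR lt_in => /min; rewrite -leqNgt.
Qed.

Fact fps_mulf_eq0 f g : f * g = 0 -> (f == 0) || (g == 0).
Proof.
move=> fg; rewrite -[_ || _]negbK negb_or; apply/negP => /andP[].
move=> /fps_neq0[m fm m_min] /fps_neq0[n gn n_min].
have /eqP := congr1 (fun h : fps F => h (m + n)%N) fg.
have lt_m : (m < (m + n).+1)%N by rewrite ltnS leq_addr.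
rewrite /= (bigD1 (Ordinal lt_m)) //= addKn big1 ?addr0.
  by rewrite if_same mulf_eq0 (negbTE fm) (negbTE gn).
move=> i /negP/negP; rewrite -val_eqE /= neq_ltn => /orP[lt|gt].
  by rewrite m_min ?mul0r.
by rewrite n_min ?mulr0 // ltn_subLR ?ltn_add2r // -ltnS.
Qed.
HB.instance Definition _ :=
  GRing.ComUnitRing_isIntegral.Build (fps F) fps_mulf_eq0.

End FpsDomain.

Definition fps_of_poly (R : nzRingType) (u : {poly R}) : fps R :=
  Fps (fun n => u`_n).

Definition fps_scale (R : nzRingType) (c : R) (f : fps R) : fps R :=
  Fps (fun n => c ^+ n * f n).

(** Exponential of a series with zero constant coefficient: the [j]-th term
    only involves exponents [>= j]. *)
Definition fps_exp (F : fieldType) (A : lalgType F) (f : fps A) : fps A :=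
  Fps (fun n => \sum_(j < n.+1) (j`!%:R : F)^-1 *: (f ^+ j) n).

(** sum_(i >= 0) X^(a + d i), for d > 0 *)
Definition geom (R : nzRingType) (a d : nat) : fps R :=
  Fps (fun j => ((a <= j)%N && (d %| j - a)%N)%:R).

Fact fps_mulX (R : nzRingType) (f : fps R) n :
  (f * fpsX R) n = if n is m.+1 then f m else 0.
Proof.
rewrite -[LHS]/(\sum_(i < n.+1) f i * ((n - i)%N == 1)%:R).
case: n => [|m]; first by rewrite big_ord1 mulr0.
rewrite big_ord_recr /= subnn mulr0 addr0 big_ord_recr /= subSnn mulr1.
rewrite big1 ?add0r // => i _.
by rewrite (_ : (m.+1 - i)%N == 1 = false) ?mulr0 //; apply/eqP; case: i => /= i; lia.
Qed.
Fact fps_mulXn (R : nzRingType) (f : fps R) d n :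
  (f * fpsX R ^+ d) n = if (n < d)%N then 0 else f (n - d)%N.
Proof.
elim: d n => [|d IH] n; first by rewrite expr0 mulr1 subn0.
by rewrite exprSr mulrA fps_mulX; case: n => // n; rewrite IH ltnS subSS.
Qed.
Fact geomE (R : nzRingType) a d : (0 < d)%N -> geom R a d * (1 - fpsX _ ^+ d) = fpsX _ ^+ a.
Proof.
move=> d0; apply: fpsP => n.
rewrite mulrBr mulr1 -[LHS]/(geom R a d n - (geom R a d * fpsX _ ^+ d) n).
rewrite fps_mulXn -[fpsX _ ^+ a]mul1r fps_mulXn /=.
case: (ltnP n a) => an /=.
  case: ifP => _; first by rewrite subr0.
  by rewrite leqNgt (leq_ltn_trans (leq_subr _ _) an) subr0.
rewrite [RHS](_ : _ = ((n - a)%N == 0)%:R); last by case: eqP.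
have [e|pos] := posnP (n - a).
  rewrite e dvdn0 (_ : (if _ then _ else _) = 0) ?subr0 //.
  by case: ltnP => // nd; rewrite leqNgt (_ : (n - d < a)%N) //; lia.
case: (ltnP n d) => nd.
  by rewrite subr0 gtnNdvd //; lia.
case: (leqP a (n - d)) => and /=; last by rewrite subr0 gtnNdvd //; lia.
by rewrite (_ : (n - a = n - d - a + d)%N) ?dvdn_addl ?subrr //; lia.
Qed.

(** * Scalars

    A field with elements q, t, gamma^(1/2) and values of
    1 / (gamma^n - gamma^(-n)) and 1 / (1 - gamma^(-2n)).  The case of interest
    is [formal_scalars]; the abstraction keeps the structure of that field out
    of the terms. *)

Record scalars := Scalars {
  sfield :> fieldType;
  q : sfield;
  t : sfield;
  gammah : sfield;
  inv_gamma_sub : nat -> sfield;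
  inv_one_sub : nat -> sfield }.

Section StructureFunctions.
Variable P : scalars.
Local Notation q := (q P).
Local Notation t := (t P).
Local Notation inv_one_sub := (inv_one_sub P).

Definition p : P := q / t.
Definition gamma : P := gammah P ^+ 2.

Definition Gp : {poly P} :=
  (1 - q *: 'X) * (1 - t^-1 *: 'X) * (1 - (q^-1 * t) *: 'X).
Definition Gm : {poly P} :=
  (1 - q^-1 *: 'X) * (1 - t *: 'X) * (1 - (q * t^-1) *: 'X).
Definition g : fps P := fps_of_poly Gp * fps_inv (fps_of_poly Gm).

Definition Aseries : fps P :=
  @fps_exp P P^o (Fps (fun n => if n == 0 then 0 else
    n%:R^-1 * ((1 - q ^+ n) * (1 - t ^- n) * (1 - p ^- n * gamma ^- (2 * n)))
      * inv_one_sub n)).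

Definition Bseries : fps P :=
  @fps_exp P P^o (Fps (fun n => if n == 0 then 0 else
    n%:R^-1 * ((1 - q ^+ n) * (1 - t ^- n) *
               (p ^- (2 * n) * gamma ^- (2 * n) - p ^- n * gamma ^- (2 * n)))
      * inv_one_sub n)).

Fact Gp_pole : q != 0 -> t != 0 -> Gp.[p] = 0.
Proof.
move=> q0 t0; rewrite /Gp hornerM [X in _ * X](_ : _ = 0) ?mulr0 //.
rewrite hornerD hornerN hornerZ hornerX hornerC /p mulrACA mulVf // mul1r.
by rewrite divff // subrr.
Qed.

End StructureFunctions.

(** * Complete separated topological algebras

    The topology is linear: the neighbourhoods of 0 are left ideals, and right
    multiplications are continuous.  The motivating example is the completion
    of a Z-graded algebra U with respect to the left ideals generated by the
    homogeneous elements of degree at least N. *)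

Record linear_topology (F : fieldType) (E : algType F) := LinearTopology {
  nbhd0 : nat -> set E;
  nbhd0_decr : forall N x, nbhd0 N.+1 x -> nbhd0 N x;
  nbhd0_0 : forall N, nbhd0 N 0;
  nbhd0D : forall N x y, nbhd0 N x -> nbhd0 N y -> nbhd0 N (x + y);
  nbhd0_mull : forall N u x, nbhd0 N x -> nbhd0 N (u * x);
  nbhd0_mulr : forall N u, exists M, forall x, nbhd0 M x -> nbhd0 N (x * u);
  nbhd0_separated : forall x, (forall N, nbhd0 N x) -> x = 0;
  nbhd0_complete : forall u : nat -> E,
    (forall N, nbhd0 N (u N.+1 - u N)) ->
    exists s, forall N, nbhd0 N (s - u N) }.

(** * Currents

    A formal distribution is represented by the family of its coefficients:
    [a n] is the coefficient of z^n in a(z), and [F m n] that of z^m w^n in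
    F(z,w). *)

(** f(z) and f(1/z) for a power series f; delta(c z) *)
Definition cur_z (V : nmodType) (f : fps V) : int -> V :=
  fun n => if n is Posz k then f k else 0.
Definition cur_zV (V : nmodType) (f : fps V) : int -> V :=
  fun n => cur_z f (- n).
Definition delta (K : fieldType) (c : K) : int -> K := fun n => c ^ n.

Section Currents.
Variables (K : fieldType) (E : algType K) (J : linear_topology E).
Implicit Types (a b : int -> E) (F : int -> int -> E) (f : int -> K).

Definition is_sum (f : int -> E) (s : E) : Prop :=
  forall N, exists S0 : {fset int}, forall S : {fset int},
    (S0 `<=` S)%fset -> nbhd0 J N (s - \sum_(i <- S) f i).

(** The sum of a summable family (unique by separatedness). *)
Definition tsum (f : int -> E) : E := xget 0 [set s | is_sum f s]%classic.

(** a(z)b(z) *)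
Definition cmul a b : int -> E := fun n => tsum (fun i => a i * b (n - i)).

(** a(c z) *)
Definition dil (c : K) a : int -> E := fun n => c ^ n *: a n.

(** a(z)b(w) and a(w)b(z) *)
Definition zw a b : int -> int -> E := fun m n => a m * b n.
Definition wz a b : int -> int -> E := fun m n => a n * b m.

(** [a(z), b(w)] *)
Definition comm2 a b : int -> int -> E := fun m n => a m * b n - b n * a m.

(** a(z) and a(w), as distributions in (z,w) *)
Definition in_z a : int -> int -> E := fun m n => if n == 0 then a m else 0.
Definition in_w a : int -> int -> E := fun m n => if m == 0 then a n else 0.

(** f(w/z) F(z,w) and f(z/w) F(z,w) *)
Definition mulwz f F : int -> int -> E :=
  fun m n => tsum (fun k => f k *: F (m + k) (n - k)).
Definition mulzw f F : int -> int -> E :=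
  fun m n => tsum (fun k => f k *: F (m - k) (n + k)).

(** a(c z) a(z), as the value at z = c w of the matrix elements of a(z) a(w).
    The latter are expansions in the region |z| >> |w| of rational functions,
    and the coefficients of a(c z) a(z) are not convergent sums; but when
    R(z,w) = G(z/w) a(z) a(w) is also G'(z/w) a(w) a(z) for some polynomials G
    and G', R(c z,z) is well defined, and one divides it by G(c), provided
    that this is not 0. *)
Definition fuse (G : {poly K}) (c : K) a : int -> E := fun n =>
  (G.[c])^-1 *: tsum (fun i => c ^ i *:
    mulzw (cur_z (fps_of_poly G)) (zw a a) i (n - i)).

End Currents.

(** * The algebra U(q,t) *)

(** [psip k] is psi^+_k and [psim k] is psi^-_(-k), for k >= 0. *)
Record modes (E : Type) := Modes {
  xp : int -> E; xm : int -> E; psip : fps E; psim : fps E }.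

Inductive generator := GXp of int | GXm of int | GPsip of nat | GPsim of nat.

Definition gen_degree (x : generator) : int :=
  match x with
  | GXp n | GXm n => n
  | GPsip k => k%:Z
  | GPsim k => - k%:Z
  end.

Definition gen_val (E : Type) (U : modes E) (x : generator) : E :=
  match x with
  | GXp n => xp U n
  | GXm n => xm U n
  | GPsip k => psip U k
  | GPsim k => psim U k
  end.

Section DingIohara.
Variables (P : scalars) (E : algType P) (J : linear_topology E) (U : modes E).
Local Notation q := (q P).
Local Notation t := (t P).
Local Notation p := (p P).
Local Notation g := (g P).
Local Notation gammah := (gammah P).
Local Notation gamma := (gamma P).
Local Notation Gp := (Gp P).
Local Notation Gm := (Gm P).
Local Notation inv_gamma_sub := (inv_gamma_sub P).

Definition xpc : int -> E := fun n => xp U (- n).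
Definition xmc : int -> E := fun n => xm U (- n).
Definition psipc : int -> E := cur_zV (psip U).
Definition psimc : int -> E := cur_z (psim U).

(** [U] defines a continuous morphism from U(q,t), with scalars extended to
    [P], to [E].  All the sums in the relations are finite.  The elements
    psi^+_0 and psi^-_0 have to be invertible for the b_n to be defined. *)
Record ding_iohara : Prop := DingIohara {
  psip0_unit : exists u, u * psip U 0%N = 1 /\ psip U 0%N * u = 1;
  psim0_unit : exists u, u * psim U 0%N = 1 /\ psim U 0%N * u = 1;
  psip_psip : zw psipc psipc =2 wz psipc psipc;
  psim_psim : zw psimc psimc =2 wz psimc psimc;
  psip_psim : zw psipc psimc =2
    mulwz J (cur_z (fps_scale gamma g * fps_inv (fps_scale gamma^-1 g)))
      (wz psimc psipc);
  psip_xp : zw psipc xpc =2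
    mulwz J (cur_z (fps_inv (fps_scale gammah^-1 g))) (wz xpc psipc);
  psip_xm : zw psipc xmc =2
    mulwz J (cur_z (fps_scale gammah g)) (wz xmc psipc);
  psim_xp : zw psimc xpc =2
    mulzw J (cur_z (fps_scale gammah^-1 g)) (wz xpc psimc);
  psim_xm : zw psimc xmc =2
    mulzw J (cur_z (fps_inv (fps_scale gammah g))) (wz xmc psimc);
  xp_xm : forall m n, comm2 xpc xmc m n =
    ((1 - q) * (1 - t^-1) / (1 - q / t)) *:
      (mulzw J (delta gamma^-1) (in_w (dil gammah psipc)) m n -
       mulzw J (delta gamma) (in_w (dil gammah^-1 psimc)) m n);
  xp_xp : mulzw J (cur_z (fps_of_poly Gm)) (zw xpc xpc) =2
          mulzw J (cur_z (fps_of_poly Gp)) (wz xpc xpc);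
  xm_xm : mulzw J (cur_z (fps_of_poly Gp)) (zw xmc xmc) =2
          mulzw J (cur_z (fps_of_poly Gm)) (wz xmc xmc);
  modes_continuous : forall N, exists D : int, forall s : seq generator,
    D <= \sum_(x <- s) gen_degree x ->
    nbhd0 J N (\prod_(x <- s) gen_val U x) }.

(** [b n], for n <> 0, is the element b_n; [b 0] is irrelevant. *)
Definition cartan_modes (b : int -> E) : Prop :=
  psip U = fps_const (psip U 0%N) *
    @fps_exp P E (Fps (fun n => if n == 0 then 0 else gammah ^+ n *: b n)) /\
  psim U = fps_const (psim U 0%N) *
    @fps_exp P E (Fps (fun n => if n == 0 then 0 else
                                  - (gammah ^+ n *: b (- n%:Z)))).

Variable b : int -> E.

(** [alpha] is a series in z and [beta] a series in 1/z. *)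
Definition alpha : fps E :=
  @fps_exp P E (Fps (fun n => if n == 0 then 0 else
                                - (inv_gamma_sub n *: b (- n%:Z)))).
Definition beta : fps E :=
  @fps_exp P E (Fps (fun n => if n == 0 then 0 else inv_gamma_sub n *: b n)).

Definition alphac : int -> E := cur_z alpha.
Definition betac : int -> E := cur_zV beta.
Definition alphaVc : int -> E := cur_z (fps_inv alpha).
Definition betaVc : int -> E := cur_zV (fps_inv beta).

Definition tc : int -> E := cmul J (cmul J alphac xpc) betac.

Definition tsc : int -> E :=
  cmul J (cmul J (dil p^-1 alphaVc) (dil (p^-1 * gamma^-1) xmc))
         (dil (gamma ^- 2 * p^-1) betaVc).

Definition t2c : int -> E :=
  cmul J (cmul J (cmul J (cmul J (dil p alphac) alphac)
                         (fuse J Gm p xpc))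
                 (dil p betac))
         betac.

(** t^(2)(z) is t(p z)t(z), and t*^(2)(z) is t*(p^(-1) z)t*(z), normally
    ordered.  Here p^(-1) cannot be p: x^-(z) x^-(w) is regular at z = p^(-1) w,
    but has a pole at z = p w ([Gp_pole]), so that there is no x^-(p z) x^-(z).
    With a(y) = alpha(gamma y)^(-1) and b(y) = beta(gamma^(-1) y)^(-1), one has
    t*(z) = a(y) x^-(y) b(y) at y = p^(-1) gamma^(-1) z, and t*^(2)(z) is
      a(p^(-1) y) a(y) x^-(p^(-1) y) x^-(y) b(p^(-1) y) b(y)
    at the same y. *)
Definition ts2c : int -> E :=
  dil (p^-1 * gamma^-1)
    (cmul J (cmul J (cmul J (cmul J (dil (gamma * p^-1) alphaVc)
                                    (dil gamma alphaVc))
                            (fuse J Gp p^-1 xmc))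
                    (dil (gamma^-1 * p^-1) betaVc))
            (dil gamma^-1 betaVc)).

End DingIohara.

(** * Formal scalars: the field k((h)), k = Q(q^(1/2), t^(1/2)), h = gamma^(-1/2)

    The central element gamma^(1/2) is made a scalar; extending scalars from
    k[gamma^(1/2), gamma^(-1/2)] to k((gamma^(-1/2))) is what gives a meaning to
    the formal power sums in gamma^(-1). *)

Definition base_field : fieldType := {fraction {poly {fraction {poly rat}}}}.
Definition q_half0 : base_field :=
  FracField.tofrac (FracField.tofrac ('X : {poly rat}))%:P.
Definition t_half0 : base_field :=
  FracField.tofrac ('X : {poly {fraction {poly rat}}}).

Fact q_half0_neq0 : q_half0 != 0.
Proof. by rewrite tofrac_eq0 polyC_eq0 tofrac_eq0 polyX_eq0. Qed.
Fact t_half0_neq0 : t_half0 != 0.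
Proof. by rewrite tofrac_eq0 polyX_eq0. Qed.
Global Opaque base_field.

Definition laurent_field : fieldType := {fraction (fps base_field)}.
Definition laurent : fps base_field -> laurent_field := @FracField.tofrac (fps base_field).

Fact laurent_is_zmod_morphism : zmod_morphism laurent.
Proof. exact: tofrac_is_zmod_morphism. Qed.
Fact laurent_is_monoid_morphism : monoid_morphism laurent.
Proof. exact: tofrac_is_monoid_morphism. Qed.
HB.instance Definition _ := GRing.isZmodMorphism.Build (fps base_field) laurent_field
  laurent laurent_is_zmod_morphism.
HB.instance Definition _ := GRing.isMonoidMorphism.Build (fps base_field) laurent_field
  laurent laurent_is_monoid_morphism.
Fact laurent_eq0 f : (laurent f == 0) = (f == 0).
Proof. exact: tofrac_eq0. Qed.
Global Opaque laurent_field.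

Definition formal_scalars : scalars := Scalars
  (laurent (fps_const (q_half0 ^+ 2)))
  (laurent (fps_const (t_half0 ^+ 2)))
  (laurent (fpsX base_field))^-1
  (* sum_(i >= 0) gamma^(-(2i+1)n) *)
  (fun n => laurent (geom base_field (2 * n) (4 * n)))
  (* sum_(i >= 0) gamma^(-2in) *)
  (fun n => laurent (geom base_field 0 (4 * n))).

Section FormalSums.
Local Notation c := (gammah formal_scalars).

Let cV m : c ^- m = laurent (fpsX base_field ^+ m).
Proof. by rewrite -exprVn invrK -rmorphXn. Qed.

Let laurent_geomE a d : (0 < d)%N ->
  laurent (geom base_field a d) * (1 - c ^- d) = c ^- a.
Proof.
by move=> d0; rewrite !cV -(rmorph1 laurent) -rmorphB -rmorphM geomE.
Qed.

Fact gammah_neq0 : c != 0.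
Proof.
rewrite invr_eq0 laurent_eq0.
apply/eqP => /(congr1 (fun f : fps _ => f 1%N)) /eqP.
by rewrite /= oner_eq0.
Qed.

Let sumE (F : fieldType) (h s : F) n : h != 0 ->
  s * (1 - h ^- (4 * n)) = h ^- (2 * n) ->
  s * ((h ^+ 2) ^+ n - (h ^+ 2) ^- n) = 1.
Proof.
move=> h0 E; have u m : h ^+ m != 0 by rewrite expf_neq0.
have -> : (h ^+ 2) ^+ n - (h ^+ 2) ^- n = (1 - h ^- (4 * n)) * h ^+ (2 * n).
  rewrite -!exprM mulrBl mul1r (_ : 4 * n = 2 * n + 2 * n)%N; last lia.
  by rewrite exprD invfM -mulrA mulVf ?mulr1.
by rewrite mulrA E mulVf.
Qed.

Fact inv_gamma_subE n : (0 < n)%N ->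
  inv_gamma_sub formal_scalars n *
    (gamma formal_scalars ^+ n - gamma formal_scalars ^- n) = 1.
Proof.
move=> n0; apply: sumE; first exact: gammah_neq0.
by apply: laurent_geomE; rewrite muln_gt0.
Qed.

Fact inv_one_subE n : (0 < n)%N ->
  inv_one_sub formal_scalars n * (1 - gamma formal_scalars ^- (2 * n)) = 1.
Proof.
move=> n0; rewrite /gamma -exprM mulnA.
have d0 : (0 < 4 * n)%N by rewrite muln_gt0.
by rewrite (laurent_geomE 0 d0) expr0 invr1.
Qed.

Fact laurent_const_neq0 (x : base_field) :
  x != 0 -> laurent (fps_const x) != 0.
Proof.
move=> x0; rewrite laurent_eq0.
by apply: contraNneq x0 => /(congr1 (fun f : fps _ => f 0%N)) /= ->.
Qed.

Fact q_neq0 : q formal_scalars != 0.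
Proof. by apply: laurent_const_neq0; rewrite expf_neq0 // q_half0_neq0. Qed.

Fact t_neq0 : t formal_scalars != 0.
Proof. by apply: laurent_const_neq0; rewrite expf_neq0 // t_half0_neq0. Qed.

End FormalSums.

(* Main.v *)
Require Import Defs.
From mathcomp Require Import all_boot all_order all_algebra fraction.
From mathcomp Require Import finmap boolp classical_sets.
From mathcomp Require Import zify ring.

Set Implicit Arguments.
Unset Strict Implicit.
Unset Printing Implicit Defensive.

Import GRing.Theory Num.Theory.
Local Open Scope ring_scope.

(** Write g(z) = exp (sum_(n > 0) g_n z^n / n), where
    g_n = (1 - q^n) (1 - t^-n) (1 - p^-n).  Logarithms of the relations between
    the psi^+-(z) and the currents x^+-(w), and between psi^+ and psi^-, say
    that, for n > 0,
      [b_n, x^+(z)] = - (g_n / n) gamma^-n z^n x^+(z),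
      [b_n, x^-(z)] = (g_n / n) z^n x^-(z),
      [b_n, b_-m] = - delta_(n,m) (g_n / n) (1 - gamma^-2n),
    and the same with z^-n for b_-n in the first two ([b_xp], [b_xm],
    [fbr_bp_alpha], [fbr_bm_beta]).  All passages between a series and its
    logarithm go through the differential equation X f' = l f, which determines
    f from f(0) ([ode_uniq]); no convergence is involved in them.

    The last bracket makes alpha(z) an eigenvector of [b_n, -] for n > 0 and
    beta(z) one for n < 0, with the eigenvalue opposite to that of x^+(z).
    Hence every b_n commutes with t(z) = alpha x^+ beta, and similarly with
    t^*(z); everything in the first part is a series in the b_n and the central
    elements psi^+-_0 ([t_commutes_with_cartan]).

    For the products, t(z) commutes with alpha(w), so that
    t(z) t(w) = alpha(w) t(z) x^+(w) beta(w), and the only exchange left is that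
    of beta(z) with x^+(w), which costs a scalar series in w/z.  Thus a
    commutator of t and t^* weighted by A or B is the commutator of the bare
    currents x^+ and x^- with a simpler weight, multiplied by the series alpha
    and beta ([dress_commutator]).
    - For t t, the weight becomes
      (1 - q u) (1 - u / t) / ((1 - u) (1 - p u)) at u = w/z ([A_h_tt]).  It is
      G^+(u) divided by (1 - u) (1 - p u) (1 - u / p), and the quadratic
      relation says that G^+(w/z) x^+(z) x^+(w) is also, up to a power of w/z,
      a polynomial in z/w times x^+(w) x^+(z).  The difference is therefore that
      of two expansions of one rational function, a sum of three delta
      functions, of which the one at z = w vanishes by antisymmetry
      ([quadratic_delta]).
    - For t^* t^* the situation is the same with q and t inverted.
    - For t t^*, the weight becomes 1, and what remains is [x^+, x^-], whose
      delta functions identify the arguments in such a way that alpha, beta and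
      psi^+- cancel up to psi^+-_0 ([plus_vacuum], [minus_vacuum]).

    Products of currents are infinite sums.  The sums needed converge because
    the coefficients of x(z) y(w) tend to 0 in a cone of exponents, and
    multiplication by series in z, w and w/z on the left, and by beta on the
    right, preserves this property; these multiplications commute by
    a Fubini theorem ([smooth], [lop_lopC], [lop_ropC], [rop_ropC]). *)

(** * Power series over a noncommutative ring and the operator X d/dX *)

Section FpsRing.
Variable R : nzRingType.
Implicit Types f g h l : fps R.

Lemma coefsD f g n : (f + g) n = f n + g n. Proof. by []. Qed.
Lemma coefsN f n : (- f) n = - f n. Proof. by []. Qed.
Lemma coefsB f g n : (f - g) n = f n - g n. Proof. by []. Qed.
Lemma coefsM f g n : (f * g) n = \sum_(i < n.+1) f i * g (n - i)%N.
Proof. by []. Qed.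
Lemma coefs0 n : (0 : fps R) n = 0. Proof. by rewrite /= if_same. Qed.
Lemma coefs1 n : (1 : fps R) n = (n == 0)%:R. Proof. by case: n. Qed.
Lemma coefsMn f k n : (f *+ k) n = f n *+ k.
Proof. by elim: k => [|k IH]; rewrite ?coefs0 // !mulrS coefsD IH. Qed.
Lemma coefs_sum I (r : seq I) (P : pred I) (F : I -> fps R) n :
  (\sum_(i <- r | P i) F i) n = \sum_(i <- r | P i) F i n.
Proof. by apply: (big_morph (fun f : fps R => f n)) => [f g|]; rewrite ?coefs0. Qed.
Lemma coefsCM c f n : (fps_const c * f) n = c * f n.
Proof.
rewrite coefsM big_ord_recl /= subn0 big1 ?addr0 // => i _.
by rewrite mul0r.
Qed.
Lemma coefsMC c f n : (f * fps_const c) n = f n * c.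
Proof.
rewrite coefsM big_ord_recr /= subnn eqxx big1 ?add0r // => i _.
by rewrite subn_eq0 leqNgt ltn_ord mulr0.
Qed.
Lemma coefsM0 f g : (f * g) 0 = f 0 * g 0.
Proof. by rewrite coefsM big_ord1. Qed.

Lemma fps_constM (c d : R) : fps_const c * fps_const d = fps_const (c * d).
Proof. by apply: fpsP => n; rewrite coefsCM /=; case: eqP; rewrite ?mulr0. Qed.

(** This makes the sums over exponents in [fps_inv] and [fps_exp] locally
    finite: their upper bound may be increased at will. *)
Lemma coefsX_eq0 f j n : f 0 = 0 -> (n < j)%N -> (f ^+ j) n = 0.
Proof.
move=> f0; elim: j n => // j IH n lt_nj.
rewrite exprS coefsM big_ord_recl f0 mul0r add0r big1 // => i _.
rewrite IH ?mulr0 //; move: lt_nj; rewrite /= /bump /= ltnS => le_nj; have := ltn_ord i.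
by lia.
Qed.

(** As f begins in degree 1, the coefficient of degree m + 1 of f^j for j >= 2
    does not involve that of f.  The second conclusion is the induction step
    that recovers a series from its exponential ([graded_log]). *)
Lemma coefs_pow_closed (C : nat -> R -> Prop) f m :
  (forall d, C d 0) -> (forall d x y, C d x -> C d y -> C d (x + y)) ->
  (forall d e x y, C d x -> C e y -> C (d + e)%N (x * y)) -> C 0 1 ->
  f 0 = 0 -> (forall i, (i <= m)%N -> C i (f i)) ->
  (forall j n, (n <= m)%N -> C n ((f ^+ j) n)) /\
  (forall j, C m.+1 ((f ^+ j.+2) m.+1)).
Proof.
move=> C0 CD CM C1 f0 Cf.
have Csum d (r : seq nat) (F : nat -> R) (P : pred nat) :
    (forall i, P i -> C d (F i)) -> C d (\sum_(i <- r | P i) F i).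
  by move=> H; apply: (big_ind (C d)) => // x y; apply: CD.
have Cj j n : (n <= m)%N -> C n ((f ^+ j) n).
  elim: j n => [|j IH] n nm; first by rewrite expr0 coefs1; case: n nm.
  rewrite exprS coefsM.
  apply: (big_ind (C n)) => // [x y|i _]; first exact: CD.
  have le_in : (i <= n)%N by rewrite -ltnS.
  have -> : C n = C (i + (n - i))%N by rewrite subnKC.
  apply: CM; first by apply: Cf; lia.
  by apply: IH; lia.
split=> // j; rewrite exprS coefsM big_ord_recl f0 mul0r add0r.
rewrite big_ord_recr /= /bump /= !add1n subnn.
rewrite coefsX_eq0 ?mulr0 ?addr0 //.
apply: (big_ind (C m.+1)) => // [x y|i _]; first exact: CD.
rewrite /= /bump /= add1n; have := ltn_ord i => im.
have -> : C m.+1 = C (i.+1 + (m.+1 - i.+1))%N by congr C; lia.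
by apply: CM; [apply: Cf|apply: Cj]; lia.
Qed.

Section Inverse.
Variable f : fps R.
Hypothesis f0 : f 0 = 1.

Let g := 1 - f.
Let g0 : g 0 = 0. Proof. by rewrite coefsB coefs1 f0 subrr. Qed.

Lemma fps_inv_coefs L n : (n < L)%N -> fps_inv f n = (\sum_(j < L) g ^+ j) n.
Proof.
move=> nL; rewrite coefs_sum /= (big_ord_widen L (fun j => (g ^+ j) n)) //.
rewrite big_mkcond /=; apply: eq_bigr => j _; case: ifP => // /negbT.
by rewrite -leqNgt => nj; rewrite coefsX_eq0.
Qed.

Lemma fps_inv0 : fps_inv f 0 = 1.
Proof. by rewrite (@fps_inv_coefs 1) // big_ord1 expr0. Qed.

Lemma mulVfps : fps_inv f * f = 1.
Proof.
apply: fpsP => n.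
transitivity (((\sum_(j < n.+1) g ^+ j) * f) n).
  rewrite !coefsM; apply: eq_bigr => i _; rewrite (@fps_inv_coefs n.+1) //.
have -> : (\sum_(j < n.+1) g ^+ j) * f = 1 - g ^+ n.+1.
  rewrite -opprB subrX1 -mulNr opprB.
  have -> : f = 1 - g by rewrite subKr.
  rewrite mulr_suml mulr_sumr; apply: eq_bigr => j _.
  by rewrite mulrBl mulrBr mul1r mulr1 -exprS -exprSr.
by rewrite coefsB (@coefsX_eq0 g) // subr0.
Qed.

Lemma mulfpsV : f * fps_inv f = 1.
Proof.
apply: fpsP => n.
transitivity ((f * (\sum_(j < n.+1) g ^+ j)) n).
  rewrite !coefsM; apply: eq_bigr => i _; rewrite (@fps_inv_coefs n.+1) //.
  by rewrite ltnS leq_subr.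
have -> : f * (\sum_(j < n.+1) g ^+ j) = 1 - g ^+ n.+1.
  by rewrite -opprB subrX1 -mulNr opprB subKr.
by rewrite coefsB (@coefsX_eq0 g) // subr0.
Qed.

End Inverse.

Definition theta f : fps R := Fps (fun n => f n *+ n).

Lemma thetaD f g : theta (f + g) = theta f + theta g.
Proof. by apply: fpsP => n; rewrite /= mulrnDl. Qed.
Lemma thetaN f : theta (- f) = - theta f.
Proof. by apply: fpsP => n; rewrite /= mulNrn. Qed.
Lemma thetaB f g : theta (f - g) = theta f - theta g.
Proof. by rewrite thetaD thetaN. Qed.
Lemma thetaC (c : R) : theta (fps_const c) = 0.
Proof. by apply: fpsP => -[|n]; rewrite /= ?mulr0n // mul0rn. Qed.
Lemma thetaM f g : theta (f * g) = theta f * g + f * theta g.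
Proof.
apply: fpsP => n; rewrite coefsD !coefsM -big_split /=.
rewrite -sumrMnl; apply: eq_bigr => i _.
rewrite mulrnAl mulrnAr -mulrnDr subnKC //.
by rewrite -ltnS.
Qed.
Lemma theta0 : theta 0 = 0. Proof. exact: thetaC. Qed.
Lemma theta1 : theta 1 = 0. Proof. exact: thetaC. Qed.

Definition torsion_free := forall (x : R) n, x *+ n.+1 = 0 -> x = 0.

(** In degree n the equation reads n f_n = sum_(i > 0) l_i f_(n - i), which
    computes f_n from the previous coefficients.  All the identities between
    exponentials below are instances. *)
Lemma ode_uniq l f g : torsion_free -> l 0 = 0 ->
  theta f = l * f -> theta g = l * g -> f 0 = g 0 -> f = g.
Proof.
move=> tf l0 Ef Eg E0; apply/eqP; rewrite -subr_eq0; apply/eqP.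
have : theta (f - g) = l * (f - g) by rewrite thetaB Ef Eg mulrBr.
have : (f - g) 0 = 0 by rewrite coefsB E0 subrr.
move: (f - g) => h h0 Eh; apply: fpsP => n; rewrite coefs0.
elim/ltn_ind: n => -[|n] IH //; apply: (tf _ n).
have := congr1 (fun s : fps R => s n.+1) Eh; rewrite /= => ->.
rewrite big_ord_recl l0 mul0r add0r big1 // => i _.
by rewrite IH ?mulr0 // /= /bump /=; have := ltn_ord i; lia.
Qed.

Lemma fpsX_comm f k : fpsX R ^+ k * f = f * fpsX R ^+ k.
Proof.
apply: commr_sym; apply: commrX => {k}; apply: fpsP => n; rewrite fps_mulX.
rewrite coefsM; case: n => [|n]; first by rewrite big_ord1 mul0r.
rewrite 2!big_ord_recl /= mul0r add0r mul1r subSS subn0 big1 ?addr0 // => i _.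
by rewrite /bump /= mul0r.
Qed.

End FpsRing.

(** * Exponentials with commuting coefficients *)

Section FpsAlgebra.
Variables (K : fieldType) (E : algType K).
Hypothesis char0 : forall n, n.+1%:R != 0 :> K.
Implicit Types (c f g : fps E) (h : fps K) (x : int -> E).

Definition fcomm f g := forall i j, GRing.comm (f i) (g j).

Lemma mulfC f g : fcomm f g -> f * g = g * f.
Proof.
move=> fg; apply: fpsP => n; rewrite !coefsM (reindex_inj rev_ord_inj) /=.
by apply: eq_bigr => i _; rewrite subSS subKn 1?fg // -ltnS.
Qed.

Lemma alg_torsion_free : torsion_free E.
Proof.
move=> x n /eqP; rewrite -scaler_nat scaler_eq0 (negbTE (char0 n)) /=.
by move/eqP.
Qed.

Lemma fps_exp_coefs c L n : c 0 = 0 -> (n < L)%N ->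
  fps_exp c n = \sum_(j < L) (j`!%:R)^-1 *: (c ^+ j) n.
Proof.
move=> c0 nL; rewrite /=.
rewrite (big_ord_widen L (fun j => (j`!%:R)^-1 *: (c ^+ j) n)) //.
rewrite big_mkcond /=; apply: eq_bigr => j _; case: ifP => // /negbT.
by rewrite -leqNgt => nj; rewrite coefsX_eq0 // scaler0.
Qed.

Lemma fps_exp0 c : fps_exp c 0 = 1.
Proof. by rewrite /= big_ord1 fact0 invr1 scale1r expr0. Qed.

Lemma theta_pow c j : fcomm c c -> theta (c ^+ j.+1) = (theta c * c ^+ j) *+ j.+1.
Proof.
move=> cc; have tc : c * theta c = theta c * c.
  apply: mulfC => i j'; rewrite /theta /= /GRing.comm mulrnAr mulrnAl.
  by rewrite (cc i j').
elim: j => [|j IH]; first by rewrite expr1 expr0 mulr1.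
by rewrite exprS thetaM IH mulrnAr mulrA tc -mulrA -exprS [RHS]mulrS.
Qed.

Lemma theta_exp c : c 0 = 0 -> fcomm c c ->
  theta (fps_exp c) = theta c * fps_exp c.
Proof.
move=> c0 cc; apply: fpsP => n.
have -> : (theta (fps_exp c)) n =
    \sum_(j < n.+1) (j`!%:R)^-1 *: (theta (c ^+ j)) n.
  rewrite /= -sumrMnl; apply: eq_bigr => j _.
  by rewrite scalerMnr.
rewrite big_ord_recl expr0 theta1 coefs0 scaler0 add0r.
have -> : \sum_(i < n) ((lift ord0 i)`!%:R)^-1 *: theta (c ^+ lift ord0 i) n =
   \sum_(i < n) (i`!%:R)^-1 *: (theta c * c ^+ i) n.
  apply: eq_bigr => i _; rewrite lift0 theta_pow // coefsMn.
  rewrite -scaler_nat scalerA factS natrM invfM mulrAC mulVf ?mul1r //.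
under eq_bigr do rewrite coefsM scaler_sumr.
rewrite exchange_big coefsM /=; apply: eq_bigr => i _.
have [->|i0] := posnP i.
  by rewrite mulr0n mul0r big1 // => j _; rewrite mul0r scaler0.
rewrite -[\sum_(j < (n - i).+1) _]/(fps_exp c (n - i)%N) (@fps_exp_coefs _ n) //.
  by rewrite mulr_sumr; apply: eq_bigr => j _; rewrite scalerAr.
by have := ltn_ord i; lia.
Qed.

(** ** Closure of graded families of subspaces under exp, log and inverse

    This is used for the commutant of an element, where the family is constant,
    and for the degree, which governs convergence. *)

Section Graded.
Variable C : nat -> E -> Prop.
Hypothesis C0 : forall d, C d 0.
Hypothesis CD : forall d (x y : E), C d x -> C d y -> C d (x + y).
Hypothesis CZ : forall d (k : K) (x : E), C d x -> C d (k *: x).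
Hypothesis CM : forall d e (x y : E), C d x -> C e y -> C (d + e)%N (x * y).
Hypothesis C1 : C 0 1.

Let Csum d (r : seq nat) (F : nat -> E) :
  (forall i, C d (F i)) -> C d (\sum_(i <- r) F i).
Proof. by move=> H; apply: (big_ind (C d)) => // x y; apply: CD. Qed.

Let Cfps f := forall n, C n (f n).

Let CX f : f 0 = 0 -> Cfps f -> forall j, Cfps (f ^+ j).
Proof.
by move=> f0 Cf j n; have [H _] := @coefs_pow_closed _ C f n C0 CD CM C1 f0 (fun i _ => Cf i); apply: H.
Qed.

Lemma graded_exp c : c 0 = 0 -> Cfps c -> Cfps (fps_exp c).
Proof.
move=> c0 Cc n /=; rewrite -(big_mkord xpredT (fun j => (j`!%:R)^-1 *: (c ^+ j) n)).
by apply: Csum => j; apply/CZ/CX.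
Qed.

Lemma graded_log c : c 0 = 0 -> Cfps (fps_exp c) -> Cfps c.
Proof.
move=> c0 Cc n; elim/ltn_ind: n => -[|m] IH; first by rewrite c0.
have [_ Cj] := coefs_pow_closed C0 CD CM C1 c0 IH.
have := Cc m.+1; rewrite (@fps_exp_coefs c m.+2) // 2!big_ord_recl.
rewrite expr0 coefs1 scaler0 add0r lift0 -[nat_of_ord ord0]/0%N.
rewrite -[1`!%:R]/1 invr1 scale1r expr1.
set s := \sum_(i < m) _ => H.
(* The term of exponent 1 is c itself, and those of higher exponent only
   involve lower coefficients. *)
have Cs : C m.+1 s.
  rewrite /s (eq_bigr (fun i : 'I_m => (i.+2`!%:R)^-1 *: (c ^+ i.+2) m.+1)); last first.
    by move=> i _; rewrite !lift0.
  rewrite -(big_mkord xpredT (fun i => (i.+2`!%:R)^-1 *: (c ^+ i.+2) m.+1)).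
  by apply: Csum => i; apply: CZ.
have -> : c m.+1 = c m.+1 + s + (-1 : K) *: s by rewrite scaleN1r addrK.
by apply: CD => //; apply: CZ.
Qed.

Lemma graded_inv f : f 0 = 1 -> Cfps f -> Cfps (fps_inv f).
Proof.
move=> f0 Cf n /=; rewrite -(big_mkord xpredT (fun j => ((1 - f) ^+ j) n)).
apply: Csum => j; apply: CX => [|m]; first by rewrite coefsB coefs1 f0 subrr.
rewrite coefsB coefs1; apply: CD; last by rewrite -scaleN1r; apply: CZ.
by case: m => // m.
Qed.

End Graded.

Section Commutant.
Variable y : E.

Let C (_ : nat) (z : E) := GRing.comm y z.
Let C0 d : C d 0. Proof. exact: commr0. Qed.
Let CD d u v : C d u -> C d v -> C d (u + v). Proof. exact: commrD. Qed.
Let CZ d (k : K) u : C d u -> C d (k *: u).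
Proof. by rewrite /C /GRing.comm => e; rewrite -scalerAr e scalerAl. Qed.
Let CM d e u v : C d u -> C e v -> C (d + e)%N (u * v).
Proof. exact: commrM. Qed.
Let C1 : C 0 1. Proof. exact: commr1. Qed.

Lemma comm_exp c : c 0 = 0 -> (forall n, GRing.comm y (c n)) ->
  forall n, GRing.comm y (fps_exp c n).
Proof. exact: (graded_exp C0 CD CZ CM C1). Qed.
Lemma comm_log c : c 0 = 0 -> (forall n, GRing.comm y (fps_exp c n)) ->
  forall n, GRing.comm y (c n).
Proof. exact: (graded_log C0 CD CZ CM C1). Qed.
Lemma comm_inv f : f 0 = 1 -> (forall n, GRing.comm y (f n)) ->
  forall n, GRing.comm y (fps_inv f n).
Proof. exact: (graded_inv C0 CD CZ CM C1). Qed.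

End Commutant.

Lemma commZ (y z : E) (k : K) : GRing.comm y z -> GRing.comm y (k *: z).
Proof. by rewrite /GRing.comm => e; rewrite -scalerAr e scalerAl. Qed.

(** ** Brackets with the coefficients of an exponential *)

Definition fbr (y : E) f := fps_const y * f - f * fps_const y.

Lemma fbrE y f n : fbr y f n = y * f n - f n * y.
Proof. by rewrite /fbr coefsB coefsCM coefsMC. Qed.
Lemma fbrM y f g : fbr y (f * g) = fbr y f * g + f * fbr y g.
Proof. by rewrite /fbr mulrBl mulrBr !mulrA addrA subrK. Qed.
Lemma theta_fbr y f : theta (fbr y f) = fbr y (theta f).
Proof. by rewrite /fbr thetaB !thetaM !thetaC !mul0r mulr0 add0r addr0. Qed.

(** These monomials are central, which is why brackets with values in their
    multiples commute with taking exponentials. *)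
Definition kX (k : K) s : fps E := fps_const k%:A * fpsX E ^+ s.
Lemma kX_comm k s f : kX k s * f = f * kX k s.
Proof.
rewrite /kX -mulrA fpsX_comm !mulrA; congr (_ * _); apply: mulfC => i j.
by rewrite /GRing.comm /=; case: eqP; rewrite ?mulr0 ?mul0r // mulr_algl mulr_algr.
Qed.
Lemma kXE k s f n : (kX k s * f) n = if (n < s)%N then 0 else k *: f (n - s)%N.
Proof.
rewrite /kX -mulrA fpsX_comm coefsCM fps_mulXn.
by case: ifP; rewrite ?mulr0 // mulr_algl.
Qed.

(** Since k X^s is central, the difference of the two sides satisfies the
    differential equation of f = exp d, with constant term 0. *)
Lemma fbr_exp y f d k s : theta f = theta d * f -> f 0 = 1 ->
  fbr y d = kX k s -> (0 < s)%N -> fbr y f = kX k s * f.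
Proof.
move=> Ef f0 Ed s0; apply/eqP; rewrite -subr_eq0; apply/eqP.
apply: (@ode_uniq _ (theta d)); first exact: alg_torsion_free.
- by rewrite /= mulr0n.
- rewrite thetaB thetaM theta_fbr Ef fbrM -theta_fbr Ed.
  rewrite opprD addrACA subrr add0r; have := kX_comm k s (theta d).
  by move: (kX k s) (fbr y f) => u v e; rewrite mulrBr !mulrA e.
- by rewrite theta0 mulr0.
by rewrite coefsB fbrE f0 mulr1 mul1r subrr kXE s0 subrr.
Qed.

(** Applying X d/dX to the hypothesis and cancelling f on the right leaves
    X d/dX [y, d] = X d/dX (k X^s). *)
Lemma fbr_log y f f' d k s : theta f = theta d * f -> f * f' = 1 ->
  fbr y f = kX k s * f -> (0 < s)%N -> d 0 = 0 -> fbr y d = kX k s.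
Proof.
move=> Ef ff' Efb s0 d0.
have H : theta (fbr y d) * f = theta (kX k s) * f.
  apply/(@addrI _ (theta d * fbr y f)).
  rewrite theta_fbr addrC -fbrM -Ef -theta_fbr Efb thetaM Ef addrC.
  by rewrite mulrA kX_comm mulrA.
have {}H : theta (fbr y d) = theta (kX k s).
  by rewrite -[LHS]mulr1 -[RHS]mulr1 -ff' !mulrA H.
have /eqP : fbr y d - kX k s = 0; last by rewrite subr_eq0 => /eqP.
apply: (@ode_uniq _ 0); first exact: alg_torsion_free.
- exact: coefs0.
- by rewrite thetaB H subrr mul0r.
- by rewrite mul0r theta0.
by rewrite coefsB fbrE d0 mulr0 mul0r subrr -[kX k s]mulr1 kXE s0 subrr.
Qed.

Lemma fbr_inv y f k s : f 0 = 1 -> fbr y f = kX k s * f ->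
  fbr y (fps_inv f) = kX (- k) s * fps_inv f.
Proof.
move=> f0 Efb; have V := mulVfps f0; have V' := mulfpsV f0.
have : fbr y (fps_inv f * f) = 0.
  by rewrite V /fbr mulr1 mul1r subrr.
rewrite fbrM Efb => e0; have -> : fbr y (fps_inv f) = - (kX k s * fps_inv f).
  have vc := kX_comm k s (fps_inv f).
  move: (fbr y _) (kX k s) e0 vc => u v e0 ->; apply/eqP; rewrite -addr_eq0.
  rewrite -[X in X == 0]mulr1 -V' mulrA mulrDl -(mulrA _ v f) e0.
  by rewrite mul0r.
by apply: fpsP => n; rewrite coefsN !kXE; case: ifP; rewrite ?oppr0 // scaleNr.
Qed.

(** ** Exchange of psi(u) = exp c(u) with a current

    psi(1/z) x(w) = h(w/z) x(w) psi(1/z) at the level of coefficients is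
    psi x_n = X_n psi, where X_n = sum_i h_i x_(n-i) u^i. *)

Definition exch (psi : fps E) x h := forall k n, psi k * x n =
  \sum_(i < k.+1) h i *: (x (n - i%:Z) * psi (k - i)%N).

Let shifted x h n : fps E := Fps (fun i => h i *: x (n - i%:Z)).

Let exchE psi x h : exch psi x h <->
  forall n, psi * fps_const (x n) = shifted x h n * psi.
Proof.
split=> H => [n|k n].
  apply: fpsP => k; rewrite coefsMC H coefsM; apply: eq_bigr => i _.
  by rewrite scalerAl.
have := congr1 (fun f : fps E => f k) (H n); rewrite coefsMC => ->.
by rewrite coefsM; apply: eq_bigr => i _; rewrite scalerAl.
Qed.

Let bracket_shifted c x h n s :
  (theta c * shifted x h n - shifted x h n * theta c) s.+1 =
  \sum_(i < s.+1) (h i *: (c (s.+1 - i)%N * x (n - i%:Z) -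
                           x (n - i%:Z) * c (s.+1 - i)%N)) *+ (s.+1 - i).
Proof.
rewrite coefsD coefsN !coefsM (reindex_inj rev_ord_inj) /= -sumrN -big_split /=.
rewrite big_ord_recr /= !subSS !subnn !mulr0n mul0r mulr0 subr0 addr0.
apply: eq_bigr => i _; have le_is : (i <= s)%N by rewrite -ltnS.
rewrite !subSS !subKn // ?leqW // subSn //.
by rewrite -scalerAr -scalerAl mulrnAl mulrnAr -scalerBr -mulrnBl -scalerMnr.
Qed.

Let theta_shifted h kap x n s : theta h = theta kap * h -> kap 0 = 0 ->
  theta (shifted x h n) s.+1 =
  \sum_(i < s.+1) (h i *: (kap (s.+1 - i)%N *: x (n - i%:Z - (s.+1 - i)%:Z)))
                    *+ (s.+1 - i).
Proof.
move=> Eh k0 /=; rewrite scalerMnl.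
have -> : h s.+1 *+ s.+1 = \sum_(i < s.+1) (kap i.+1 *+ i.+1) * h (s - i)%N.
  rewrite -[LHS]/(theta h s.+1) Eh coefsM big_ord_recl /=.
  rewrite mulr0n mul0r add0r; apply: eq_bigr => i _.
  by rewrite /bump add1n subSS.
rewrite scaler_suml [LHS](reindex_inj rev_ord_inj) /=.
apply: eq_bigr => i _; have le_is : (i <= s)%N by rewrite -ltnS.
rewrite !subSS !subKn // subSn //.
rewrite (_ : n - i%:Z - (s - i).+1%:Z = n - s.+1%:Z); last by lia.
by rewrite scalerA scalerMnl mulrnAl mulrC.
Qed.

(** Both sides of psi x_n = X_n psi satisfy X f' = X c' f.  For X_n psi this
    amounts to [X c', X_n] = X (X_n)', which is the system of eigenvalue
    equations of the c_i combined with the differential equation of h. *)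
Lemma exch_exp psi c x h kap :
  theta psi = theta c * psi -> psi 0 = 1 -> theta h = theta kap * h -> h 0 = 1 ->
  c 0 = 0 -> kap 0 = 0 ->
  (forall i n, (0 < i)%N -> c i * x n - x n * c i = kap i *: x (n - i%:Z)) ->
  exch psi x h.
Proof.
move=> Ep p0 Eh h0 c0 k0 Hc; apply/exchE => n.
apply: (@ode_uniq _ (theta c)); first exact: alg_torsion_free.
- by rewrite /= mulr0n.
- by rewrite thetaM thetaC mulr0 addr0 Ep mulrA.
- rewrite thetaM Ep !mulrA -mulrDl; congr (_ * _).
  apply/eqP; rewrite eq_sym -subr_eq; apply/eqP.
  apply: fpsP => -[|s].
    by rewrite coefsD coefsN !coefsM0 /= !mulr0n mulr0 mul0r subr0.
  rewrite bracket_shifted (theta_shifted _ _ _ Eh k0); apply: eq_bigr => i _.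
  by rewrite Hc // subn_gt0.
by rewrite coefsMC coefsM0 p0 /= h0 scale1r mulr1 mul1r subr0.
Qed.

(** The same computation backwards; the equation [X c', X_n] = X (X_n)' is
    solved for [c_i, x_n] by induction on i, since h_0 = 1. *)
Lemma exch_log psi psi' c x h kap :
  theta psi = theta c * psi -> psi * psi' = 1 ->
  theta h = theta kap * h -> h 0 = 1 -> kap 0 = 0 -> exch psi x h ->
  forall i n, (0 < i)%N -> c i * x n - x n * c i = kap i *: x (n - i%:Z).
Proof.
move=> Ep ppsi Eh h0 k0 /exchE Hx.
have Hn n : theta c * shifted x h n - shifted x h n * theta c =
    theta (shifted x h n).
  have := congr1 (@theta _) (Hx n); rewrite !thetaM thetaC mulr0 addr0 Ep.
  rewrite -(mulrA (theta c)) Hx !mulrA -mulrDl => /(congr1 (fun u => u * psi')).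
  by rewrite -!(mulrA _ psi) ppsi !mulr1 => ->; rewrite addrK.
elim/ltn_ind=> -[|s] // IH n _.
have := congr1 (fun f : fps E => f s.+1) (Hn n).
rewrite bracket_shifted (theta_shifted _ _ _ Eh k0) !big_ord_recl /=.
rewrite h0 !scale1r !subr0 (eq_bigr (fun i : 'I_s => (h (bump 0 i) *: (kap (s.+1 - bump 0 i)%N *:
    x (n - (bump 0 i)%:Z - (s.+1 - bump 0 i)%:Z))) *+ (s.+1 - bump 0 i))); last first.
  by move=> i _; rewrite IH //; rewrite /bump /=; have := ltn_ord i; lia.
by move/addIr/eqP; rewrite -subr_eq0 -mulrnBl => /eqP/alg_torsion_free/eqP; rewrite subr_eq0 => /eqP.
Qed.

End FpsAlgebra.

(** * Summation of families indexed by the integers *)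

Section Summation.
Variables (K : fieldType) (E : algType K) (J : linear_topology E).
Implicit Types (f : int -> E) (x y u : E) (N B : nat).

Lemma nbhdZ N (c : K) x : nbhd0 J N x -> nbhd0 J N (c *: x).
Proof. by rewrite -mulr_algl; apply: nbhd0_mull. Qed.
Lemma nbhdN N x : nbhd0 J N x -> nbhd0 J N (- x).
Proof. by rewrite -scaleN1r; apply: nbhdZ. Qed.
Lemma nbhdB N x y : nbhd0 J N x -> nbhd0 J N y -> nbhd0 J N (x - y).
Proof. by move=> Nx Ny; apply: nbhd0D => //; apply: nbhdN. Qed.
Lemma nbhd_sum N I (r : seq I) (P : pred I) (F : I -> E) :
  (forall i, P i -> nbhd0 J N (F i)) -> nbhd0 J N (\sum_(i <- r | P i) F i).
Proof.
by move=> NF; apply: (big_ind (nbhd0 J N)) => //;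
  [exact: nbhd0_0|exact: nbhd0D].
Qed.
Lemma nbhd_le N M x : (N <= M)%N -> nbhd0 J M x -> nbhd0 J N x.
Proof.
move=> /subnK <-; elim: (M - N)%N x => // k IH x; rewrite addSn => /nbhd0_decr.
exact: IH.
Qed.

Definition eqJ N x y := nbhd0 J N (x - y).

Lemma eqJ_eq x y : (forall N, eqJ N x y) -> x = y.
Proof. by move=> H; apply/eqP; rewrite -subr_eq0; apply/eqP/nbhd0_separated/H. Qed.
Lemma eqJ_refl N x : eqJ N x x.
Proof. by rewrite /eqJ subrr; apply: nbhd0_0. Qed.
Lemma eqJ_sym N x y : eqJ N x y -> eqJ N y x.
Proof. by rewrite /eqJ -opprB => /nbhdN; rewrite opprK. Qed.
Lemma eqJ_trans N y x z : eqJ N x y -> eqJ N y z -> eqJ N x z.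
Proof. by rewrite /eqJ => /nbhd0D H /H; rewrite addrA subrK. Qed.

Lemma is_sum_uniq f x y : is_sum J f x -> is_sum J f y -> x = y.
Proof.
move=> fx fy; apply: eqJ_eq => N; have [S HS] := fx N; have [T HT] := fy N.
have H1 := HS (S `|` T)%fset (fsubsetUl _ _).
have H2 := HT (S `|` T)%fset (fsubsetUr _ _).
by apply: eqJ_trans H1 (eqJ_sym H2).
Qed.

Lemma is_sum_tsum f x : is_sum J f x -> tsum J f = x.
Proof.
move=> fx; rewrite /tsum; case: xgetP => [y _ fy|/(_ x)//].
exact: is_sum_uniq fy fx.
Qed.

Lemma is_sumZ (c : K) f x : is_sum J f x -> is_sum J (fun i => c *: f i) (c *: x).
Proof.
move=> fx N; have [S HS] := fx N; exists S => T ST.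
by rewrite -scaler_sumr -scalerBr; apply/nbhdZ/HS.
Qed.

Lemma tsumZ (c : K) f : tsum J (fun i => c *: f i) = c *: tsum J f.
Proof.
have [->|c0] := eqVneq c 0.
  rewrite scale0r; apply: is_sum_tsum => N; exists fset0 => T _.
  by rewrite big1 ?subrr => [|i _]; [apply: nbhd0_0|rewrite scale0r].
have [[x fx]|nf] := pselect (exists x, is_sum J f x).
  by rewrite (is_sum_tsum fx); apply/is_sum_tsum/is_sumZ.
rewrite {2}/tsum; case: xgetP => [x _ fx|_]; first by case: nf; exists x.
rewrite scaler0 /tsum; case: xgetP => // x _ /(is_sumZ c^-1) fx; case: nf.
exists (c^-1 *: x); move: fx; congr is_sum; apply/funext => i.
by rewrite scalerA mulVf // scale1r.
Qed.

Lemma is_sum_finite (S : {fset int}) f :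
  (forall i, i \notin S -> f i = 0) -> is_sum J f (\sum_(i <- S) f i).
Proof.
move=> f0 N; exists S => T ST.
rewrite (_ : \sum_(i <- T) f i = \sum_(i <- S) f i).
  by rewrite subrr; apply: nbhd0_0.
rewrite (bigID (mem S)) /= [X in _ + X]big1 ?addr0; last by move=> i /f0.
rewrite -big_filter; apply/perm_big/uniq_perm; rewrite ?filter_uniq ?fset_uniq //.
by move=> i; rewrite mem_filter /=; apply: andb_idr => /(fsubsetP ST).
Qed.

(** The topology being linear, convergence to 0 is enough for summability, and
    the sum is the limit of the partial sums over -B <= i < B. *)
Definition vanishing f := forall N, exists B, forall i : int, (B <= `|i|)%N -> nbhd0 J N (f i).
Local Notation small := vanishing.

Definition psum f B : E := \sum_(k < B) (f k%:Z + f (- k.+1%:Z)).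

Lemma psum_diff N B C f : (forall i : int, (B <= `|i|)%N -> nbhd0 J N (f i)) ->
  (B <= C)%N -> eqJ N (psum f C) (psum f B).
Proof.
move=> fN /subnKC <-; elim: (C - B)%N => [|k IH].
  by rewrite addn0; apply: eqJ_refl.
apply: eqJ_trans IH; rewrite /eqJ addnS /psum big_ord_recr /= addrAC subrr add0r.
by apply: nbhd0D; apply: fN; lia.
Qed.

Let ball B : seq int := [seq k%:Z | k <- iota 0 B] ++ [seq - k.+1%:Z | k <- iota 0 B].

Let ball_uniq B : uniq (ball B).
Proof.
rewrite cat_uniq !map_inj_uniq ?iota_uniq; [|by move=> i j; lia|by move=> i j; lia].
rewrite andbT /=; apply/hasPn => i /mapP[k _ ->].
by apply/negP => /mapP[l _]; lia.
Qed.

Let mem_ball B i : (i \in ball B) = (- B%:Z <= i < B%:Z).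
Proof.
rewrite mem_cat; apply/orP/idP => [[/mapP[k]|/mapP[k]]|H].
- by rewrite mem_iota => /andP[_ kB] ->; lia.
- by rewrite mem_iota => /andP[_ kB] ->; lia.
case: i H => k H; [left|right]; apply/mapP; exists k; rewrite ?mem_iota //.
  by lia.
by lia.
Qed.

Let psum_ball f B : psum f B = \sum_(i <- ball B) f i.
Proof.
rewrite big_cat !big_map /psum big_split /=.
rewrite -(big_mkord xpredT (fun k => f k%:Z)).
by rewrite -(big_mkord xpredT (fun k => f (- k.+1%:Z))) /index_iota subn0.
Qed.

Lemma is_sum_psum f s : small f ->
  (forall N, exists B0, forall B, (B0 <= B)%N -> eqJ N s (psum f B)) -> is_sum J f s.
Proof.
move=> sf fs N; have [B HB] := sf N; have [B0 HB0] := fs N.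
pose C := maxn B B0.
exists [fset i in ball C]%fset => S CS.
apply: eqJ_trans (HB0 C (leq_maxr _ _)) _; rewrite psum_ball.
rewrite (_ : \sum_(i <- S) f i = \sum_(i <- ball C) f i +
    \sum_(i <- S | i \notin ball C) f i).
  rewrite /eqJ opprD addNKr; apply/nbhdN/nbhd_sum => i; rewrite mem_ball => iC.
  by apply: HB; have := leq_maxl B B0; rewrite -/C; lia.
rewrite (bigID (mem (ball C))) /=; congr (_ + _).
rewrite -big_filter; apply/perm_big/uniq_perm; rewrite ?filter_uniq ?fset_uniq ?ball_uniq //.
move=> i; rewrite mem_filter /=; apply: andb_idr => iC.
by apply: (fsubsetP CS); rewrite in_fset.
Qed.

Lemma small_is_sum f : small f -> is_sum J f (tsum J f).
Proof.
move=> sf; suff [s fs] : exists s, is_sum J f s by rewrite (is_sum_tsum fs).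
(* D need not be monotone, as required for the completeness axiom. *)
have [D HD] := boolp.choice sf.
pose C N := (\sum_(i < N.+1) D i)%N.
have DC N : (D N <= C N)%N by rewrite /C big_ord_recr leq_addl.
have CC N : (C N <= C N.+1)%N by rewrite [X in (_ <= X)%N]/C big_ord_recr leq_addr.
have [s Hs] : exists s, forall N, nbhd0 J N (s - psum f (C N)).
  apply: nbhd0_complete => N; apply: psum_diff (CC N) => i Ci.
  by apply: HD; apply: leq_trans (DC N) Ci.
exists s; apply: is_sum_psum => // N; exists (C N) => B CB.
apply: eqJ_trans (Hs N) _; apply/eqJ_sym/psum_diff => // i Ci.
by apply: HD; apply: leq_trans (DC N) Ci.
Qed.

Lemma tsum_psum f N B : small f ->
  (forall i : int, (B <= `|i|)%N -> nbhd0 J N (f i)) -> eqJ N (tsum J f) (psum f B).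
Proof.
move=> sf fN; have [S HS] := small_is_sum sf N.
pose C := maxn B (\max_(i <- S) (absz i).+1).
have BC : (B <= C)%N by rewrite leq_maxl.
apply: eqJ_trans (psum_diff fN BC).
have H : (S `<=` [fset i in ball C])%fset.
  apply/fsubsetP => i iS; rewrite in_fset mem_ball.
  have : ((absz i).+1 <= C)%N.
    by rewrite leq_max; apply/orP; right; apply: (leq_bigmax_seq (F := fun i => (absz i).+1)).
  by lia.
have := HS _ H; rewrite psum_ball /eqJ; congr (nbhd0 J N (_ - _)).
apply/perm_big/uniq_perm; rewrite ?fset_uniq ?ball_uniq // => i; by rewrite in_fset.
Qed.

Lemma nbhd_tsum N f : small f -> (forall i, nbhd0 J N (f i)) -> nbhd0 J N (tsum J f).
Proof.
move=> sf fN; have := @tsum_psum f N 0 sf (fun i _ => fN i).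
by rewrite /eqJ /psum big_ord0 subr0.
Qed.

Lemma tsum_finite (B : nat) f :
  (forall i : int, ~~ (0 <= i <= B%:Z) -> f i = 0) ->
  tsum J f = \sum_(i < B.+1) f i%:Z.
Proof.
move=> f0; apply: eqJ_eq => N.
have sf : small f.
  by move=> M; exists B.+1 => i Bi; rewrite f0; [apply: nbhd0_0|lia].
apply: eqJ_trans (@tsum_psum f N B.+1 sf _) _.
  by move=> i Bi; rewrite f0; [apply: nbhd0_0|lia].
rewrite (_ : psum _ _ = \sum_(i < B.+1) f i); first exact: eqJ_refl.
apply: eq_bigr => i _; rewrite [X in _ + X]f0 ?addr0 //; lia.
Qed.

Lemma tsum_single (i0 : int) f : (forall i, i != i0 -> f i = 0) -> tsum J f = f i0.
Proof.
move=> f0; have <- : \sum_(i <- [fset i0]%fset) f i = f i0 by rewrite big_seq_fset1.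
by apply/is_sum_tsum/is_sum_finite => i; rewrite inE; apply: f0.
Qed.

Lemma small_mull u f : small f -> small (fun i => u * f i).
Proof.
by move=> sf N; have [B HB] := sf N; exists B => i /HB; apply: nbhd0_mull.
Qed.
Lemma small_mulr u f : small f -> small (fun i => f i * u).
Proof.
move=> sf N; have [M HM] := nbhd0_mulr J N u; have [B HB] := sf M.
by exists B => i /HB/HM.
Qed.
Lemma smallD f g : small f -> small g -> small (fun i => f i + g i).
Proof.
move=> sf sg N; have [B HB] := sf N; have [C HC] := sg N; exists (maxn B C) => i.
by rewrite geq_max => /andP[/HB Hf /HC Hg]; apply: nbhd0D.
Qed.
Lemma smallZ (c : K) f : small f -> small (fun i => c *: f i).
Proof. by move=> sf N; have [B HB] := sf N; exists B => i /HB; apply: nbhdZ. Qed.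

Lemma tsum_mull u f : small f -> tsum J (fun i => u * f i) = u * tsum J f.
Proof.
move=> sf; apply: is_sum_tsum => N; have [S HS] := small_is_sum sf N.
by exists S => T /HS; rewrite -mulr_sumr -mulrBr; apply: nbhd0_mull.
Qed.
Lemma tsum_mulr u f : small f -> tsum J (fun i => f i * u) = tsum J f * u.
Proof.
move=> sf; apply: is_sum_tsum => N; have [M HM] := nbhd0_mulr J N u.
have [S HS] := small_is_sum sf M.
by exists S => T /HS; rewrite -mulr_suml -mulrBl; apply: HM.
Qed.
Lemma tsumD f g : small f -> small g ->
  tsum J (fun i => f i + g i) = tsum J f + tsum J g.
Proof.
move=> sf sg; apply: is_sum_tsum => N.
have [S HS] := small_is_sum sf N; have [T HT] := small_is_sum sg N.
exists (S `|` T)%fset => V; rewrite fsubUset => /andP[/HS Hf /HT Hg].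
by rewrite big_split opprD addrACA; apply: nbhd0D.
Qed.
Lemma tsumB f g : small f -> small g ->
  tsum J (fun i => f i - g i) = tsum J f - tsum J g.
Proof.
move=> sf sg; rewrite -(scaleN1r (tsum J g)) -tsumZ -tsumD //; last exact: smallZ.
by congr tsum; apply/funext => i; rewrite scaleN1r.
Qed.

Lemma tsum_reindex (s r : int -> int) f : cancel s r -> cancel r s ->
  tsum J (fun i => f (s i)) = tsum J f.
Proof.
move=> sK rK.
have H (s' r' : int -> int) (f' : int -> E) x : cancel s' r' -> cancel r' s' ->
    is_sum J f' x -> is_sum J (fun i => f' (s' i)) x.
  move=> sK' rK' fx N; have [S HS] := fx N; exists [fset r' i | i in S]%fset => T ST.
  have -> : \sum_(i <- T) f' (s' i) = \sum_(i <- [fset s' i | i in T]%fset) f' i.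
    rewrite big_imfset //=; first by move=> i j _ _; apply: (can_inj sK').
  apply: HS; apply/fsubsetP => i iS; apply/imfsetP; exists (r' i); rewrite ?rK' //.
  by apply: (fsubsetP ST); apply/imfsetP; exists i.
rewrite /tsum; congr xget; apply/seteqP; split=> x /=; last exact: H.
move=> /(H r s _ _ rK sK); congr is_sum; apply/funext => i; by rewrite rK.
Qed.

Lemma tsum_shift (k : int) f : tsum J (fun i => f (i + k)) = tsum J f.
Proof. by apply: (@tsum_reindex _ (fun i => i - k)) => i; lia. Qed.
Lemma tsum_rev (k : int) f : tsum J (fun i => f (k - i)) = tsum J f.
Proof. by apply: (@tsum_reindex _ (fun i => k - i)) => i; lia. Qed.

(** ** Double sums *)

Definition jvanishing (F : int -> int -> E) := forall N, exists B : nat,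
  forall i j : int, (B <= `|i|)%N || (B <= `|j|)%N -> nbhd0 J N (F i j).
Local Notation jsmall := jvanishing.

Lemma jsmall_row F i : jsmall F -> small (F i).
Proof. by move=> sF N; have [B HB] := sF N; exists B => j Bj; apply: HB; rewrite Bj orbT. Qed.
Lemma jsmallC F : jsmall F -> jsmall (fun i j => F j i).
Proof. by move=> sF N; have [B HB] := sF N; exists B => i j; rewrite orbC; apply: HB. Qed.
Lemma jsmall_tsum F : jsmall F -> small (fun i => tsum J (F i)).
Proof.
move=> sF N; have [B HB] := sF N; exists B => i Bi.
by apply: nbhd_tsum => [|j]; [apply: jsmall_row|apply: HB; rewrite Bi].
Qed.

Let tsum_tsum F N B : jsmall F ->
  (forall i j : int, (B <= `|i|)%N || (B <= `|j|)%N -> nbhd0 J N (F i j)) ->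
  eqJ N (tsum J (fun i => tsum J (F i))) (psum (fun i => psum (F i) B) B).
Proof.
move=> sF HB; apply: eqJ_trans (@tsum_psum _ N B (jsmall_tsum sF) _) _.
  move=> i Bi; apply: nbhd_tsum => [|j]; first exact: jsmall_row.
  by apply: HB; rewrite Bi.
have H i : eqJ N (tsum J (F i)) (psum (F i) B).
  by apply: tsum_psum => [|j Bj]; [apply: jsmall_row|apply: HB; rewrite Bj orbT].
rewrite /eqJ /psum -sumrB; apply: nbhd_sum => k _.
by rewrite opprD addrACA; apply: nbhd0D; apply: H.
Qed.

Lemma tsum_exchange F : jsmall F ->
  tsum J (fun i => tsum J (F i)) = tsum J (fun j => tsum J (fun i => F i j)).
Proof.
move=> sF; apply: eqJ_eq => N; have [B HB] := sF N.
apply: eqJ_trans (tsum_tsum sF HB) _; apply: eqJ_sym.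
apply: eqJ_trans (tsum_tsum (jsmallC sF) _) _; first by move=> i j; rewrite orbC; apply: HB.
rewrite (_ : psum _ _ = psum (fun i => psum (F i) B) B); first exact: eqJ_refl.
rewrite /psum; under eq_bigr do rewrite -big_split /=.
under [RHS]eq_bigr do rewrite -big_split /=.
rewrite exchange_big /=; apply: eq_bigr => i _; apply: eq_bigr => j _.
by rewrite addrACA.
Qed.

Lemma jsmall_shear F : jsmall F -> jsmall (fun i j => F i (j - i)).
Proof.
move=> sF N; have [B HB] := sF N; exists (B + B)%N => i j H; apply: HB.
by apply/orP; case: (leqP B `|i|) => [|iB]; [left|right; lia].
Qed.

Lemma tsum_diag F : jsmall F ->
  tsum J (fun i => tsum J (F i)) = tsum J (fun j => tsum J (fun i => F i (j + i))).
Proof.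
move=> sF; have sF' : jsmall (fun i j => F i (j + i)).
  move=> N; have [B HB] := sF N; exists (B + B)%N => i j H; apply: HB.
  by apply/orP; case: (leqP B `|i|) => [|iB]; [left|right; lia].
rewrite -(tsum_exchange sF'); congr tsum.
by apply/funext => i; rewrite -(tsum_shift i).
Qed.

Lemma tsum_antidiag F : jsmall F ->
  tsum J (fun i => tsum J (F i)) = tsum J (fun j => tsum J (fun i => F i (j - i))).
Proof.
move=> sF; rewrite -(tsum_exchange (jsmall_shear sF)); congr tsum.
by apply/funext => i; rewrite -(tsum_shift (- i)).
Qed.

End Summation.

(** * Operators on distributions in two variables *)

(** The variable z, w or w/z of a series by which distributions in (z,w) are
    multiplied *)
Inductive dir := DZ | DW | DU.

Definition sh1 d (m k : int) : int :=
  match d with DZ => m - k | DW => m | DU => m + k end.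
Definition sh2 d (n k : int) : int :=
  match d with DZ => n | DW | DU => n - k end.

Definition swap (V : Type) (F : int -> int -> V) : int -> int -> V :=
  fun m n => F n m.

Lemma cur_z_neg (V : nmodType) (f : fps V) (k : int) : k < 0 -> cur_z f k = 0.
Proof. by case: k. Qed.

Section Operators.
Variables (K : fieldType) (E : algType K) (J : linear_topology E).
Implicit Types (a b x y X : int -> E) (F G : int -> int -> E) (N : nat) (d : dir).
Implicit Types (f g : fps E) (s : bool).
Local Notation small := (vanishing J).
Local Notation jsmall := (jvanishing J).
Local Notation tsum := (tsum J).

(** The coefficients of a product x(z) y(w) of two currents are small when
    m + n or n is very negative ([s = true]); in general only m + n is
    controlled ([s = false]), which is enough for series in z and in w, but
    not for series in w/z. *)
Definition smooth s F := forall N, exists D : nat, forall m n : int,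
  (m + n <= - D%:Z) || (s && (n <= - D%:Z)) -> nbhd0 J N (F m n).

Definition okdir s d := if d is DU then s else true.

Definition left_current a := forall k : int, k < 0 -> a k = 0.
Definition right_current b := (forall k : int, 0 < k -> b k = 0) /\
  forall N, exists L : nat, forall k : int, k <= - L%:Z -> nbhd0 J N (b k).

Definition lmulc d a F : int -> int -> E := fun m n =>
  tsum (fun k => a k * F (sh1 d m k) (sh2 d n k)).
Definition rmulc d b F : int -> int -> E := fun m n =>
  tsum (fun k => F (sh1 d m k) (sh2 d n k) * b k).
Local Notation lop := lmulc.
Local Notation rop := rmulc.

Lemma smooth_weak s F : smooth s F -> smooth false F.
Proof.
by move=> sF N; have [D HD] := sF N; exists D => m n; rewrite orbF => H; apply: HD; rewrite H.
Qed.
Lemma smooth_swap s F : smooth s F -> smooth false (swap F).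
Proof.
move=> /smooth_weak sF N; have [D HD] := sF N; exists D => m n; rewrite orbF => H.
by apply: HD; rewrite orbF addrC.
Qed.

Lemma small_right b (x : int -> E) : right_current b -> small (fun k => x k * b k).
Proof.
move=> [b0 sb] N; have [L HL] := sb N; exists L => k kL; apply: nbhd0_mull.
have [k0|k0] := lerP k 0; first by apply: HL; lia.
by rewrite b0 //; apply: nbhd0_0.
Qed.

(** Right multiplication by b_j is continuous for each j, and sends everything
    into the given neighbourhood for all but finitely many j. *)
Lemma right_unif b N : right_current b ->
  exists M, forall u, nbhd0 J M u -> forall j, nbhd0 J N (u * b j).
Proof.
move=> [b0 sb]; have [L HL] := sb N.
have [M HM] := boolp.choice (fun k : nat => nbhd0_mulr J N (b (- k%:Z))).
exists (\sum_(k < L) M k)%N => u Mu j.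
have [j0|j0] := ltrP 0 j; first by rewrite b0 // mulr0; apply: nbhd0_0.
have [jL|jL] := lerP j (- L%:Z); first by apply/nbhd0_mull/HL.
have -> : j = - `|j|%N%:Z by lia.
have jL' : (`|j| < L)%N by lia.
apply: (HM `|j|%N); apply: nbhd_le Mu.
by rewrite (bigD1 (Ordinal jL')) //= leq_addr.
Qed.

(** Each step in direction z or w lowers m + n, and each step in direction w/z
    lowers n while keeping m + n; hence two series can be multiplied at once. *)
Lemma lop_jsmall {s d d' a a' F m n} : smooth s F -> left_current a -> left_current a' ->
  okdir s d -> okdir s d' ->
  jsmall (fun k j => a k * (a' j * F (sh1 d' (sh1 d m k) j) (sh2 d' (sh2 d n k) j))).
Proof.
move=> sF la la' od od' N; have [D HD] := sF N.
exists (`|m| + `|n| + D)%N => k j H.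
have [k0|k0] := ltrP k 0; first by rewrite la // mul0r; apply: nbhd0_0.
have [j0|j0] := ltrP j 0; first by rewrite la' // mul0r mulr0; apply: nbhd0_0.
apply/nbhd0_mull/nbhd0_mull/HD.
by move: od od'; case: (s); case: (d); case: (d') => //= _ _; lia.
Qed.

Lemma lop_small {s d a F m n} : smooth s F -> left_current a -> okdir s d ->
  small (fun k => a k * F (sh1 d m k) (sh2 d n k)).
Proof.
move=> sF la od N; have [D HD] := sF N.
exists (`|m| + `|n| + D)%N => k H.
have [k0|k0] := ltrP k 0; first by rewrite la // mul0r; apply: nbhd0_0.
by apply/nbhd0_mull/HD; move: od; case: (s); case: (d) => //= _; lia.
Qed.

Lemma lop_rop_jsmall {s d d' a b F m n} : smooth s F -> left_current a -> right_current b ->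
  okdir s d ->
  jsmall (fun k j => a k * F (sh1 d' (sh1 d m k) j) (sh2 d' (sh2 d n k) j) * b j).
Proof.
move=> sF la rb od N; have [M HM] := right_unif N rb; have [D HD] := sF M.
have [L HL] := rb.2 N.
exists (`|m| + `|n| + D + L + L)%N => k j H.
have [k0|k0] := ltrP k 0; first by rewrite la // !mul0r; apply: nbhd0_0.
have [j0|j0] := ltrP 0 j; first by rewrite rb.1 // mulr0; apply: nbhd0_0.
have [jL|jL] := lerP j (- L%:Z); first by apply/nbhd0_mull/HL.
by apply/HM/nbhd0_mull/HD; move: od; case: (s); case: (d); case: (d') => //= _; lia.
Qed.

Lemma rop_jsmall d d' b b' F m n : right_current b -> right_current b' ->
  jsmall (fun k j => F (sh1 d' (sh1 d m k) j) (sh2 d' (sh2 d n k) j) * b' j * b k).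
Proof.
move=> rb rb' N; have [M HM] := right_unif N rb; have [L HL] := rb'.2 M.
have [L' HL'] := rb.2 N.
exists (L + L')%N => k j H.
have [k0|k0] := ltrP 0 k; first by rewrite rb.1 // mulr0; apply: nbhd0_0.
have [j0|j0] := ltrP 0 j; first by rewrite rb'.1 // mulr0 mul0r; apply: nbhd0_0.
have [kL|kL] := lerP k (- L'%:Z); first by apply/nbhd0_mull/HL'.
by apply/HM/nbhd0_mull/HL; lia.
Qed.

Lemma shC d d' (m k j : int) : sh1 d' (sh1 d m k) j = sh1 d (sh1 d' m j) k /\
  sh2 d' (sh2 d m k) j = sh2 d (sh2 d' m j) k.
Proof. by case: d; case: d' => /=; split; lia. Qed.

Lemma lop_lopC s d d' a a' F : smooth s F -> left_current a -> left_current a' ->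
  okdir s d -> okdir s d' -> (forall i j, GRing.comm (a i) (a' j)) ->
  lop d a (lop d' a' F) = lop d' a' (lop d a F).
Proof.
move=> sF la la' od od' aa'; apply/funext => m; apply/funext => n.
transitivity (tsum (fun k => tsum (fun j =>
    a k * (a' j * F (sh1 d' (sh1 d m k) j) (sh2 d' (sh2 d n k) j))))).
  congr Defs.tsum; apply/funext => k; by rewrite -tsum_mull //; apply: (lop_small sF la' od').
rewrite tsum_exchange; last exact: (lop_jsmall sF la la' od od').
congr Defs.tsum; apply/funext => j; rewrite -tsum_mull; last exact: (lop_small sF la od).
congr Defs.tsum; apply/funext => k.
by rewrite !mulrA aa' (shC d d' m k j).1 (shC d d' n k j).2.
Qed.

Lemma lop_ropC s d d' a b F : smooth s F -> left_current a -> right_current b ->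
  okdir s d -> lop d a (rop d' b F) = rop d' b (lop d a F).
Proof.
move=> sF la rb od; apply/funext => m; apply/funext => n.
transitivity (tsum (fun k => tsum (fun j =>
    a k * F (sh1 d' (sh1 d m k) j) (sh2 d' (sh2 d n k) j) * b j))).
  congr Defs.tsum; apply/funext => k; rewrite -tsum_mull; last exact: small_right.
  by congr Defs.tsum; apply/funext => j; rewrite mulrA.
rewrite tsum_exchange; last exact: (lop_rop_jsmall sF la rb od).
congr Defs.tsum; apply/funext => j; rewrite -tsum_mulr; last exact: (lop_small sF la od).
congr Defs.tsum; apply/funext => k.
by rewrite (shC d d' m k j).1 (shC d d' n k j).2.
Qed.

Lemma rop_ropC d d' b b' F : right_current b -> right_current b' ->
  (forall i j, GRing.comm (b i) (b' j)) ->
  rop d b (rop d' b' F) = rop d' b' (rop d b F).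
Proof.
move=> rb rb' bb'; apply/funext => m; apply/funext => n.
transitivity (tsum (fun k => tsum (fun j =>
    F (sh1 d' (sh1 d m k) j) (sh2 d' (sh2 d n k) j) * b' j * b k))).
  congr Defs.tsum; apply/funext => k; rewrite -tsum_mulr //; exact: small_right.
rewrite tsum_exchange; last exact: rop_jsmall.
congr Defs.tsum; apply/funext => j; rewrite -tsum_mulr; last exact: small_right.
congr Defs.tsum; apply/funext => k.
by rewrite -!mulrA bb' (shC d d' m k j).1 (shC d d' n k j).2.
Qed.

Lemma smooth_lop s d a F : smooth s F -> left_current a -> okdir s d ->
  smooth s (lop d a F).
Proof.
move=> sF la od N; have [D HD] := sF N; exists D => m n H.
apply: nbhd_tsum => [|k]; first exact: (lop_small sF la od).
have [k0|k0] := ltrP k 0; first by rewrite la // mul0r; apply: nbhd0_0.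
by apply/nbhd0_mull/HD; move: od H; case: (s); case: (d) => //= _; lia.
Qed.

Lemma smooth_rop s d b F : smooth s F -> right_current b -> okdir false d ->
  smooth s (rop d b F).
Proof.
move=> sF rb od N; have [M HM] := right_unif N rb; have [D HD] := sF M.
have [L HL] := rb.2 N.
exists (D + L)%N => m n H.
apply: nbhd_tsum => [|k]; first exact: small_right.
have [j0|j0] := ltrP 0 k; first by rewrite rb.1 // mulr0; apply: nbhd0_0.
have [jL|jL] := lerP k (- L%:Z); first by apply/nbhd0_mull/HL.
by apply/HM/HD; move: od H; case: (s); case: (d) => //= _; lia.
Qed.

Lemma lopB s d a F G : smooth s F -> smooth s G -> left_current a -> okdir s d ->
  lop d a (fun m n => F m n - G m n) = fun m n => lop d a F m n - lop d a G m n.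
Proof.
move=> sF sG la od; apply/funext => m; apply/funext => n.
rewrite /lop -tsumB; [|exact: (lop_small sF la od)|exact: (lop_small sG la od)].
by congr Defs.tsum; apply/funext => k; rewrite mulrBr.
Qed.
Lemma ropB d b F G : right_current b ->
  rop d b (fun m n => F m n - G m n) = fun m n => rop d b F m n - rop d b G m n.
Proof.
move=> rb; apply/funext => m; apply/funext => n.
rewrite /rop -tsumB; [|exact: small_right|exact: small_right].
by congr Defs.tsum; apply/funext => k; rewrite mulrBl.
Qed.
Lemma lopZ d a (c : K) F :
  lop d a (fun m n => c *: F m n) = fun m n => c *: lop d a F m n.
Proof.
apply/funext => m; apply/funext => n; rewrite /lop -tsumZ.
by congr Defs.tsum; apply/funext => k; rewrite scalerAr.
Qed.
Lemma ropZ d b (c : K) F :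
  rop d b (fun m n => c *: F m n) = fun m n => c *: rop d b F m n.
Proof.
apply/funext => m; apply/funext => n; rewrite /rop -tsumZ.
by congr Defs.tsum; apply/funext => k; rewrite scalerAl.
Qed.

(** ** Products of series *)

Lemma left_cur_z f : left_current (cur_z f). Proof. exact: cur_z_neg. Qed.

Definition small_fps f := forall N, exists L : nat, forall k, (L <= k)%N -> nbhd0 J N (f k).

Lemma right_cur_zV f : small_fps f -> right_current (cur_zV f).
Proof.
move=> sf; split=> [k k0|N]; first by rewrite /cur_zV left_cur_z //; lia.
have [L HL] := sf N; exists L => k kL; rewrite /cur_zV /cur_z.
case Ek: (- k) => [i|i]; last exact: nbhd0_0.
by apply: HL; lia.
Qed.

Let cauchy_support f g (n k : int) : n < 0 -> cur_z f k * cur_z g (n - k) = 0.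
Proof.
move=> n0; have [k0|k0] := ltrP k 0; first by rewrite left_cur_z // mul0r.
by rewrite [cur_z g _]left_cur_z ?mulr0 //; lia.
Qed.
Let cauchy_support' f g (n : nat) (k : int) : ~~ (0 <= k <= n%:Z) ->
  cur_z f k * cur_z g (n%:Z - k) = 0.
Proof.
move=> H; have [k0|k0] := ltrP k 0; first by rewrite left_cur_z // mul0r.
by rewrite [cur_z g _]left_cur_z ?mulr0 //; lia.
Qed.

Let small_cauchy f g n : small (fun k => cur_z f k * cur_z g (n - k)).
Proof.
move=> N; exists (`|n|.+1) => k kn.
have [n0|n0] := ltrP n 0; first by rewrite cauchy_support //; apply: nbhd0_0.
have -> : n = `|n|%N by lia.
by rewrite cauchy_support' //; [apply: nbhd0_0|lia].
Qed.

Lemma cmul_cur_z f g : cmul J (cur_z f) (cur_z g) = cur_z (f * g).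
Proof.
apply/funext => -[n|n]; rewrite /cmul.
  rewrite (@tsum_finite _ _ _ n) => [|i]; last exact: cauchy_support'.
  rewrite [RHS]coefsM; apply: eq_bigr => i _.
  by rewrite subzn // -ltnS.
rewrite (@tsum_single _ _ _ 0) => [|i _]; exact: cauchy_support.
Qed.

Lemma cmul_cur_zV f g : cmul J (cur_zV f) (cur_zV g) = cur_zV (f * g).
Proof.
apply/funext => n; rewrite /cur_zV -cmul_cur_z /cmul.
rewrite -[LHS](@tsum_rev _ _ _ 0); congr Defs.tsum; apply/funext => i.
by congr (cur_z _ _ * cur_z _ _); lia.
Qed.

Lemma lop_lop_mul s d f g F : smooth s F -> okdir s d ->
  lop d (cur_z f) (lop d (cur_z g) F) = lop d (cur_z (f * g)) F.
Proof.
move=> sF od; apply/funext => m; apply/funext => n.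
have lf := @left_cur_z f; have lg := @left_cur_z g.
transitivity (tsum (fun k => tsum (fun j =>
    cur_z f k * (cur_z g j * F (sh1 d (sh1 d m k) j) (sh2 d (sh2 d n k) j))))).
  by congr Defs.tsum; apply/funext => k; rewrite -tsum_mull //; apply: (lop_small sF lg od).
rewrite tsum_antidiag; last exact: (lop_jsmall sF lf lg od od).
congr Defs.tsum; apply/funext => j; rewrite -cmul_cur_z /cmul -tsum_mulr; last exact: small_cauchy.
congr Defs.tsum; apply/funext => k; rewrite mulrA; congr (_ * F _ _).
  by case: d od => /= _; lia.
by case: d od => /= _; lia.
Qed.

Lemma rop_rop_mul d f g F : small_fps f -> small_fps g ->
  rop d (cur_zV f) (rop d (cur_zV g) F) = rop d (cur_zV (g * f)) F.
Proof.
move=> sf sg; apply/funext => m; apply/funext => n.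
have rf := right_cur_zV sf; have rg := right_cur_zV sg.
transitivity (tsum (fun k => tsum (fun j =>
    F (sh1 d (sh1 d m k) j) (sh2 d (sh2 d n k) j) * cur_zV g j * cur_zV f k))).
  by congr Defs.tsum; apply/funext => k; rewrite -tsum_mulr //; apply: small_right.
rewrite tsum_antidiag; last exact: rop_jsmall.
congr Defs.tsum; apply/funext => j; rewrite -cmul_cur_zV /cmul -tsum_mull; last first.
  move=> N; have [B HB] := small_cauchy g f (- j) N; exists B => i Bi.
  have := HB (- i); rewrite abszN => /(_ Bi); congr (nbhd0 J N (_ * cur_z _ _)); lia.
rewrite -[LHS](tsum_rev _ j); congr Defs.tsum; apply/funext => k.
rewrite -mulrA; congr (F _ _ * (cur_zV _ _ * _)).
- by case: d => /=; lia.
- by case: d => /=; lia.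
by lia.
Qed.

(** ** Distributions supported on a line *)

(** X(e w) times the delta function of (c z) / (e w).  On it, series in z and in
    w act as series in the single variable of X. *)
Definition line (c e : K) X : int -> int -> E := fun m n => (c ^ m * e ^ n) *: X (m + n).

Definition smooth1 X := forall N, exists D : nat, forall n : int, n <= - D%:Z -> nbhd0 J N (X n).

Lemma smooth_line c e X : smooth1 X -> smooth false (line c e X).
Proof.
by move=> sX N; have [D HD] := sX N; exists D => m n; rewrite orbF => H; apply/nbhdZ/HD.
Qed.

Lemma cmul_rop X b n : cmul J X b n = tsum (fun k => X (n - k) * b k).
Proof.
rewrite /cmul -[LHS](tsum_rev _ n); congr Defs.tsum; apply/funext => k.
by rewrite subKr.
Qed.

Lemma lopZ_line c e a X : c != 0 ->
  lop DZ a (line c e X) = line c e (cmul J (dil c^-1 a) X).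
Proof.
move=> c0; apply/funext => m; apply/funext => n; rewrite /line /lop /cmul -tsumZ.
congr Defs.tsum; apply/funext => k /=; rewrite /dil -scalerAr -scalerAl scalerA.
rewrite (addrAC m) exprzDr ?unitfE //; congr (_ *: _).
by rewrite exprz_inv mulrAC.
Qed.
Lemma lopW_line c e a X : e != 0 ->
  lop DW a (line c e X) = line c e (cmul J (dil e^-1 a) X).
Proof.
move=> c0; apply/funext => m; apply/funext => n; rewrite /line /lop /cmul -tsumZ.
congr Defs.tsum; apply/funext => k /=; rewrite /dil -scalerAr -scalerAl scalerA.
rewrite addrA exprzDr ?unitfE //; congr (_ *: _).
by rewrite exprz_inv mulrA.
Qed.
Lemma ropZ_line c e b X : c != 0 ->
  rop DZ b (line c e X) = line c e (cmul J X (dil c^-1 b)).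
Proof.
move=> c0; apply/funext => m; apply/funext => n; rewrite /line cmul_rop /rop -tsumZ.
congr Defs.tsum; apply/funext => k /=; rewrite /dil -scalerAr -scalerAl scalerA.
rewrite (addrAC m) exprzDr ?unitfE //; congr (_ *: _).
by rewrite exprz_inv mulrAC.
Qed.
Lemma ropW_line c e b X : e != 0 ->
  rop DW b (line c e X) = line c e (cmul J X (dil e^-1 b)).
Proof.
move=> c0; apply/funext => m; apply/funext => n; rewrite /line cmul_rop /rop -tsumZ.
congr Defs.tsum; apply/funext => k /=; rewrite /dil -scalerAr -scalerAl scalerA.
rewrite addrA exprzDr ?unitfE //; congr (_ *: _).
by rewrite exprz_inv mulrA.
Qed.

Lemma dil1 X : dil 1 X = X.
Proof. by apply/funext => n; rewrite /dil exp1rz scale1r. Qed.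

Let line1 X Y : line 1 1 X = line 1 1 Y -> X = Y.
Proof.
move=> H; apply/funext => n; have := congr1 (fun F => F n 0) H.
by rewrite /line !exp1rz mulr1 !scale1r addr0.
Qed.

(** Products of currents are not associative in general.  These two cases follow
    from those in two variables, applied to the line z = w. *)
Lemma cmulA_left f g X : smooth1 X ->
  cmul J (cur_z f) (cmul J (cur_z g) X) = cmul J (cur_z (f * g)) X.
Proof.
move=> sX; apply: line1; have o := oner_neq0 K; have sl := smooth_line 1 1 sX.
have := @lop_lop_mul false DZ f g _ sl isT; rewrite !lopZ_line //.
by rewrite invr1 !dil1.
Qed.
Lemma cmulA_right f g X : small_fps f -> small_fps g ->
  cmul J (cmul J X (cur_zV g)) (cur_zV f) = cmul J X (cur_zV (g * f)).
Proof.
move=> sf sg; apply: line1; have o := oner_neq0 K.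
have := @rop_rop_mul DZ f g (line 1 1 X) sf sg; rewrite !ropZ_line //.
by rewrite invr1 !dil1.
Qed.

Lemma cmul_small f X n : smooth1 X -> small (fun k => cur_z f k * X (n - k)).
Proof.
move=> sX; have := @lop_small false DZ (cur_z f) _ n 0 (smooth_line 1 1 sX) (@left_cur_z f) isT.
congr vanishing; apply/funext => k /=; by rewrite /line !exp1rz mulr1 scale1r addr0.
Qed.

End Operators.

(** * Dressed currents *)

Section Dressing.
Variables (K : fieldType) (E : algType K) (J : linear_topology E).
Implicit Types (f g : fps E) (h k : fps K) (x y t : int -> E) (F : int -> int -> E).
Local Notation small := (vanishing J).
Local Notation smooth := (smooth J).
Local Notation smooth1 := (smooth1 J).
Local Notation small_fps := (small_fps J).
Local Notation lop := (lmulc J).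
Local Notation rop := (rmulc J).
Local Notation cmul := (cmul J).

Definition scal h : fps E := Fps (fun n => (h n)%:A).

Lemma scalM h k : scal (h * k) = scal h * scal k.
Proof.
apply: fpsP => n; rewrite coefsM /= scaler_suml; apply: eq_bigr => i _.
by rewrite mulr_algl scalerA.
Qed.

Lemma scal_comm h (u : E) i : GRing.comm u (cur_z (scal h) i).
Proof. by case: i => i /=; [rewrite /GRing.comm mulr_algr mulr_algl|apply: commr0]. Qed.

Lemma mulwzE h F : mulwz J (cur_z h) F = lop DU (cur_z (scal h)) F.
Proof.
apply/funext => m; apply/funext => n; rewrite /mulwz /lmulc; congr tsum.
by apply/funext => -[i|i] /=; rewrite ?mulr_algl // mul0r scale0r.
Qed.
Lemma mulzwE h F : mulzw J (cur_z h) F = swap (mulwz J (cur_z h) (swap F)).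
Proof. by []. Qed.
Lemma swap_lopZ (a : int -> E) F : swap (lop DZ a F) = lop DW a (swap F).
Proof. by []. Qed.
Lemma swap_lopW (a : int -> E) F : swap (lop DW a F) = lop DZ a (swap F).
Proof. by []. Qed.
Lemma swap_ropZ (a : int -> E) F : swap (rop DZ a F) = rop DW a (swap F).
Proof. by []. Qed.
Lemma swap_ropW (a : int -> E) F : swap (rop DW a F) = rop DZ a (swap F).
Proof. by []. Qed.

Lemma cur_z_comm (u : E) f : (forall i, GRing.comm u (f i)) -> forall i, GRing.comm u (cur_z f i).
Proof. by move=> H [i|i]; [apply: H|apply: commr0]. Qed.
Lemma cur_z_fcomm f g : fcomm f g -> forall i j, GRing.comm (cur_z f i) (cur_z g j).
Proof. by move=> H i j; apply: cur_z_comm => l; apply/commr_sym/cur_z_comm => l'; apply: commr_sym. Qed.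
Lemma cur_zV_fcomm f g : fcomm f g -> forall i j, GRing.comm (cur_zV f i) (cur_zV g j).
Proof. by move=> H i j; apply: cur_z_fcomm. Qed.

Lemma zw_lopZ f x y : smooth1 x -> zw (cmul (cur_z f) x) y = lop DZ (cur_z f) (zw x y).
Proof.
move=> sx; apply/funext => m; apply/funext => n.
rewrite /zw -tsum_mulr; last exact: cmul_small.
by congr tsum; apply/funext => i; rewrite mulrA.
Qed.

Lemma zw_lopW f x t : smooth1 x -> (forall m j, GRing.comm (t m) (f j)) ->
  zw t (cmul (cur_z f) x) = lop DW (cur_z f) (zw t x).
Proof.
move=> sx tf; apply/funext => m; apply/funext => n.
rewrite /zw -tsum_mull; last exact: cmul_small.
by congr tsum; apply/funext => i; rewrite !mulrA (cur_z_comm (tf m)).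
Qed.

Lemma zw_ropW g y t : small_fps g -> zw t (cmul y (cur_zV g)) = rop DW (cur_zV g) (zw t y).
Proof.
move=> sg; apply/funext => m; apply/funext => n.
rewrite /zw cmul_rop -tsum_mull; last by apply: small_right; apply: right_cur_zV.
by congr tsum; apply/funext => i; rewrite mulrA.
Qed.

Lemma exch_cur_zV g x h i n : exch g x h -> cur_zV g i * x n =
  tsum J (fun l => (cur_z h l)%:A * (x (n - l) * cur_zV g (i + l))).
Proof.
move=> ex; rewrite /cur_zV; have [i0|i0] := ltrP 0 i.
  rewrite left_cur_z ?mul0r; last by lia.
  rewrite (@tsum_single _ _ _ 0) /= ?addr0 => [|l l0].
    by rewrite [cur_z g _]left_cur_z ?mulr0 //; lia.
  have [l1|l1] := ltrP l 0; first by rewrite (cur_z_neg h) // scale0r mul0r.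
  by rewrite [cur_z g _]left_cur_z ?mulr0 //; lia.
have -> : i = - `|i|%N%:Z by lia.
move: `|i|%N => {i0}i; rewrite opprK /= ex (@tsum_finite _ _ _ i) => [|l il].
  apply: eq_bigr => l _; rewrite mulr_algl /=.
  congr (_ *: (_ * _)); have := ltn_ord l.
  have -> : - (- i%:Z + l%:Z) = (i - l)%N%:Z by have := ltn_ord l; lia.
  by [].
have [l1|l1] := ltrP l 0; first by rewrite (cur_z_neg h) // scale0r mul0r.
by rewrite [cur_z g _]left_cur_z ?mulr0 //; lia.
Qed.

(** For each coefficient of g the exchange relation is a finite sum, and summing
    over these coefficients is a change of the order of summation. *)
Lemma zw_exch g h y x : small_fps g -> exch g x h -> smooth true (zw y x) ->
  zw (cmul y (cur_zV g)) x = lop DU (cur_z (scal h)) (rop DZ (cur_zV g) (zw y x)).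
Proof.
move=> sg ex syx; have rg := right_cur_zV sg.
have js m n : jvanishing J (fun i j => cur_z (scal h) i *
    (zw y x) (sh1 DZ (sh1 DU m i) j) (sh2 DZ (sh2 DU n i) j) * cur_zV g j).
  by have := @lop_rop_jsmall _ _ J true DU DZ (cur_z (scal h)) _ _ m n syx (@left_cur_z _ _ _) rg isT.
apply/funext => m; apply/funext => n.
rewrite /zw cmul_rop -tsum_mulr; last exact: small_right.
transitivity (tsum J (fun i => tsum J (fun l =>
   cur_z (scal h) l * (y (m + l - (i + l)) * x (n - l)) * cur_zV g (i + l)))).
  congr tsum; apply/funext => i; rewrite -mulrA (exch_cur_zV _ _ ex) -tsum_mull.
    congr tsum; apply/funext => l.
    have -> : m + l - (i + l) = m - i by lia.
    have -> : (cur_z h l)%:A = cur_z (scal h) l by case: l => l //=; rewrite scale0r.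
    by rewrite !mulrA; congr (_ * _ * _); rewrite scal_comm.
  move=> N; exists (`|i|.+1) => l il.
  have [l1|l1] := ltrP l 0; first by rewrite (cur_z_neg h) // scale0r mul0r; apply: nbhd0_0.
  by rewrite /cur_zV [cur_z g _]left_cur_z ?mulr0; [apply: nbhd0_0|lia].
rewrite -(tsum_diag (js m n)).
congr tsum; apply/funext => l; rewrite -tsum_mull; last exact: small_right.
by congr tsum; apply/funext => i; rewrite mulrA.
Qed.

Definition dress f x g := cmul (cmul (cur_z f) x) (cur_zV g).

(** The normally ordered product of the dressing factors of two currents, where
    F stands for the product of the bare currents or their commutator *)
Definition dress2 f g f' g' F :=
  rop DW (cur_zV g') (rop DZ (cur_zV g) (lop DW (cur_z f') (lop DZ (cur_z f) F))).

Section Product.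
Variables (f g f' g' : fps E) (x x' : int -> E) (h : fps K).
Hypotheses (sg : small_fps g) (sg' : small_fps g').
Hypotheses (sx : smooth1 x) (sx' : smooth1 x') (sxx : smooth true (zw x x')).
Hypothesis tf' : forall m j, GRing.comm (dress f x g m) (f' j).
Hypothesis gx' : exch g x' h.

Lemma zw_dress : zw (dress f x g) (dress f' x' g') =
  rop DW (cur_zV g') (lop DW (cur_z f') (lop DU (cur_z (scal h))
    (rop DZ (cur_zV g) (lop DZ (cur_z f) (zw x x'))))).
Proof.
rewrite {2}/dress zw_ropW // zw_lopW // /dress (zw_exch sg gx') zw_lopZ //.
by apply: smooth_lop => //; apply: left_cur_z.
Qed.

Lemma mulwz_dress k : mulwz J (cur_z k) (zw (dress f x g) (dress f' x' g')) =
  dress2 f g f' g' (mulwz J (cur_z (k * h)) (zw x x')).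
Proof.
have [rg rg'] := (right_cur_zV sg, right_cur_zV sg').
have lf := @left_cur_z _ _ f; have lf' := @left_cur_z _ _ f'.
have lk := @left_cur_z _ _ (scal k); have lkh := @left_cur_z _ _ (scal (k * h)).
have lh := @left_cur_z _ _ (scal h).
rewrite mulwzE zw_dress mulwzE.
set F := zw x x'.
have s1 : smooth true (lop DZ (cur_z f) F) by apply: smooth_lop.
have s2 : smooth true (rop DZ (cur_zV g) (lop DZ (cur_z f) F)) by apply: smooth_rop.
have s3 := smooth_lop s2 lh (isT : okdir true DU).
have s4 := smooth_lop s3 lf' (isT : okdir true DW).
rewrite (lop_ropC _ s4) // (lop_lopC s3) //; last by move=> i j; apply/commr_sym/scal_comm.
rewrite (lop_lop_mul _ _ s2) // -scalM (lop_ropC _ s1) //.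
rewrite (@lop_lopC _ _ _ _ DU DZ _ _ _ sxx) //; last by move=> i j; apply/commr_sym/scal_comm.
rewrite /dress2; congr rmulc; rewrite (@lop_ropC _ _ _ true) //.
by do 2 (apply: smooth_lop => //).
Qed.

End Product.

Lemma swap_dress2 s f g f' g' F : small_fps g -> small_fps g' -> fcomm f f' ->
  fcomm g g' -> smooth s F ->
  swap (dress2 f g f' g' F) = dress2 f' g' f g (swap F).
Proof.
move=> sg sg' ff' gg' sF; have [rg rg'] := (right_cur_zV sg, right_cur_zV sg').
have lf := @left_cur_z _ _ f; have lf' := @left_cur_z _ _ f'.
rewrite /dress2 swap_ropW swap_ropZ swap_lopW swap_lopZ.
rewrite (rop_ropC _ _ _ rg' rg); last by move=> i j; apply/commr_sym/cur_zV_fcomm.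
congr (rmulc _ _ _ (rmulc _ _ _ _)).
rewrite (lop_lopC (smooth_swap sF)) // => i j.
by apply/commr_sym/cur_z_fcomm.
Qed.

Lemma dress2B s f g f' g' F G : small_fps g -> small_fps g' ->
  smooth s F -> smooth s G ->
  dress2 f g f' g' (fun m n => F m n - G m n) =
  fun m n => dress2 f g f' g' F m n - dress2 f g f' g' G m n.
Proof.
move=> sg sg' sF sG; have [rg rg'] := (right_cur_zV sg, right_cur_zV sg').
have lf := @left_cur_z _ _ f; have lf' := @left_cur_z _ _ f'.
rewrite /dress2 (lopB sF sG) // (@lopB _ _ _ s) ?ropB //; exact: smooth_lop.
Qed.

Lemma dress2Z f g f' g' c F : dress2 f g f' g' (fun m n => c *: F m n) =
  fun m n => c *: dress2 f g f' g' F m n.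
Proof. by rewrite /dress2 !lopZ !ropZ. Qed.

(** Both orders of the product have the same normally ordered dressing
    ([swap_dress2]), and differ by the bare product and by the scalar factors h
    and h' picked up in normal ordering. *)
Theorem dress_commutator f g f' g' x x' h h' k :
  small_fps g -> small_fps g' -> smooth1 x -> smooth1 x' ->
  smooth true (zw x x') -> smooth true (zw x' x) ->
  (forall m j, GRing.comm (dress f x g m) (f' j)) ->
  (forall m j, GRing.comm (dress f' x' g' m) (f j)) ->
  fcomm f f' -> fcomm g g' -> exch g x' h -> exch g' x h' ->
  forall m n,
  mulwz J (cur_z k) (zw (dress f x g) (dress f' x' g')) m n -
  mulzw J (cur_z k) (wz (dress f' x' g') (dress f x g)) m n =
  dress2 f g f' g' (fun m n => mulwz J (cur_z (k * h)) (zw x x') m n -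
                    mulzw J (cur_z (k * h')) (wz x' x) m n) m n.
Proof.
move=> sg sg' sx sx' sxx sxx' tf' tf ff' gg' gx' gx m n.
have lop_s e (y y' : int -> E) : smooth true (zw y y') -> smooth true (mulwz J (cur_z e) (zw y y')).
  by move=> s; rewrite mulwzE; apply: smooth_lop => //; apply: left_cur_z.
rewrite mulzwE (mulwz_dress sg sg' sx sx' sxx tf' gx').
have -> : swap (wz (dress f' x' g') (dress f x g)) = zw (dress f' x' g') (dress f x g) by [].
rewrite (mulwz_dress sg' sg sx' sx sxx' tf gx).
rewrite (@swap_dress2 true) //; last exact: lop_s; last first.
- by move=> i j; apply: commr_sym.
- by move=> i j; apply: commr_sym.
rewrite (@dress2B false) //; first by apply/smooth_weak/lop_s/sxx.
by apply: (@smooth_swap _ _ _ true); apply: (lop_s _ x' x).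
Qed.

Lemma dress2_line f g f' g' c e X : c != 0 -> e != 0 ->
  dress2 f g f' g' (line c e X) = line c e
    (cmul (cmul (cmul (dil e^-1 (cur_z f')) (cmul (dil c^-1 (cur_z f)) X))
      (dil c^-1 (cur_zV g))) (dil e^-1 (cur_zV g'))).
Proof.
by move=> c0 e0; rewrite /dress2 lopZ_line // lopW_line // ropZ_line // ropW_line.
Qed.

(** ** Dilations *)

Definition fdil (c : K) f : fps E := Fps (fun n => c ^+ n *: f n).

Lemma dil_cur_z c f : dil c (cur_z f) = cur_z (fdil c f).
Proof. by apply/funext => -[n|n]; rewrite /dil //= scaler0. Qed.
Lemma dil_cur_zV c f : dil c (cur_zV f) = cur_zV (fdil c^-1 f).
Proof.
apply/funext => n; rewrite /dil /cur_zV.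
case Ei: (- n) => [i|i] /=; last by rewrite scaler0.
have -> : n = - i%:Z by rewrite -Ei opprK.
by rewrite exprVn exprnN.
Qed.
Lemma dil_cmul c (x y : int -> E) : c != 0 -> dil c (cmul x y) = cmul (dil c x) (dil c y).
Proof.
move=> c0; apply/funext => n; rewrite /dil /Defs.cmul -tsumZ; congr tsum.
apply/funext => i; rewrite -scalerAr -scalerAl scalerA -exprzDr ?unitfE //.
by rewrite subrK.
Qed.
Lemma fdilM c f g : fdil c (f * g) = fdil c f * fdil c g.
Proof.
apply: fpsP => n; rewrite /= scaler_sumr; apply: eq_bigr => i _.
have le_in : (i <= n)%N by rewrite -ltnS.
by rewrite -scalerAr -scalerAl scalerA -exprD subnK.
Qed.
Lemma fdil_fdil c e f : fdil c (fdil e f) = fdil (c * e) f.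
Proof. by apply: fpsP => n; rewrite /= scalerA exprMn. Qed.
Lemma fcomm_fdil c e f g : fcomm f g -> fcomm (fdil c f) (fdil e g).
Proof. by move=> H i j; apply: commZ; apply/commr_sym/commZ/commr_sym. Qed.
Lemma small_fdil c f : small_fps f -> small_fps (fdil c f).
Proof. by move=> sf N; have [L HL] := sf N; exists L => i /HL; apply: nbhdZ. Qed.

End Dressing.

(** * Logarithmic derivatives of scalar series *)

Section ScalarSeries.
Variable K : fieldType.
Implicit Types (f g h l : fps K) (a b c : K).

Definition logder f l := theta f = l * f.

Lemma logderM f g l l' : logder f l -> logder g l' -> logder (f * g) (l + l').
Proof. by rewrite /logder => Ef Eg; rewrite thetaM Ef Eg; ring. Qed.

Lemma logderV f g l : f * g = 1 -> logder f l -> logder g (- l).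
Proof.
rewrite /logder => fg Ef.
have H : f * theta g = - l.
  apply/eqP; rewrite -addr_eq0 addrC; apply/eqP.
  by rewrite -(theta1 K) -fg thetaM Ef -mulrA fg mulr1.
by rewrite -[LHS]mul1r -fg mulrAC H.
Qed.

Lemma theta_scale c f : theta (fps_scale c f) = fps_scale c (theta f).
Proof. by apply: fpsP => n; rewrite /= mulrnAr. Qed.
Lemma fps_scaleM c f g : fps_scale c (f * g) = fps_scale c f * fps_scale c g.
Proof.
apply: fpsP => n; rewrite /= mulr_sumr; apply: eq_bigr => i _.
have le_in : (i <= n)%N by rewrite -ltnS.
by rewrite mulrACA -exprD subnKC.
Qed.
Lemma logder_scale c f l : logder f l -> logder (fps_scale c f) (fps_scale c l).
Proof. by rewrite /logder => Ef; rewrite theta_scale Ef fps_scaleM. Qed.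
Lemma fps_scale_scale a b f : fps_scale a (fps_scale b f) = fps_scale (a * b) f.
Proof. by apply: fpsP => n; rewrite /= exprMn mulrA. Qed.

(** The series 1 - aX, its inverse, and the logarithmic derivative of the
    latter *)
Definition lin a : fps K := 1 - fps_const a * fpsX K.
Definition geo a : fps K := Fps (fun n => a ^+ n).
Definition lam a : fps K := Fps (fun n => if n == 0 then 0 else a ^+ n).

Lemma coefs_lin f a n : (f * lin a) n = f n - if n is m.+1 then a * f m else 0.
Proof.
rewrite /lin mulrBr mulr1 coefsB mulrCA coefsCM fps_mulX.
by case: n => //; rewrite mulr0.
Qed.

Lemma coefs_lin0 f a : (f * lin a) 0 = f 0.
Proof. by rewrite coefs_lin subr0. Qed.
Lemma coefs_linS f a n : (f * lin a) n.+1 = f n.+1 - a * f n.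
Proof. by rewrite coefs_lin. Qed.

Lemma geo_lin a : geo a * lin a = 1.
Proof.
apply: fpsP => n; rewrite coefs_lin coefs1; case: n => [|n] /=.
  by rewrite expr0 subr0.
by rewrite exprS subrr.
Qed.

Lemma logder_lin a : logder (lin a) (- lam a).
Proof.
apply: fpsP => n; rewrite [LHS](_ : _ = lin a n *+ n) // mulNr coefsN coefs_lin.
rewrite -[lin a]mul1r coefs_lin !coefs1; case: n => [|[|n]] /=.
- by rewrite mulr0n subr0 oppr0.
- by rewrite mulr1n mulr0 !subr0 mulr1 expr1 sub0r.
by rewrite !mulr0 subr0 mul0rn exprS subrr oppr0.
Qed.

Lemma logder_geo a : logder (geo a) (lam a).
Proof.
have H : lin a * geo a = 1 by rewrite mulrC geo_lin.
by have := logderV H (logder_lin a); rewrite opprK.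
Qed.

Lemma fps_of_polyM (u v : {poly K}) : fps_of_poly (u * v) = fps_of_poly u * fps_of_poly v.
Proof. by apply: fpsP => n; rewrite /= coefM. Qed.
Lemma fps_of_poly_lin a : fps_of_poly (1 - a *: 'X) = lin a.
Proof.
apply: fpsP => n; rewrite -[lin a]mul1r coefs_lin coefs1 /=.
rewrite coefB coef1 coefZ coefX; case: n => [|[|n]] /=.
- by rewrite mulr0.
- by [].
by rewrite !mulr0.
Qed.

Hypothesis char0 : forall n, n.+1%:R != 0 :> K.

Lemma field_torsion_free : torsion_free K.
Proof. exact: (@alg_torsion_free K K^o char0). Qed.

Lemma logder_uniq f g l : l 0 = 0 -> logder f l -> logder g l -> f 0 = g 0 -> f = g.
Proof. exact: ode_uniq field_torsion_free. Qed.

Definition sexp (l : fps K) : fps K := @fps_exp K K^o l.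

Lemma logder_sexp l : l 0 = 0 -> logder (sexp l) (theta l).
Proof.
by move=> l0; apply: (@theta_exp K K^o char0 l l0) => i j; apply: mulrC.
Qed.
Lemma sexp0 l : sexp l 0 = 1.
Proof. exact: (@fps_exp0 K K^o). Qed.

Section Structure.
Variables q t : K.
Hypotheses (q0 : q != 0) (t0 : t != 0).

Definition Gpol (q t : K) : {poly K} :=
  (1 - q *: 'X) * (1 - t^-1 *: 'X) * (1 - (q^-1 * t) *: 'X).

Lemma fps_Gpol : fps_of_poly (Gpol q t) = lin q * lin t^-1 * lin (q^-1 * t).
Proof. by rewrite /Gpol !fps_of_polyM !fps_of_poly_lin. Qed.

Lemma coefs_Gpol n : fps_of_poly (Gpol q t) n =
  match n with
  | 0 => 1
  | 1 => - (q + t^-1 + q^-1 * t)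
  | 2 => q * t^-1 + t + q^-1
  | 3 => - 1
  | _ => 0
  end.
Proof.
rewrite fps_Gpol -[lin q]mul1r.
case: n => [|[|[|[|n]]]]; rewrite ?coefs_linS ?coefs_lin0 ?coefs1 /=.
- by [].
- by ring.
- by field; rewrite q0 t0.
- by field; rewrite q0 t0.
by case: n => [|[|[|n]]]; rewrite ?coefs_linS ?coefs_lin0 ?coefs1 /=; ring.
Qed.

End Structure.

Lemma GpolV (q t : K) : q != 0 -> t != 0 -> forall n, (n <= 3)%N ->
  fps_of_poly (Gpol q^-1 t^-1) n = - fps_of_poly (Gpol q t) (3 - n)%N.
Proof.
move=> q0 t0 n n3; rewrite !coefs_Gpol ?invr_eq0 // !invrK.
by case: n n3 => [|[|[|[|n]]]] //= _; field; rewrite ?q0 ?t0.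
Qed.

End ScalarSeries.

(** * Delta functions from a quadratic relation *)

Section Quadratic.
Variables (K : fieldType) (E : algType K) (J : linear_topology E).
Hypothesis char0 : forall n, n.+1%:R != 0 :> K.
Variables q t : K.
Hypotheses (q0 : q != 0) (t0 : t != 0) (q1 : q != 1) (t1 : t != 1).
Local Notation p := (q / t).
Hypotheses (p1 : p != 1) (p2 : p ^+ 2 != 1).
Local Notation small := (vanishing J).
Local Notation tsum := (tsum J).

Let p0 : p != 0. Proof. by rewrite mulf_neq0 ?invr_eq0. Qed.
Let tq0 : t - q != 0.
Proof.
by rewrite subr_eq0; apply: contraNneq p1 => ->; rewrite divff.
Qed.
Let tq2 : t ^+ 2 - q ^+ 2 != 0.
Proof.
rewrite subr_eq0; apply: contraNneq p2 => E2; rewrite expr_div_n -E2 divff //.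
by rewrite expf_neq0.
Qed.

(** The partial fraction formula for the coefficients of
    1 / ((1 - u) (1 - p u) (1 - u / p)) makes sense for all integers, and the
    expansion of the same rational function in powers of 1/u involves its values
    at negative integers. *)
Let A1 := ((1 - p) * (1 - p^-1))^-1.
Let A2 := ((1 - p^-1) * (1 - p ^- 2))^-1.
Let A3 := ((1 - p) * (1 - p ^+ 2))^-1.
Let ecoef (k : int) : K := A1 + A2 * p ^ k + A3 * p ^ (- k).

Definition poles : fps K := geo 1 * geo p * geo p^-1.

Let A1E : A1 = - (q * t) / (t - q) ^+ 2.
Proof. by rewrite /A1; field; rewrite q0 t0 -(opprB t q) oppr_eq0 tq0. Qed.
Let A2E : A2 = q ^+ 3 / ((t - q) * (t ^+ 2 - q ^+ 2)).
Proof.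
by rewrite /A2; field; rewrite q0 t0 -(opprB t q) -(opprB (t ^+ 2)) !oppr_eq0 tq0 tq2.
Qed.
Let A3E : A3 = t ^+ 3 / ((t - q) * (t ^+ 2 - q ^+ 2)).
Proof. by rewrite /A3; field; rewrite t0 tq0 tq2. Qed.

Let ecoef_m1 : ecoef (-1) = 0.
Proof.
rewrite /ecoef opprK expr1z exprN1 A1E A2E A3E; field.
by rewrite q0 t0 tq0 tq2.
Qed.
Let ecoef_m2 : ecoef (-2) = 0.
Proof.
rewrite /ecoef opprK (_ : p ^ 2 = p ^+ 2) // (_ : p ^ (-2) = p ^- 2) //.
rewrite A1E A2E A3E; field.
by rewrite q0 t0 tq0 tq2.
Qed.
Let ecoef_rev k : ecoef (- 3 - k) = ecoef k.
Proof.
rewrite /ecoef opprB !exprzDr ?unitfE // opprK.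
rewrite (_ : p ^ (-3) = p ^- 3) // (_ : p ^ 3 = p ^+ 3) // -!invr_expz A1E A2E A3E.
have := expfz_neq0 k p0; move: (p ^ k) => u u0; field.
by rewrite q0 t0 tq0 tq2 u0.
Qed.

Let polesE (n : nat) : poles n = ecoef n.
Proof.
pose e : fps K := Fps (fun n => ecoef n%:Z).
suff -> : poles = e by [].
have H : e * lin 1 * lin p = geo p^-1.
  apply: fpsP => {}n; case: n => [|n]; rewrite ?coefs_linS ?coefs_lin0.
    rewrite /= expr0 /ecoef oppr0 !expr0z A1E A2E A3E; field.
    by rewrite tq0 tq2.
  rewrite mul1r coefs_lin.
  (* There is no boundary term, because the formula vanishes at -1. *)
  have -> : (if n is m.+1 then 1 * e m else 0) = ecoef (n%:Z - 1).
    case: n => [|n]; first by rewrite sub0r ecoef_m1.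
    by rewrite mul1r (_ : n.+1%:Z - 1 = n%:Z) //; clear; lia.
  rewrite /= /ecoef exprVn exprSr invfM exprnN.
  have -> : n.+1%:Z = n%:Z + 1 by (clear; lia).
  rewrite !opprD opprK !exprzDr ?unitfE // !expr1z !exprN1 -invr_expz.
  have := expfz_neq0 n p0; move: (p ^ n) => u u0.
  rewrite A1E A2E A3E; field.
  by rewrite q0 t0 tq0 tq2 u0.
rewrite /poles -H.
transitivity (e * (geo 1 * lin 1) * (geo p * lin p)); first by ring.
by rewrite !geo_lin !mulr1.
Qed.

Variable x : int -> E.
Let F := zw x x.
Hypothesis sxx : smooth J true F.
Hypothesis rel : mulzw J (cur_z (fps_of_poly (Gpol q^-1 t^-1))) (zw x x) =
                 mulzw J (cur_z (fps_of_poly (Gpol q t))) (wz x x).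

Let G := fps_of_poly (Gpol q t).
Let rho := mulwz J (cur_z G) F.

Let smooth_rho : smooth J true rho.
Proof. by rewrite /rho mulwzE; apply: smooth_lop => //; apply: left_cur_z. Qed.

Let rho_swap m n : mulzw J (cur_z (fps_of_poly (Gpol q^-1 t^-1))) F m n = rho n m.
Proof. by rewrite /F rel mulzwE. Qed.

(** The polynomial on the left hand side of the quadratic relation is, up to
    sign, that on the right hand side read backwards ([GpolV]); so the relation
    says that rho(z,w) is antisymmetric up to a factor (w/z)^3. *)
Let rho_anti m n : rho n m = - rho (m - 3) (n + 3).
Proof.
rewrite -rho_swap /mulzw /rho /mulwz.
have sup (f : fps K) (c : int -> E) (k : int) : (forall n, (3 < n)%N -> f n = 0) ->
   ~~ (0 <= k <= 3%N%:Z) -> cur_z f k *: c k = 0.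
  move=> f3 k3; case: k k3 => k k3 /=; last by rewrite scale0r.
  by rewrite f3 ?scale0r //; clear -k3; lia.
have G3 (u v : K) : u != 0 -> v != 0 -> forall n, (3 < n)%N -> fps_of_poly (Gpol u v) n = 0.
  by move=> u0 v0 k k3; rewrite coefs_Gpol //; case: k k3 => [|[|[|[|k]]]].
rewrite (@tsum_finite _ _ _ 3) => [|k]; last first.
  by apply: (sup _ (fun k => F (m - k) (n + k))); apply: G3; rewrite invr_eq0.
rewrite (@tsum_finite _ _ _ 3) => [|k]; last first.
  by apply: (sup _ (fun k => F (m - 3 + k) (n + 3 - k))); apply: G3.
rewrite -sumrN (reindex_inj rev_ord_inj); apply: eq_bigr => i _.
have i3 : (i <= 3)%N by rewrite -ltnS.
have -> : nat_of_ord (rev_ord i) = (3 - i)%N by rewrite /= subSS.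
have -> : cur_z (fps_of_poly (Gpol q^-1 t^-1)) (3 - i)%N = - G i.
  by have := GpolV q0 t0 (leq_subr i 3); rewrite subKn.
rewrite scaleNr; congr (- (_ *: F _ _)); clear -i3; lia.
Qed.

Let small_rho (c : int -> K) (d : int) : small (fun i => c i *: rho i (d - i)).
Proof.
move=> N; have [D HD] := smooth_rho N.
exists (`|d| + D + 3)%N => i iB; apply: nbhdZ.
have [i0|i0] := lerP 0 i; first by apply: HD; clear -iB i0; lia.
rewrite rho_anti; apply: nbhdN; apply: HD; clear -iB i0; lia.
Qed.

Let Z (c : K) (d : int) := tsum (fun i => c ^ i *: rho i (d - i)).

Let Z_rev c (d : int) : c != 0 -> Z c d = - (c ^ (d - 3) *: Z c^-1 d).
Proof.
move=> c0; rewrite /Z -tsumZ -scaleN1r -tsumZ -[LHS](tsum_rev _ (d - 3)).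
congr Defs.tsum; apply/funext => i; rewrite rho_anti scalerN scaleN1r scalerA.
rewrite exprz_inv -exprzDr ?unitfE //.
rewrite (_ : d - (d - 3 - i) - 3 = i); last by clear; lia.
by rewrite (_ : d - 3 - i + 3 = d - i) //; clear; lia.
Qed.

Let Z1 (d : int) : Z 1 d = 0.
Proof.
have := Z_rev d (oner_neq0 K); rewrite invr1 exp1rz scale1r => /eqP.
rewrite -addr_eq0 -mulr2n => /eqP H.
exact: (alg_torsion_free char0 H).
Qed.

Let Gpol_p : (Gpol q^-1 t^-1).[p] = (1 - t^-1) * (1 - q) * (1 - p ^+ 2).
Proof.
rewrite /Gpol !hornerM !hornerD !hornerN !hornerZ !hornerX !hornerC.
by field; rewrite q0 t0 oner_neq0.
Qed.

Let fuseE (d : int) : fuse J (Gpol q^-1 t^-1) p x d =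
  ((1 - t^-1) * (1 - q) * (1 - p ^+ 2))^-1 *: (p ^ d *: Z p^-1 d).
Proof.
rewrite /fuse Gpol_p; congr (_ *: _); rewrite /Z -tsumZ -[LHS](tsum_rev _ d).
congr Defs.tsum; apply/funext => i; rewrite rho_swap scalerA exprz_inv -exprzDr ?unitfE //.
by rewrite (_ : d - (d - i) = i) //; clear; lia.
Qed.

Lemma smooth1_fuse : smooth1 J (fuse J (Gpol q^-1 t^-1) p x).
Proof.
move=> N; have [D HD] := smooth_rho N; exists D => d dD; rewrite fuseE.
apply/nbhdZ/nbhdZ/nbhd_tsum => [|i]; first exact: small_rho.
by apply/nbhdZ/HD; clear -dD; lia.
Qed.

Let tsum_poles m n : mulwz J (cur_z (poles * G)) F m n -
    mulzw J (cur_z (poles * G)) (wz x x) m n =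
  tsum (fun i => ecoef (i - m) *: rho i (m + n - i)).
Proof.
have H : mulwz J (cur_z (poles * G)) F = mulwz J (cur_z poles) rho.
  by rewrite /rho !mulwzE scalM (lop_lop_mul _ _ sxx).
rewrite mulzwE H /swap /mulwz.
have S m' n' : small (fun k => cur_z poles k *: rho (m' + k) (n' - k)).
  have := @lop_small _ _ J true DU (cur_z (scal E poles)) rho m' n' smooth_rho (@left_cur_z _ _ _) isT.
  congr vanishing; apply/funext => -[k|k] /=; by rewrite ?mulr_algl // mul0r scale0r.
rewrite -[X in _ - X](tsum_rev _ (- 3)) -tsumB //; last first.
  move=> N; have [B HB] := S n m N; exists (B + 3)%N => i Bi; apply: HB; clear -Bi; lia.
rewrite -[RHS](tsum_shift _ m); congr Defs.tsum; apply/funext => k.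
rewrite (rho_anti (m - (- 3 - k)) (n + (- 3 - k))) scalerN opprK.
rewrite (_ : m - (-3 - k) - 3 = k + m); last by clear; lia.
rewrite (_ : n + (-3 - k) + 3 = m + n - (k + m)); last by clear; lia.
rewrite (_ : n - k = m + n - (k + m)); last by clear; lia.
(* The exponents k >= 0 come from the first sum and k <= -3 from the second;
   the formula for the coefficients vanishes at the two missing ones. *)
rewrite addrK (addrC m k) -scalerDl; congr (_ *: _).
have [k0|k0] := lerP 0 k.
  rewrite [X in _ + X]cur_z_neg ?addr0; last by clear -k0; lia.
  by case: k k0 => // k _; apply: polesE.
rewrite [X in X + _]cur_z_neg ?add0r //.
have [k3|k3] := lerP k (- 3).
  rewrite -(ecoef_rev k); have : 0 <= - 3 - k by (clear -k3; lia).
  by case: (- 3 - k) => // j _; apply: polesE.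
rewrite cur_z_neg; last by clear -k0 k3; lia.
have [->|->] : k = -1 \/ k = -2 by (clear -k0 k3; lia).
  by rewrite ecoef_m1.
by rewrite ecoef_m2.
Qed.

(** The two expansions of a rational function with simple poles at u = 1, p
    and 1/p differ by three delta functions.  The one at u = 1 does not
    contribute, since rho vanishes on the diagonal by antisymmetry; the other
    two are exchanged by it. *)
Theorem quadratic_delta m n :
  mulwz J (cur_z (poles * fps_of_poly (Gpol q t))) (zw x x) m n -
  mulzw J (cur_z (poles * fps_of_poly (Gpol q t))) (wz x x) m n =
  ((1 - q) * (1 - t^-1) / (1 - p)) *:
    (line 1 p^-1 (fuse J (Gpol q^-1 t^-1) p x) m n -
     line p^-1 1 (fuse J (Gpol q^-1 t^-1) p x) m n).
Proof.
rewrite tsum_poles.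
have -> : tsum (fun i => ecoef (i - m) *: rho i (m + n - i)) =
    A1 *: Z 1 (m + n) + (A2 * p ^ (- m)) *: Z p (m + n) +
    (A3 * p ^ m) *: Z p^-1 (m + n).
  rewrite /Z -!tsumZ -!tsumD; try (by do ![apply: smallZ|apply: smallD|apply: small_rho]).
  congr Defs.tsum; apply/funext => i; rewrite !scalerA -!scalerDl; congr (_ *: _).
  rewrite exp1rz mulr1 /ecoef opprB !exprzDr ?unitfE // -!invr_expz exprz_inv -invr_expz.
  by ring.
rewrite Z1 scaler0 add0r (Z_rev _ p0) /line !fuseE !exp1rz mulr1 mul1r.
rewrite scalerN !scalerA -scaleNr -scalerDl -scalerBl scalerA.
congr (_ *: _); rewrite !exprzDr ?unitfE // !exprz_inv -!invr_expz -[3]/(3%N%:Z) -exprnP.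
have := expfz_neq0 m p0; have := expfz_neq0 n p0; move: (p ^ m) (p ^ n) => u v v0 u0.
have q1' : 1 - q != 0 by rewrite subr_eq0 eq_sym.
have t1' : t - 1 != 0 by rewrite subr_eq0.
rewrite A2E A3E; field.
by rewrite q0 t0 tq0 tq2 q1' t1' u0 v0.
Qed.

End Quadratic.

(** * Logarithms, and eigenvectors of a bracket *)

Section Logs.
Variables (K : fieldType) (E : algType K).
Hypothesis char0 : forall n, n.+1%:R != 0 :> K.
Implicit Types (f g c e : fps E).

(** This says that f = exp c, in a form that is stable under products, inverses
    and dilations as long as the exponents commute. *)
Definition has_log f c := theta f = theta c * f /\ f 0 = 1.

Lemma fcomm_theta c e : fcomm c e -> fcomm (theta c) e.
Proof. by move=> ce i j; apply/commr_sym/commrMn/commr_sym. Qed.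
Lemma fcommC f g : fcomm f g -> fcomm g f.
Proof. by move=> fg i j; apply: commr_sym. Qed.
Lemma fcomm_inv f g : g 0 = 1 -> fcomm f g -> fcomm f (fps_inv g).
Proof. by move=> g0 fg i; apply: comm_inv. Qed.
Lemma fcomm_exp f c : c 0 = 0 -> fcomm f c -> fcomm f (fps_exp c).
Proof. by move=> c0 fc i; apply: comm_exp. Qed.

Lemma has_log_exp c : c 0 = 0 -> fcomm c c -> has_log (fps_exp c) c.
Proof. by move=> c0 cc; split; [apply: theta_exp|apply: fps_exp0]. Qed.

Lemma has_logM f c f' c' : has_log f c -> has_log f' c' -> fcomm c' f ->
  has_log (f * f') (c + c').
Proof.
move=> [Ef f0] [Ef' f'0] cf; split; last by rewrite coefsM0 f0 f'0 mulr1.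
rewrite thetaM thetaD Ef Ef' mulrDl !mulrA.
by rewrite (mulfC (fcomm_theta cf)).
Qed.

Lemma has_logV f c : has_log f c -> fcomm c f -> has_log (fps_inv f) (- c).
Proof.
move=> [Ef f0] cf; split; last exact: fps_inv0.
have V := mulVfps f0; have V' := mulfpsV f0.
have H : theta (fps_inv f) * f + fps_inv f * theta f = 0 by rewrite -thetaM V theta1.
have cg : fps_inv f * theta c = theta c * fps_inv f.
  by apply/esym/mulfC/fcomm_theta/fcomm_inv.
rewrite -[LHS]mulr1 -V' mulrA.
have -> : theta (fps_inv f) * f = - theta c.
  apply/eqP; rewrite -addr_eq0 -[theta c]mulr1 -V mulrA -cg -mulrA -Ef.
  by rewrite H.
by rewrite thetaN mulNr.
Qed.

Lemma has_log_dil f c (k : K) : has_log f c -> has_log (fdil k f) (fdil k c).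
Proof.
have td h : theta (fdil k h) = fdil k (theta h).
  by apply: fpsP => n; rewrite /= scalerMnr.
move=> [Ef f0]; split; first by rewrite !td Ef fdilM.
by rewrite /= expr0 scale1r.
Qed.

Lemma has_log0 f : has_log f 0 -> f = 1.
Proof.
move=> [Ef f0]; apply: (@ode_uniq _ 0) => //.
- exact: alg_torsion_free.
- by rewrite Ef theta0.
by rewrite theta1 mul0r.
Qed.

Lemma fbr_dil (y : E) f k s (r : K) : fbr y f = kX E k s * f ->
  fbr y (fdil r f) = kX E (k * r ^+ s) s * fdil r f.
Proof.
move=> H; apply: fpsP => n; rewrite fbrE kXE /=.
have := congr1 (fun f : fps E => f n) H; rewrite fbrE kXE => H'.
rewrite -scalerAr -scalerAl -scalerBr H'; case: ltnP => sn; first by rewrite scaler0.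
by rewrite !scalerA; congr (_ *: _); rewrite -{1}(subnK sn) exprD; ring.
Qed.

End Logs.

Section Eigen.
Variables (K : fieldType) (E : algType K) (J : linear_topology E).
Implicit Types (a x : int -> E) (f g : fps E) (y : E) (k : K).
Local Notation small := (vanishing J).

(** The generating function form is [y, a(z)] = k z^s a(z). *)
Definition eig y (s : int) k a := forall m, y * a m - a m * y = k *: a (m - s).

Lemma eig_comm y s a : (forall m, GRing.comm y (a m)) <-> eig y s 0 a.
Proof.
split=> H m; first by rewrite H subrr scale0r.
by have /eqP := H m; rewrite scale0r subr_eq0 => /eqP.
Qed.

Lemma eig_cur_z y s k f : fbr y f = kX E k s * f -> eig y s%:Z k (cur_z f).
Proof.
move=> H m; case: m => [n|n]; last first.
  by rewrite !cur_z_neg ?mulr0 ?mul0r ?subrr ?scaler0 //; lia.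
have := congr1 (fun f : fps E => f n) H; rewrite fbrE kXE => -> .
case: ltnP => ns; first by rewrite cur_z_neg ?scaler0 //; lia.
by rewrite subzn.
Qed.

Lemma eig_cur_zV y s k f : fbr y f = kX E k s * f -> eig y (- s%:Z) k (cur_zV f).
Proof. by move=> /eig_cur_z H m; rewrite /cur_zV H; congr (_ *: cur_z _ _); lia. Qed.

Lemma eig_cmul y s k k' a x : eig y s k a -> eig y s k' x ->
  (forall n, small (fun i => a i * x (n - i))) -> eig y s (k + k') (cmul J a x).
Proof.
move=> ya yx sm m; rewrite /cmul -tsum_mull // -tsum_mulr // -tsumB; last first.
- exact: small_mulr.
- exact: small_mull.
rewrite scalerDl -[X in k *: X](tsum_shift _ (- s)) -!tsumZ -tsumD; last first.
- exact: smallZ.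
- move=> N; have [B HB] := sm (m - s) N; exists (B + `|s|)%N => i Bi.
  by apply/nbhdZ/HB; lia.
congr tsum; apply/funext => i.
have -> : m - s - (i - s) = m - i by lia.
have -> : m - s - i = m - i - s by lia.
rewrite scalerAl -ya scalerAr -yx mulrBl mulrBr !mulrA.
by rewrite addrA subrK.
Qed.

Lemma small_cmul_right x g n : small_fps J g -> small (fun i => x i * cur_zV g (n - i)).
Proof.
move=> sg N; have [B HB] := small_right (fun i => x (n - i)) (right_cur_zV sg) N.
exists (B + `|n|)%N => i Bi; have := HB (n - i); rewrite subKr; apply.
by lia.
Qed.

Lemma eig_dress y s k1 k2 k3 f x g : smooth1 J x -> small_fps J g ->
  eig y s k1 (cur_z f) -> eig y s k2 x -> eig y s k3 (cur_zV g) ->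
  eig y s (k1 + k2 + k3) (dress J f x g).
Proof.
move=> sx sg yf yx yg; apply: eig_cmul => // [|n]; last exact: small_cmul_right.
by apply: eig_cmul => // n; apply: cmul_small.
Qed.

(** ** Exchange relations read off from currents *)

Lemma exch_of_mulwz f x (h : fps K) :
  zw (cur_zV f) x =2 mulwz J (cur_z h) (wz x (cur_zV f)) -> exch f x h.
Proof.
move=> H l n; have := H (- l%:Z) n; rewrite /zw /mulwz /wz.
rewrite {1}/cur_zV opprK => ->; rewrite (@tsum_finite _ _ _ l) => [|i il].
  apply: eq_bigr => i _; congr (_ *: (_ * _)); rewrite /cur_zV.
  have il : (i <= l)%N by rewrite -ltnS.
  by have -> : - (- l%:Z + i%:Z) = (l - i)%N%:Z by lia.
have [i0|i0] := ltrP i 0; first by rewrite (cur_z_neg h) // scale0r.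
by rewrite /cur_zV [cur_z f _]cur_z_neg ?mulr0 ?scaler0 //; lia.
Qed.

Lemma exch_of_mulzw f x (h : fps K) :
  zw (cur_z f) x =2 mulzw J (cur_z h) (wz x (cur_z f)) ->
  exch f (fun n => x (- n)) h.
Proof.
move=> H l n; have := H l%:Z (- n); rewrite /zw /mulzw /wz.
rewrite {1}/cur_z => ->; rewrite (@tsum_finite _ _ _ l) => [|i il].
  apply: eq_bigr => i _; have il : (i <= l)%N by rewrite -ltnS.
  rewrite subzn //; congr (_ *: (x _ * _)); lia.
have [i0|i0] := ltrP i 0; first by rewrite (cur_z_neg h) // scale0r.
by rewrite [cur_z f _]cur_z_neg ?mulr0 ?scaler0 //; lia.
Qed.

(** ** Delta functions and dilations of double products *)

Lemma mulwz_delta_in_z c x m n : mulwz J (delta c) (in_z x) m n = c ^ n *: x (m + n).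
Proof.
rewrite /mulwz (@tsum_single _ _ _ n) => [|i ni]; first by rewrite /in_z subrr eqxx.
by rewrite /in_z subr_eq0 eq_sym (negbTE ni) scaler0.
Qed.
Lemma mulwz_delta_in_w c x m n : mulwz J (delta c) (in_w x) m n = c ^ (- m) *: x (m + n).
Proof.
rewrite /mulwz (@tsum_single _ _ _ (- m)) => [|i ni].
  by rewrite /in_w subrr eqxx opprK addrC.
by rewrite /in_w addr_eq0 -eqr_oppLR eq_sym (negbTE ni) scaler0.
Qed.
Lemma mulzw_delta_in_w c x m n : mulzw J (delta c) (in_w x) m n = c ^ m *: x (m + n).
Proof.
rewrite /mulzw (@tsum_single _ _ _ m) => [|i ni]; first by rewrite /in_w subrr eqxx addrC.
by rewrite /in_w subr_eq0 eq_sym (negbTE ni) scaler0.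
Qed.

Lemma mulwz_zw_dil (h : fps K) c a x m n : c != 0 ->
  mulwz J (cur_z h) (zw a (dil c x)) m n =
  c ^ n *: mulwz J (cur_z (fps_scale c^-1 h)) (zw a x) m n.
Proof.
move=> c0; rewrite /mulwz -tsumZ; congr tsum; apply/funext => -[i|i] /=; last first.
  by rewrite !scale0r scaler0.
rewrite /zw /dil -scalerAr !scalerA; congr (_ *: _).
rewrite exprzDr ?unitfE // -invr_expz -exprnP exprVn; ring.
Qed.
Lemma mulzw_wz_dil (h : fps K) c a x m n : c != 0 ->
  mulzw J (cur_z h) (wz (dil c x) a) m n =
  c ^ n *: mulzw J (cur_z (fps_scale c h)) (wz x a) m n.
Proof.
move=> c0; rewrite /mulzw -tsumZ; congr tsum; apply/funext => -[i|i] /=; last first.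
  by rewrite !scale0r scaler0.
rewrite /wz /dil -scalerAl !scalerA; congr (_ *: _).
rewrite exprzDr ?unitfE // -exprnP; ring.
Qed.
Lemma mulwz_dil2 (h : fps K) c a x m n : c != 0 ->
  mulwz J (cur_z h) (zw (dil c a) (dil c x)) m n = c ^ (m + n) *: mulwz J (cur_z h) (zw a x) m n.
Proof.
move=> c0; rewrite /mulwz -tsumZ; congr tsum; apply/funext => i.
rewrite /zw /dil -scalerAr -scalerAl !scalerA; congr (_ *: _).
by rewrite !exprzDr ?unitfE // -invr_expz; field; rewrite expfz_neq0.
Qed.

Lemma cmul1_z x : cmul J (cur_z 1) x = x.
Proof.
apply/funext => n; rewrite /cmul (@tsum_single _ _ _ 0) => [|[i|i] i0].
- by rewrite subr0 -[cur_z _ _]/((1 : fps E) 0) coefs1 mul1r.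
- by rewrite -[cur_z _ _]/((1 : fps E) i) coefs1; case: i i0 => // i; rewrite mul0r.
by rewrite mul0r.
Qed.
Lemma cmul1_zV x : cmul J x (cur_zV 1) = x.
Proof.
apply/funext => n; rewrite cmul_rop (@tsum_single _ _ _ 0) => [|i i0].
  by rewrite subr0 -[cur_zV _ _]/((1 : fps E) 0) coefs1 mulr1.
rewrite /cur_zV; case Ei: (- i) => [k|k]; last by rewrite mulr0.
rewrite -[cur_z _ _]/((1 : fps E) k) coefs1; case: k Ei => [|k]; last by rewrite mulr0.
by move/eqP; rewrite oppr_eq0 (negbTE i0).
Qed.
Lemma cur_zV_const (u : E) : cur_zV (fps_const u) = cur_z (fps_const u).
Proof. by apply/funext => -[[|n]|n]. Qed.

Lemma mulwz1 F : mulwz J (cur_z (1 : fps K)) F = F.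
Proof.
apply/funext => m; apply/funext => n; rewrite /mulwz (@tsum_single _ _ _ 0) => [|[i|i] i0].
- by rewrite addr0 subr0 -[cur_z _ _]/((1 : fps K) 0) coefs1 scale1r.
- by rewrite -[cur_z _ _]/((1 : fps K) i) coefs1; case: i i0 => // i; rewrite scale0r.
by rewrite scale0r.
Qed.

Lemma regroup f1 f2 f1' f2' g1 g2 g1' g2' x :
  smooth1 J x -> small_fps J g1 -> small_fps J g2 -> small_fps J g1' -> small_fps J g2' ->
  f1 * f2 = f1' * f2' -> g1 * g2 = g1' * g2' ->
  cmul J (cmul J (cmul J (cur_z f1) (cmul J (cur_z f2) x)) (cur_zV g1)) (cur_zV g2) =
  cmul J (cmul J (cmul J (cmul J (cur_z f1') (cur_z f2')) x) (cur_zV g1')) (cur_zV g2').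
Proof.
move=> sx s1 s2 s1' s2' ef eg.
by rewrite !cmulA_right // eg cmulA_left // cmul_cur_z ef.
Qed.

(** On each of the two lines, one of the dressing factors in z and w becomes
    a dilation of the other, which gives the normally ordered product T. *)
Lemma dress2_lines f g c x m n : c != 0 -> smooth1 J x -> small_fps J g ->
  fcomm f f -> fcomm g g ->
  let T := cmul J (cmul J (cmul J (cmul J (dil c (cur_z f)) (cur_z f)) x)
                          (dil c (cur_zV g))) (cur_zV g) in
  dress2 J f g f g (fun m n => line 1 c^-1 x m n - line c^-1 1 x m n) m n =
  mulwz J (delta c^-1) (in_z T) m n - mulwz J (delta c) (in_w T) m n.
Proof.
move=> c0 sx sg ff gg T; have cV : c^-1 != 0 by rewrite invr_eq0.
have o := oner_neq0 K; have sgV := small_fdil c^-1 sg.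
have ffc : fcomm (fdil c f) f by move=> i j; apply/commr_sym/commZ/ff.
have ggc : fcomm g (fdil c^-1 g) by move=> i j; apply/commZ/gg.
rewrite (@dress2B _ _ _ false) //; try exact: smooth_line.
rewrite !dress2_line // !invr1 !invrK !dil1 mulwz_delta_in_z mulwz_delta_in_w.
have T1 : cmul J (cmul J (cmul J (dil c (cur_z f)) (cmul J (cur_z f) x)) (cur_zV g))
   (dil c (cur_zV g)) = T.
  rewrite /T !dil_cur_z !dil_cur_zV; apply: regroup => //; exact: mulfC.
have T2 : cmul J (cmul J (cmul J (cur_z f) (cmul J (dil c (cur_z f)) x)) (dil c (cur_zV g)))
   (cur_zV g) = T.
  rewrite /T !dil_cur_z !dil_cur_zV; apply: regroup => //; exact/esym/mulfC.
by rewrite T1 T2 /line !exp1rz mulr1 mul1r !exprz_inv.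
Qed.

End Eigen.

(** * The Cartan series *)

Section Cartan.
Variables (K : fieldType) (E : algType K).
Hypothesis char0 : forall n, n.+1%:R != 0 :> K.
Variables (psi c : fps E) (u : E).
Hypotheses (upsi : u * psi 0%N = 1) (psiu : psi 0%N * u = 1).
Hypothesis psiE : psi = fps_const (psi 0%N) * fps_exp c.
Hypotheses (c0 : c 0%N = 0) (psipsi : fcomm psi psi).

Lemma comm_unit_inv (y : E) : GRing.comm y (psi 0%N) -> GRing.comm y u.
Proof.
rewrite /GRing.comm => H.
by rewrite -[LHS]mul1r -upsi -mulrA (mulrA (psi 0%N)) -H -!mulrA psiu mulr1.
Qed.

Lemma exp_cartan n : fps_exp c n = u * psi n.
Proof. by rewrite {1}psiE coefsCM mulrA upsi mul1r. Qed.

Lemma cartan_comm (y : E) : (forall n, GRing.comm y (psi n)) ->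
  forall n, GRing.comm y (c n).
Proof.
move=> H; apply: comm_log => // n; rewrite exp_cartan.
by apply: commrM => //; apply: comm_unit_inv.
Qed.

Lemma comm_cartan (y : E) : GRing.comm y (psi 0%N) -> (forall n, GRing.comm y (c n)) ->
  forall n, GRing.comm y (psi n).
Proof. by move=> y0 yc n; rewrite {1}psiE coefsCM; apply: commrM => //; apply: comm_exp. Qed.

Lemma fcomm_psi_cartan : fcomm psi c.
Proof. by move=> i; apply: cartan_comm => n; apply: psipsi. Qed.

Lemma fcomm_cartan : fcomm c c.
Proof. by move=> i; apply: cartan_comm => n; apply/commr_sym/fcomm_psi_cartan. Qed.

Lemma theta_cartan : theta psi = theta c * psi.
Proof.
have H : fps_const (psi 0%N) * theta c = theta c * fps_const (psi 0%N).
  apply/esym/mulfC/fcomm_theta => i [|j] /=; last exact: commr0.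
  exact/commr_sym/fcomm_psi_cartan.
rewrite [in LHS]psiE thetaM thetaC mul0r add0r theta_exp //; last exact: fcomm_cartan.
by rewrite mulrA H -mulrA -psiE.
Qed.

Lemma cartan_mulV : psi * (fps_inv (fps_exp c) * fps_const u) = 1.
Proof.
rewrite {1}psiE mulrA -(mulrA _ (fps_exp c)) mulfpsV ?fps_exp0 // mulr1.
by rewrite fps_constM psiu.
Qed.

(** The coefficient v is there for the powers of the inverse of psi_0, which is
    not a mode.  It does not harm convergence, as neighbourhoods of 0 are left
    ideals, nor multiplicativity, as it commutes with the psi_k. *)
Inductive psi_deg : nat -> E -> Prop :=
| PsiDeg0 d : psi_deg d 0
| PsiDegD d x y : psi_deg d x -> psi_deg d y -> psi_deg d (x + y)
| PsiDegW v s : (forall k, GRing.comm v (psi k)) ->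
    psi_deg (sumn s) (v * \prod_(k <- s) psi k).

Lemma psi_degZ d (k : K) x : psi_deg d x -> psi_deg d (k *: x).
Proof.
elim=> [e|e y z _ Hy _ Hz|v s vs]; first by rewrite scaler0; constructor.
  by rewrite scalerDr; constructor.
by rewrite scalerAl; constructor=> l; apply/commr_sym/commZ/commr_sym.
Qed.

Lemma psi_degM d e x y : psi_deg d x -> psi_deg e y -> psi_deg (d + e) (x * y).
Proof.
move=> dx; elim: dx e y => {d x} [d|d x x' _ Hx _ Hx'|v s vs] e y ey.
- by rewrite mul0r; constructor.
- by rewrite mulrDl; constructor; [apply: Hx|apply: Hx'].
elim: ey => {e y} [e|e y y' _ Hy _ Hy'|w r wr].
- by rewrite mulr0; constructor.
- by rewrite mulrDr; constructor.
have ws : GRing.comm w (\prod_(k <- s) psi k).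
  by apply: (big_ind (GRing.comm w)) => //; [exact: commr1|exact: commrM].
rewrite mulrA -(mulrA v) -ws !mulrA -mulrA -big_cat -sumn_cat.
by constructor=> k; apply/commr_sym/commrM/commr_sym => //; apply/commr_sym/vs.
Qed.

Lemma psi_deg1 : psi_deg 0 1.
Proof.
have := @PsiDegW 1 [::]; rewrite big_nil mulr1; apply=> k; exact/commr_sym/commr1.
Qed.

Lemma psi_deg_cartan n : psi_deg n (c n).
Proof.
apply: (graded_log PsiDeg0 PsiDegD psi_degZ psi_degM psi_deg1 c0) => m.
rewrite exp_cartan; have := @PsiDegW u [:: m]; rewrite big_seq1 /= addn0; apply=> k.
by apply/commr_sym/comm_unit_inv.
Qed.

Lemma psi_deg_exp (e : fps E) : e 0%N = 0 -> (forall n, psi_deg n (e n)) ->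
  forall n, psi_deg n (fps_exp e n).
Proof. exact: (graded_exp PsiDeg0 PsiDegD psi_degZ psi_degM psi_deg1). Qed.

Lemma psi_deg_inv (e : fps E) : e 0%N = 1 -> (forall n, psi_deg n (e n)) ->
  forall n, psi_deg n (fps_inv e n).
Proof. exact: (graded_inv PsiDeg0 PsiDegD psi_degZ psi_degM psi_deg1). Qed.

Variable J : linear_topology E.
Hypothesis words : forall N, exists D : nat, forall s : seq nat,
  (D <= sumn s)%N -> nbhd0 J N (\prod_(k <- s) psi k).

Lemma psi_deg_small (f : fps E) : (forall n, psi_deg n (f n)) -> small_fps J f.
Proof.
move=> Hf N; have [D HD] := words N; exists D => n; move: (Hf n).
elim=> {n} [d|d x y _ Hx _ Hy|v s _] dD.
- exact: nbhd0_0.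
- by apply: nbhd0D; [apply: Hx|apply: Hy].
by apply/nbhd0_mull/HD.
Qed.

End Cartan.

(** * The structure functions *)

Section StructureFunctions.
Variable P : scalars.
Local Notation q := (q P).
Local Notation t := (t P).
Local Notation p := (p P).
Local Notation gammah := (gammah P).
Local Notation gamma := (gamma P).
Hypothesis char0 : forall n, n.+1%:R != 0 :> P.
Hypotheses (q0 : q != 0) (t0 : t != 0) (gh0 : gammah != 0).
Hypothesis inv_subE : forall n, (0 < n)%N ->
  inv_gamma_sub P n * (gamma ^+ n - gamma ^- n) = 1.
Hypothesis inv_oneE : forall n, (0 < n)%N ->
  inv_one_sub P n * (1 - gamma ^- (2 * n)) = 1.

Lemma p_neq0 : p != 0. Proof. by rewrite mulf_neq0 ?invr_eq0. Qed.
Lemma gamma_neq0 : gamma != 0. Proof. by rewrite expf_neq0. Qed.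

Lemma GpE : Gp P = Gpol q t. Proof. by []. Qed.
Lemma GmE : Gm P = Gpol q^-1 t^-1. Proof. by rewrite /Gpol !invrK. Qed.

(** n times the coefficient of z^n in log g(z) *)
Definition gg (n : nat) : P := (1 - q ^+ n) * (1 - t ^- n) * (1 - p ^- n).

Definition pos_series (F : nat -> P) : fps P := Fps (fun n => if n == 0 then 0 else F n).

Lemma theta_pos_series F : theta (pos_series (fun n => n%:R^-1 * F n)) = pos_series F.
Proof.
apply: fpsP => -[|n] /=; first by rewrite mulr0n.
by rewrite -[LHS]mulr_natl mulrA divff ?mul1r.
Qed.

Lemma pos_seriesD F G : pos_series F + pos_series G = pos_series (fun n => F n + G n).
Proof. by apply: fpsP => -[|n] //; rewrite coefsD /= addr0. Qed.
Lemma pos_seriesN F : - pos_series F = pos_series (fun n => - F n).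
Proof. by apply: fpsP => -[|n] //; rewrite coefsN /= oppr0. Qed.
Lemma pos_series_ext F G : (forall n, (0 < n)%N -> F n = G n) -> pos_series F = pos_series G.
Proof. by move=> H; apply: fpsP => -[|n] //=; rewrite H. Qed.
Lemma lam_pos_series a : lam a = pos_series (fun n => a ^+ n). Proof. by []. Qed.
Lemma scale_pos_series a F : fps_scale a (pos_series F) = pos_series (fun n => a ^+ n * F n).
Proof. by apply: fpsP => -[|n] //=; rewrite mulr0. Qed.

Lemma logder_Gpol (a b : P) :
  logder (fps_of_poly (Gpol a b)) (- lam a - lam b^-1 - lam (a^-1 * b)).
Proof. by rewrite fps_Gpol; do 2?apply: logderM; apply: logder_lin. Qed.

Lemma Gpol0 (a b : P) : a != 0 -> b != 0 -> fps_of_poly (Gpol a b) 0%N = 1.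
Proof. by move=> a0 b0; rewrite coefs_Gpol. Qed.

Lemma logder_g : logder (g P) (pos_series gg).
Proof.
have G0 : fps_of_poly (Gm P) 0%N = 1 by rewrite GmE Gpol0 ?invr_eq0.
have Hm : logder (fps_of_poly (Gm P)) (- lam q^-1 - lam t^-1^-1 - lam (q^-1^-1 * t^-1)).
  by rewrite GmE; apply: logder_Gpol.
have := logderM (logder_Gpol q t) (logderV (mulfpsV G0) Hm).
rewrite !lam_pos_series !(pos_seriesN, pos_seriesD); congr logder; apply: pos_series_ext => n _.
rewrite /gg /p !exprMn !exprVn !invrK.
have qn := expf_neq0 n q0; have tn := expf_neq0 n t0.
by move: (q ^+ n) (t ^+ n) qn tn => Q T Q0 T0; field; rewrite ?Q0 ?T0.
Qed.

Lemma g0 : g P 0%N = 1.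
Proof.
rewrite /g coefsM0 fps_inv0 ?mulr1; first by rewrite GpE Gpol0.
by rewrite GmE Gpol0 ?invr_eq0.
Qed.

Definition sexpn (F : nat -> P) : fps P := sexp (pos_series (fun n => n%:R^-1 * F n)).

Lemma logder_sexpn F : logder (sexpn F) (pos_series F).
Proof. by rewrite -theta_pos_series; apply: logder_sexp. Qed.
Lemma sexpn0 F : sexpn F 0%N = 1. Proof. exact: sexp0. Qed.

Lemma logder_poles (a b : P) : logder (poles a b) (lam 1 + lam (a / b) + lam (a / b)^-1).
Proof. by do 2?apply: logderM; apply: logder_geo. Qed.

Let gamma_pow n : (0 < n)%N -> let G := gamma ^+ n in
  [/\ G != 0, G ^+ 2 - 1 != 0, inv_gamma_sub P n = G / (G ^+ 2 - 1) &
      inv_one_sub P n = G ^+ 2 / (G ^+ 2 - 1)].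
Proof.
move=> n0 G; have G0 : G != 0 by rewrite expf_neq0 // gamma_neq0.
have H1 := inv_subE n0; have H2 := inv_oneE n0.
rewrite -/G in H1; rewrite mulnC exprM -/G in H2.
have G2 : G ^+ 2 - 1 != 0.
  apply: contra_eq_neq H1 => G21; have {}G21 : G ^+ 2 = 1 by apply/eqP; rewrite -subr_eq0 G21.
  have -> : G - G^-1 = 0 by apply: (mulfI G0); rewrite mulrBr divff // mulr0 -expr2 G21 subrr.
  by rewrite mulr0 eq_sym oner_neq0.
split=> //.
  have GG : G - G^-1 = (G ^+ 2 - 1) / G by field.
  apply: (@mulIf _ (G - G^-1)); first by rewrite GG mulf_neq0 ?invr_eq0.
  by rewrite H1 GG; field; rewrite G0 G2.
have GG : 1 - G ^- 2 = (G ^+ 2 - 1) / G ^+ 2 by field.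
apply: (@mulIf _ (1 - G ^- 2)); first by rewrite GG mulf_neq0 ?invr_eq0 ?expf_neq0.
by rewrite H2 GG; field; rewrite G0 G2.
Qed.

Let sexpn_mul F (f l : fps P) : f 0%N = 1 -> logder f l ->
  forall h k : fps P, h 0%N = 1 -> logder h k -> pos_series F + k = l -> l 0%N = 0 -> sexpn F * h = f.
Proof.
move=> f0 Hf h k h0 Hh Fk l0; apply: (logder_uniq char0 l0) => //.
  by rewrite -Fk; apply: logderM => //; apply: logder_sexpn.
by rewrite coefsM0 sexpn0 h0 f0 mulr1.
Qed.

Lemma AseriesE : Aseries P = sexpn (fun n =>
  (1 - q ^+ n) * (1 - t ^- n) * (1 - p ^- n * gamma ^- (2 * n)) * inv_one_sub P n).
Proof.
congr (@fps_exp P P^o _); apply: fpsP => n /=.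
by case: eqP => // _; rewrite -[LHS]mulrA.
Qed.

Lemma BseriesE : Bseries P = sexpn (fun n =>
  (1 - q ^+ n) * (1 - t ^- n) * (p ^- (2 * n) * gamma ^- (2 * n) - p ^- n * gamma ^- (2 * n))
   * inv_one_sub P n).
Proof.
congr (@fps_exp P P^o _); apply: fpsP => n /=.
by case: eqP => // _; rewrite -[LHS]mulrA.
Qed.

(** The factors produced by moving the beta of t or t^* through x^+ (w) or
    x^- (w).  The cases of beta and x^-, and of its inverse and x^+, give the same
    series [h_ts]. *)
Definition h_tt := sexpn (fun n => - (inv_gamma_sub P n * gamma ^- n * gg n)).
Definition h_ts := sexpn (fun n => inv_gamma_sub P n * gg n).
Definition h_ss := sexpn (fun n => - (inv_gamma_sub P n * gamma ^+ n * gg n)).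

Let poles0 (a b : P) : a != 0 -> b != 0 -> (poles a b * fps_of_poly (Gpol a b)) 0%N = 1.
Proof. by move=> a0 b0; rewrite /poles !coefsM0 Gpol0 //= !expr0 !mulr1. Qed.

(** In degree n, the logarithmic derivative of both sides is
    (1 - q^n) (1 - t^-n). *)
Lemma A_h_tt : Aseries P * h_tt = poles q t * fps_of_poly (Gpol q t).
Proof.
rewrite AseriesE; apply: (sexpn_mul (poles0 q0 t0)
   (logderM (logder_poles _ _) (logder_Gpol _ _)) (sexpn0 _) (logder_sexpn _)).
  rewrite !lam_pos_series !(pos_seriesN, pos_seriesD); apply: pos_series_ext => n n0.
  have [/= G0 G2 -> ->] := gamma_pow n0.
  rewrite /gg mulnC exprM; move: (gamma ^+ n) G0 G2 => G G0 G2.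
  rewrite /p !exprMn !exprVn !exprMn !expr1n ?exprVn.
  have qn := expf_neq0 n q0; have tn := expf_neq0 n t0.
  move: (q ^+ n) (t ^+ n) qn tn => Q T Q0 T0; field.
  by rewrite ?Q0 ?T0 ?G0 ?G2.
by rewrite !lam_pos_series !(pos_seriesN, pos_seriesD).
Qed.

(** In degree n, the logarithmic derivative of both sides is
    (1 - q^-n) (1 - t^n), because q^n t^-n p^-n = 1. *)
Lemma A_h_ss : Aseries P * h_ss = poles q^-1 t^-1 * fps_of_poly (Gpol q^-1 t^-1).
Proof.
have [qV tV] : q^-1 != 0 /\ t^-1 != 0 by rewrite !invr_eq0.
rewrite AseriesE; apply: (sexpn_mul (poles0 qV tV)
   (logderM (logder_poles _ _) (logder_Gpol _ _)) (sexpn0 _) (logder_sexpn _)).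
  rewrite !lam_pos_series !(pos_seriesN, pos_seriesD); apply: pos_series_ext => n n0.
  have [/= G0 G2 -> ->] := gamma_pow n0.
  rewrite /gg mulnC exprM; move: (gamma ^+ n) G0 G2 => G G0 G2.
  rewrite /p !invrK !exprMn !exprVn ?invrK !exprMn !expr1n ?exprVn.
  have qn := expf_neq0 n q0; have tn := expf_neq0 n t0.
  move: (q ^+ n) (t ^+ n) qn tn => Q T Q0 T0; field.
  by rewrite ?Q0 ?T0 ?G0 ?G2.
by rewrite !lam_pos_series !(pos_seriesN, pos_seriesD).
Qed.

Lemma B_h_ts : fps_scale (p * gamma) (Bseries P) * h_ts = 1.
Proof.
apply: (@logder_uniq _ char0 _ _ (0 : fps P)); first by rewrite coefs0.
- rewrite BseriesE; set FB := (X in fps_scale _ (sexpn X)).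
  have := logderM (logder_scale (p * gamma) (logder_sexpn FB))
    (logder_sexpn (fun n => inv_gamma_sub P n * gg n)).
  congr logder; rewrite scale_pos_series pos_seriesD /FB.
  apply: fpsP => -[|n] //; rewrite coefs0 /=.
  have [//|/= G0 G2 -> ->] := @gamma_pow n.+1.
  rewrite /gg [(p * gamma) ^+ _]exprMn !(mulnC 2) ![_ ^+ (_ * 2)]exprM.
  move: (gamma ^+ n.+1) G0 G2 => G G0 G2; rewrite /p !exprMn !exprVn.
  have qn := expf_neq0 n.+1 q0; have tn := expf_neq0 n.+1 t0.
  move: (q ^+ n.+1) (t ^+ n.+1) qn tn => Q T Q0 T0.
  by field; rewrite ?Q0 ?T0 ?G0 ?G2.
- by rewrite /logder theta1 mul0r.
have s0 F : fps_scale (p * gamma) (sexpn F) 0%N = 1.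
  by rewrite -[LHS]/(1 * sexpn F 0%N) sexpn0 mulr1.
by rewrite coefsM0 BseriesE s0 sexpn0 mulr1.
Qed.

End StructureFunctions.

(** * The currents t and t* *)

Section Representation.
Variables (P : scalars) (E : algType P) (J : linear_topology E) (U : modes E) (b : int -> E).
Local Notation q := (q P).
Local Notation t := (t P).
Local Notation p := (p P).
Local Notation gammah := (gammah P).
Local Notation gamma := (gamma P).
Local Notation inv_sub := (inv_gamma_sub P).
Local Notation gg := (@gg P).
Hypothesis char0 : forall n, n.+1%:R != 0 :> P.
Hypotheses (q0 : q != 0) (t0 : t != 0) (gh0 : gammah != 0).
Hypothesis inv_subE : forall n, (0 < n)%N ->
  inv_sub n * (gamma ^+ n - gamma ^- n) = 1.
Hypothesis inv_oneE : forall n, (0 < n)%N ->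
  inv_one_sub P n * (1 - gamma ^- (2 * n)) = 1.
Hypothesis DI : ding_iohara J U.
Hypothesis CM : cartan_modes U b.

Local Notation psip := (psip U).
Local Notation psim := (psim U).
Local Notation xpc := (xpc U).
Local Notation xmc := (xmc U).
Local Notation alpha := (alpha b).
Local Notation beta := (beta b).
Local Notation kX := (kX E).

(** The exponents of psi^+, psi^-, alpha and beta *)
Let cp : fps E := Fps (fun n => if n == 0 then 0 else gammah ^+ n *: b n).
Let cm : fps E := Fps (fun n => if n == 0 then 0 else - (gammah ^+ n *: b (- n%:Z))).
Let ca : fps E := Fps (fun n => if n == 0 then 0 else - (inv_sub n *: b (- n%:Z))).
Let cb : fps E := Fps (fun n => if n == 0 then 0 else inv_sub n *: b n).

Let psipE : psip = fps_const (psip 0%N) * fps_exp cp. Proof. exact: CM.1. Qed.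
Let psimE : psim = fps_const (psim 0%N) * fps_exp cm. Proof. exact: CM.2. Qed.

Let bp_cp n : (0 < n)%N -> b n = gammah ^- n *: cp n.
Proof. by case: n => // n _; rewrite /= scalerA mulVf ?scale1r // expf_neq0. Qed.
Let bm_cm n : (0 < n)%N -> b (- n%:Z) = - (gammah ^- n) *: cm n.
Proof.
by case: n => // n _; rewrite /cm /= scalerN scaleNr opprK scalerA mulVf ?scale1r // expf_neq0.
Qed.

Let fcomm_pp : fcomm psip psip.
Proof.
move=> i j; have := psip_psip DI (- i%:Z) (- j%:Z).
by rewrite /zw /wz /psipc /cur_zV !opprK.
Qed.
Let fcomm_mm : fcomm psim psim.
Proof. by move=> i j; apply: (psim_psim DI i%:Z j%:Z). Qed.

Let up := projT1 (cid (psip0_unit DI)).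
Let upP : up * psip 0%N = 1. Proof. by rewrite /up; case: cid => u []. Qed.
Let pup : psip 0%N * up = 1. Proof. by rewrite /up; case: cid => u []. Qed.
Let um := projT1 (cid (psim0_unit DI)).
Let umP : um * psim 0%N = 1. Proof. by rewrite /um; case: cid => u []. Qed.
Let pum : psim 0%N * um = 1. Proof. by rewrite /um; case: cid => u []. Qed.

Let cp0 : cp 0%N = 0. Proof. by []. Qed.
Let cm0 : cm 0%N = 0. Proof. by []. Qed.
Let ca0 : ca 0%N = 0. Proof. by []. Qed.
Let cb0 : cb 0%N = 0. Proof. by []. Qed.

Let fcomm_cp : fcomm cp cp. Proof. exact: (fcomm_cartan upP pup psipE cp0 fcomm_pp). Qed.
Let fcomm_cm : fcomm cm cm. Proof. exact: (fcomm_cartan umP pum psimE cm0 fcomm_mm). Qed.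
Let theta_p : theta psip = theta cp * psip.
Proof. exact: (theta_cartan char0 upP pup psipE cp0 fcomm_pp). Qed.
Let theta_m : theta psim = theta cm * psim.
Proof. exact: (theta_cartan char0 umP pum psimE cm0 fcomm_mm). Qed.

Let comm_bp m n : (0 < m)%N -> (0 < n)%N -> GRing.comm (b m) (b n).
Proof.
move=> m0 n0; rewrite (bp_cp m0) (bp_cp n0).
by apply/commZ/commr_sym/commZ/fcomm_cp.
Qed.
Let comm_bm m n : (0 < m)%N -> (0 < n)%N -> GRing.comm (b (- m%:Z)) (b (- n%:Z)).
Proof.
move=> m0 n0; rewrite (bm_cm m0) (bm_cm n0).
by apply/commZ/commr_sym/commZ/fcomm_cm.
Qed.

Let fcomm_ca : fcomm ca ca.
Proof.
case=> [|j] [|k] /=; rewrite /GRing.comm ?mul0r ?mulr0 //.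
by apply: commrN; apply/commr_sym/commrN/commr_sym; apply/commZ/commr_sym/commZ; apply: comm_bm.
Qed.
Let fcomm_cb : fcomm cb cb.
Proof.
case=> [|j] [|k] /=; rewrite /GRing.comm ?mul0r ?mulr0 //.
by apply/commZ/commr_sym/commZ; apply: comm_bp.
Qed.
Let log_alpha : has_log alpha ca. Proof. exact: has_log_exp. Qed.
Let log_beta : has_log beta cb. Proof. exact: has_log_exp. Qed.

(** ** The brackets [b_n, x_m] and [b_n, b_-m] *)

Let rr n : P := n%:R^-1 * gg n.

Let scale_gg (a : P) : logder (fps_scale a (g P)) (pos_series (fun n => a ^+ n * gg n)).
Proof. by rewrite -scale_pos_series; apply/logder_scale/logder_g. Qed.
Let scale_g0 (a : P) : fps_scale a (g P) 0%N = 1.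
Proof. by rewrite /= expr0 mul1r; apply: g0. Qed.

Let bracket_psi (psi psi' c : fps E) (x : int -> E) (h : fps P) F :
  theta psi = theta c * psi -> psi * psi' = 1 -> logder h (pos_series F) -> h 0%N = 1 ->
  exch psi x h -> forall i n, (0 < i)%N ->
  c i * x n - x n * c i = (i%:R^-1 * F i) *: x (n - i%:Z).
Proof.
move=> Ep pp Eh h0 ex i n i0; have k0 : pos_series (fun n => n%:R^-1 * F n) 0%N = 0 by [].
have Eh' : theta h = theta (pos_series (fun n => n%:R^-1 * F n)) * h by rewrite theta_pos_series.
have := exch_log char0 Ep pp Eh' h0 k0 ex n i0.
by case: i i0.
Qed.

Let logderN (h : fps P) F : h 0%N = 1 -> logder h (pos_series F) ->
  logder (fps_inv h) (pos_series (fun n => - F n)).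
Proof. by move=> h0 Hh; rewrite -pos_seriesN; apply: logderV Hh; apply: mulfpsV. Qed.

Let cpV := cartan_mulV pup psipE.
Let cmV := cartan_mulV pum psimE.

Lemma b_xp s n : s != 0 -> b s * xpc n - xpc n * b s =
  - (gamma ^- `|s| * rr `|s|) *: xpc (n - s).
Proof.
case: s => [i|i] s0.
  have i0 : (0 < i)%N by case: i s0.
  have ex := exch_of_mulwz (psip_xp DI).
  have := bracket_psi theta_p cpV (logderN (scale_g0 _) (scale_gg _)) (fps_inv0 (scale_g0 _)) ex n i0.
  rewrite (bp_cp i0) -scalerAl -scalerAr -scalerBr => ->; rewrite scalerA; congr (_ *: _).
  rewrite absz_nat /rr /Defs.gamma exprVn -exprM mulnC exprM expr2 invfM; ring.
rewrite NegzE; set j := i.+1; have j0 : (0 < j)%N by [].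
have ex := exch_of_mulzw (psim_xp DI).
have := bracket_psi theta_m cmV (scale_gg _) (scale_g0 _) ex (- n) j0.
rewrite opprK (bm_cm j0) -scalerAl -scalerAr -scalerBr => ->.
rewrite scalerA -/j abszN absz_nat; congr (_ *: Defs.xpc _ _); last by clear; lia.
rewrite /rr /Defs.gamma exprVn -exprM mulnC exprM expr2 invfM; ring.
Qed.

Lemma b_xm s n : s != 0 -> b s * xmc n - xmc n * b s = rr `|s| *: xmc (n - s).
Proof.
case: s => [i|i] s0.
  have i0 : (0 < i)%N by case: i s0.
  have ex := exch_of_mulwz (psip_xm DI).
  have := bracket_psi theta_p cpV (scale_gg _) (scale_g0 _) ex n i0.
  rewrite (bp_cp i0) -scalerAl -scalerAr -scalerBr => ->; rewrite scalerA; congr (_ *: _).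
  by rewrite absz_nat /rr; field; rewrite expf_neq0 //; case: (i) i0 => // *; rewrite char0.
rewrite NegzE; set j := i.+1; have j0 : (0 < j)%N by [].
have ex := exch_of_mulzw (psim_xm DI).
have := bracket_psi theta_m cmV (logderN (scale_g0 _) (scale_gg _)) (fps_inv0 (scale_g0 _)) ex (- n) j0.
rewrite opprK (bm_cm j0) -scalerAl -scalerAr -scalerBr => ->.
rewrite scalerA -/j abszN absz_nat; congr (_ *: Defs.xmc _ _); last by clear; lia.
by rewrite /rr; field; rewrite expf_neq0 // /j char0.
Qed.

Let kappa i : P := rr i * (gamma ^+ i - gamma ^- i).

Let fbr_cp_cm i : (0 < i)%N -> fbr (cp i) cm = kX (kappa i) i.
Proof.
move=> i0; apply: (fbr_log char0 theta_m cmV) => //.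
have ex := exch_of_mulwz (psip_psim DI).
have H1 := scale_gg gamma.
have H2 := logderN (scale_g0 gamma^-1) (scale_gg gamma^-1).
have H := logderM H1 H2; rewrite pos_seriesD in H.
have h0 : (fps_scale gamma (g P) * fps_inv (fps_scale gamma^-1 (g P))) 0%N = 1.
  by rewrite coefsM0 scale_g0 (fps_inv0 (scale_g0 _)) mulr1.
have := bracket_psi theta_p cpV H h0 ex.
move=> B; apply: fpsP => n; rewrite fbrE kXE.
have := B i n%:Z i0; rewrite -![psimc U n%:Z]/(psim n) => ->.
case: ltnP => ni; first by rewrite /psimc cur_z_neg ?scaler0 //; lia.
rewrite subzn // /psimc /=; congr (_ *: _).
by rewrite /kappa /rr exprVn; ring.
Qed.

Let fbr_bp_alpha i : (0 < i)%N -> fbr (b i) alpha = kX (gamma ^- i * rr i) i * alpha.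
Proof.
move=> i0.
have ta : theta alpha = theta ca * alpha := log_alpha.1.
apply: (fbr_exp char0 ta) => //; first exact: fps_exp0.
apply: fpsP => n; rewrite fbrE -[kX _ _]mulr1 kXE.
have := congr1 (fun f : fps E => f n) (fbr_cp_cm i0); rewrite fbrE -[kX _ _]mulr1 kXE coefs1.
case: n => [_|n]; first by rewrite /= mulr0 mul0r subrr i0.
have -> : ca n.+1 = (inv_sub n.+1 * gammah ^- n.+1) *: cm n.+1.
  by rewrite -[LHS]/(- (inv_sub n.+1 *: b (- n.+1%:Z))) (bm_cm (ltn0Sn n)) scaleNr scalerN opprK scalerA.
rewrite (bp_cp i0) -!scalerAl -!scalerAr !scalerA (mulrC (gammah ^- i)) -scalerBr => ->.
case: ltnP => ni; first by rewrite scaler0.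
rewrite scalerA subn_eq0; case: leqP => [_|ni']; first by rewrite !scaler0.
have -> : n.+1 = i by lia.
congr (_ *: _); rewrite /kappa.
have gi : (gamma ^- i) = gammah ^- i * gammah ^- i.
  by rewrite /Defs.gamma -exprM mulnC exprM expr2 invfM.
transitivity ((inv_sub i * (gamma ^+ i - gamma ^- i)) * (gammah ^- i * gammah ^- i * rr i)); first by ring.
by rewrite inv_subE // mul1r -gi.
Qed.

Let fbr_bm_beta i : (0 < i)%N ->
  fbr (b (- i%:Z)) beta = kX (gamma ^- i * rr i) i * beta.
Proof.
move=> i0.
have tb : theta beta = theta cb * beta := log_beta.1.
apply: (fbr_exp char0 tb) => //; first exact: fps_exp0.
apply: fpsP => n; rewrite fbrE -[kX _ _]mulr1 kXE.
case: n => [|n]; first by rewrite /= mulr0 mul0r subrr i0.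
have H := congr1 (fun f : fps E => f i) (fbr_cp_cm (ltn0Sn n)).
rewrite fbrE -[kX _ _]mulr1 kXE coefs1 in H.
have {}H : cm i * cp n.+1 - cp n.+1 * cm i = - (if (i < n.+1)%N then 0 else kappa n.+1 *: (i - n.+1 == 0)%N%:R).
  by rewrite -H opprB.
have -> : cb n.+1 = (inv_sub n.+1 * gammah ^- n.+1) *: cp n.+1.
  by rewrite -[LHS]/(inv_sub n.+1 *: b n.+1) (bp_cp (ltn0Sn n)) scalerA.
rewrite (bm_cm i0); move: (cp n.+1) (cm i) H => u v H.
rewrite -!scalerAl -!scalerAr !scalerA (mulrC (- _)) -scalerBr H.
rewrite coefs1 !subn_eq0; case: ltngtP => ni.
- by rewrite oppr0 !scaler0.
- by rewrite scaler0 oppr0 scaler0.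
rewrite ni scalerN mulrN scaleNr opprK scalerA; congr (_ *: _); rewrite /kappa.
have gi : (gamma ^- n.+1) = gammah ^- n.+1 * gammah ^- n.+1.
  by rewrite /Defs.gamma -exprM mulnC exprM expr2 invfM.
transitivity ((inv_sub n.+1 * (gamma ^+ n.+1 - gamma ^- n.+1)) * (gammah ^- n.+1 * gammah ^- n.+1 * rr n.+1)); first by ring.
by rewrite inv_subE // mul1r -gi.
Qed.

(** ** Convergence *)

Lemma words_small (s : nat -> generator) (F : nat -> E) :
  (forall k, gen_val U (s k) = F k) -> (forall k, gen_degree (s k) = k%:Z) ->
  forall N, exists D : nat, forall r : seq nat, (D <= sumn r)%N ->
  nbhd0 J N (\prod_(k <- r) F k).
Proof.
move=> sF sd N; have [D HD] := modes_continuous DI N; exists `|D|%N => r rD.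
have := HD (map s r); rewrite !big_map (eq_bigr F) => [|k _]; last exact: sF.
apply; rewrite (eq_bigr Posz) => [|k _]; last exact: sd.
have -> : \sum_(i <- r) i%:Z = (sumn r)%:Z.
  by elim: r {rD} => [|k r IH] /=; rewrite ?big_nil // big_cons IH PoszD.
by lia.
Qed.

Lemma smooth1_word (x : int -> E) (s : int -> generator) :
  (forall n, gen_val U (s n) = x n) -> (forall n, gen_degree (s n) = - n) -> smooth1 J x.
Proof.
move=> sx sd N; have [D HD] := modes_continuous DI N; exists `|D|%N => n nD.
have := HD [:: s n]; rewrite !big_seq1 sx sd; apply; lia.
Qed.

Lemma smooth_word (x y : int -> E) (s r : int -> generator) :
  (forall n, gen_val U (s n) = x n) -> (forall n, gen_degree (s n) = - n) ->
  (forall n, gen_val U (r n) = y n) -> (forall n, gen_degree (r n) = - n) ->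
  smooth J true (zw x y).
Proof.
move=> sx sd ry rd N; have [D HD] := modes_continuous DI N.
have [D' HD'] := smooth1_word ry rd N.
exists (`|D| + D')%N => m n /= /orP[H|H]; last by apply/nbhd0_mull/HD'; lia.
have := HD [:: s m; r n]; rewrite !big_cons !big_nil mulr1 addr0 sx ry sd rd; apply; lia.
Qed.

Let gxp n : gen_val U (GXp (- n)) = xpc n. Proof. by []. Qed.
Let gxm n : gen_val U (GXm (- n)) = xmc n. Proof. by []. Qed.
Let dxp n : gen_degree (GXp (- n)) = - n. Proof. by []. Qed.
Let dxm n : gen_degree (GXm (- n)) = - n. Proof. by []. Qed.

Let sxp : smooth1 J xpc. Proof. exact: (smooth1_word gxp dxp). Qed.
Let sxm : smooth1 J xmc. Proof. exact: (smooth1_word gxm dxm). Qed.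
Let spp : smooth J true (zw xpc xpc). Proof. exact: (smooth_word gxp dxp gxp dxp). Qed.
Let spm : smooth J true (zw xpc xmc). Proof. exact: (smooth_word gxp dxp gxm dxm). Qed.
Let smp : smooth J true (zw xmc xpc). Proof. exact: (smooth_word gxm dxm gxp dxp). Qed.
Let smm : smooth J true (zw xmc xmc). Proof. exact: (smooth_word gxm dxm gxm dxm). Qed.

Let words_psip := @words_small GPsip psip (fun k => erefl) (fun k => erefl).

Let deg_cb n : psi_deg psip n (cb n).
Proof.
case: n => [|n]; first exact: PsiDeg0.
rewrite [cb _](_ : _ = inv_sub n.+1 *: (gammah ^- n.+1 *: cp n.+1)).
  by do 2 apply: psi_degZ; apply: (psi_deg_cartan upP pup psipE cp0 fcomm_pp).
by rewrite -(bp_cp (ltn0Sn n)).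
Qed.
Let deg_beta n : psi_deg psip n (beta n).
Proof. exact: (psi_deg_exp _ deg_cb). Qed.
Lemma small_beta : small_fps J beta.
Proof. exact: (psi_deg_small words_psip deg_beta). Qed.
Lemma small_betaV : small_fps J (fps_inv beta).
Proof.
apply: (psi_deg_small words_psip); by apply: (psi_deg_inv _ deg_beta); apply: fps_exp0.
Qed.

Lemma smooth1_psip : smooth1 J (psipc U).
Proof.
move=> N; have [D HD] := words_psip N; exists D => n nD.
rewrite /psipc /cur_zV; case En: (- n) => [k|k]; last exact: nbhd0_0.
by have := HD [:: k]; rewrite big_seq1 /= addn0; apply; lia.
Qed.
Lemma smooth1_psim : smooth1 J (psimc U).
Proof. by move=> N; exists 1%N => n nD; rewrite /psimc cur_z_neg; [apply: nbhd0_0|lia]. Qed.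

(** ** The currents commute with the Cartan modes *)

(** In the variable y = z / (p gamma), one has t^*(z) = scur(y) ([tscE]), which
    is of the same form as t(z). *)
Let alphaV := fdil gamma (fps_inv alpha).
Let betaV := fdil gamma (fps_inv beta).
Definition tcur := dress J alpha xpc beta.
Definition scur := dress J alphaV xmc betaV.

Let alpha0 : alpha 0%N = 1. Proof. exact: fps_exp0. Qed.
Let beta0 : beta 0%N = 1. Proof. exact: fps_exp0. Qed.
Let small_betaV' : small_fps J betaV. Proof. exact/small_fdil/small_betaV. Qed.

Let comm_ca (y : E) : (forall n, (0 < n)%N -> GRing.comm y (b (- n%:Z))) ->
  forall n, GRing.comm y (ca n).
Proof.
move=> H [|n]; first exact: commr0.
by apply/commrN/commZ/H.
Qed.
Let comm_cb (y : E) : (forall n, (0 < n)%N -> GRing.comm y (b n)) ->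
  forall n, GRing.comm y (cb n).
Proof.
move=> H [|n]; first exact: commr0.
by apply/commZ/H.
Qed.
Let comm_alpha (y : E) : (forall n, (0 < n)%N -> GRing.comm y (b (- n%:Z))) ->
  forall n, GRing.comm y (alpha n).
Proof. by move=> H; apply/comm_exp/comm_ca. Qed.
Let comm_beta (y : E) : (forall n, (0 < n)%N -> GRing.comm y (b n)) ->
  forall n, GRing.comm y (beta n).
Proof. by move=> H; apply/comm_exp/comm_cb. Qed.
Let comm_alphaV (y : E) : (forall n, (0 < n)%N -> GRing.comm y (b (- n%:Z))) ->
  forall n, GRing.comm y (alphaV n).
Proof. by move=> H n; apply/commZ/(comm_inv alpha0)/comm_alpha. Qed.
Let comm_betaV (y : E) : (forall n, (0 < n)%N -> GRing.comm y (b n)) ->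
  forall n, GRing.comm y (betaV n).
Proof. by move=> H n; apply/commZ/(comm_inv beta0)/comm_beta. Qed.

Let fbr_bp_alphaV i : (0 < i)%N -> fbr (b i) alphaV = kX (- rr i) i * alphaV.
Proof.
move=> i0; rewrite (fbr_dil _ (fbr_inv alpha0 (fbr_bp_alpha i0))); congr (kX _ _ * _).
by field; rewrite expf_neq0 // gamma_neq0.
Qed.
Let fbr_bm_betaV i : (0 < i)%N -> fbr (b (- i%:Z)) betaV = kX (- rr i) i * betaV.
Proof.
move=> i0; rewrite (fbr_dil _ (fbr_inv beta0 (fbr_bm_beta i0))); congr (kX _ _ * _).
by field; rewrite expf_neq0 // gamma_neq0.
Qed.

(** The eigenvalue of b_s on alpha x^+ beta is the sum of those on the factors,
    and only one of alpha and beta has a nonzero eigenvalue, opposite to that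
    of x^+. *)
Lemma comm_b_tcur s n : s != 0 -> GRing.comm (b s) (tcur n).
Proof.
move=> s0; move: n; apply/(@eig_comm _ _ _ s).
have ex : eig (b s) s (- (gamma ^- `|s| * rr `|s|)) xpc by move=> n; apply: b_xp.
case: s s0 ex => [i|i] s0 ex.
  have i0 : (0 < i)%N by case: i s0 {ex}.
  have ea := eig_cur_z (fbr_bp_alpha i0).
  have eb : eig (b i) i%:Z 0 (cur_zV beta).
    by apply/eig_comm => m; apply: cur_z_comm; apply: comm_beta => n n0; apply: comm_bp.
  have := eig_dress sxp small_beta ea ex eb.
  by rewrite absz_nat addrN addr0.
rewrite NegzE in ex *; set j := i.+1 in ex *; have j0 : (0 < j)%N by [].
have eb := eig_cur_zV (fbr_bm_beta j0).
have ea : eig (b (- j%:Z)) (- j%:Z) 0 (cur_z alpha).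
  by apply/eig_comm; apply: cur_z_comm; apply: comm_alpha => n n0; apply: comm_bm.
have := eig_dress sxp small_beta ea ex eb.
by rewrite abszN absz_nat add0r addNr.
Qed.

Lemma comm_b_scur s n : s != 0 -> GRing.comm (b s) (scur n).
Proof.
move=> s0; move: n; apply/(@eig_comm _ _ _ s).
have ex : eig (b s) s (rr `|s|) xmc by move=> n; apply: b_xm.
case: s s0 ex => [i|i] s0 ex.
  have i0 : (0 < i)%N by case: i s0 {ex}.
  have ea := eig_cur_z (fbr_bp_alphaV i0).
  have eb : eig (b i) i%:Z 0 (cur_zV betaV).
    by apply/eig_comm => m; apply: cur_z_comm; apply: comm_betaV => n n0; apply: comm_bp.
  have := eig_dress sxm small_betaV' ea ex eb.
  by rewrite absz_nat addNr addr0.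
rewrite NegzE in ex *; set j := i.+1 in ex *; have j0 : (0 < j)%N by [].
have eb := eig_cur_zV (fbr_bm_betaV j0).
have ea : eig (b (- j%:Z)) (- j%:Z) 0 (cur_z alphaV).
  by apply/eig_comm; apply: cur_z_comm; apply: comm_alphaV => n n0; apply: comm_bm.
have := eig_dress sxm small_betaV' ea ex eb.
by rewrite abszN absz_nat add0r addrN.
Qed.

(** The coefficients of degree 0 of the exchange relations say that psi^+_0 and
    psi^-_0 are central. *)
Let exch0 (f : fps E) (x : int -> E) (h : fps P) n : h 0%N = 1 -> exch f x h ->
  GRing.comm (f 0%N) (x n).
Proof.
by move=> h0 ex; have := ex 0%N n; rewrite big_ord1 h0 scale1r subr0.
Qed.

Let central (y : E) := (forall n, GRing.comm y (xpc n)) /\ (forall n, GRing.comm y (xmc n)) /\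
  (forall s, s != 0 -> GRing.comm y (b s)).

Let comm_b_of (y : E) : (forall n, GRing.comm y (psip n)) -> (forall n, GRing.comm y (psim n)) ->
  forall s, s != 0 -> GRing.comm y (b s).
Proof.
move=> yp ym [i|i] s0.
  have i0 : (0 < i)%N by case: i s0.
  by rewrite (bp_cp i0); apply/commZ/(cartan_comm upP pup psipE).
rewrite NegzE (bm_cm (ltn0Sn i)); exact/commZ/(cartan_comm umP pum psimE).
Qed.

Let g0 : Defs.g P 0%N = 1. Proof. exact: g0. Qed.

Let psi0_psi n : GRing.comm (psip 0%N) (psim n) /\ GRing.comm (psim 0%N) (psip n).
Proof.
have ex := exch_of_mulwz (psip_psim DI).
have h0 : (fps_scale gamma (Defs.g P) * fps_inv (fps_scale gamma^-1 (Defs.g P))) 0%N = 1.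
  by rewrite coefsM0 scale_g0 (fps_inv0 (scale_g0 _)) mulr1.
split; first exact: (exch0 n%:Z h0 ex).
apply: commr_sym; have := ex n 0; rewrite big_ord_recl h0 scale1r subr0 subn0.
by rewrite big1 ?addr0 // => i _; rewrite /psimc cur_z_neg ?mul0r ?scaler0.
Qed.

Lemma central_psip0 : central (psip 0%N).
Proof.
split=> [n|]; first by apply: (exch0 _ (fps_inv0 (scale_g0 _)) (exch_of_mulwz (psip_xp DI))).
split=> [n|]; first by apply: (exch0 _ (scale_g0 _) (exch_of_mulwz (psip_xm DI))).
by apply: comm_b_of => n; [apply: fcomm_pp|apply: (psi0_psi n).1].
Qed.
Lemma central_psim0 : central (psim 0%N).
Proof.
split=> [n|].
  by have := exch0 (- n) (scale_g0 _) (exch_of_mulzw (psim_xp DI)); rewrite opprK.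
split=> [n|].
  by have := exch0 (- n) (fps_inv0 (scale_g0 _)) (exch_of_mulzw (psim_xm DI)); rewrite opprK.
by apply: comm_b_of => n; [apply: (psi0_psi n).2|apply: fcomm_mm].
Qed.

Let central_tcur y n : central y -> GRing.comm y (tcur n).
Proof.
move=> [yp [_ yb]]; move: n; apply/(@eig_comm _ _ _ 0).
suff : eig y 0 (0 + 0 + 0) tcur by rewrite !addr0.
apply: eig_dress => //; first exact: small_beta.
- by apply/eig_comm/cur_z_comm/comm_alpha => i i0; apply: yb; lia.
- exact/eig_comm.
by apply/eig_comm => m; apply: cur_z_comm; apply: comm_beta => i i0; apply: yb; lia.
Qed.
Let central_scur y n : central y -> GRing.comm y (scur n).
Proof.
move=> [_ [ym yb]]; move: n; apply/(@eig_comm _ _ _ 0).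
suff : eig y 0 (0 + 0 + 0) scur by rewrite !addr0.
apply: eig_dress => //.
- by apply/eig_comm/cur_z_comm/comm_alphaV => i i0; apply: yb; lia.
- exact/eig_comm.
by apply/eig_comm => m; apply: cur_z_comm; apply: comm_betaV => i i0; apply: yb; lia.
Qed.

Definition cartan_central (y : E) :=
  [/\ forall n, GRing.comm y (alpha n), forall n, GRing.comm y (beta n),
      forall n, GRing.comm y (psip n) & forall n, GRing.comm y (psim n)].

Let cartan_centralI (y : E) : (forall s, s != 0 -> GRing.comm y (b s)) ->
  GRing.comm y (psip 0%N) -> GRing.comm y (psim 0%N) -> cartan_central y.
Proof.
move=> yb yp ym; split.
- by apply: comm_alpha => n n0; apply: yb; lia.
- by apply: comm_beta => n n0; apply: yb; lia.
- apply: (comm_cartan psipE cp0 yp) => -[|n]; first exact: commr0.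
  by apply/commZ/yb.
apply: (comm_cartan psimE cm0 ym) => -[|n]; first exact: commr0.
by apply/commrN/commZ/yb.
Qed.

Lemma cartan_central_tcur n : cartan_central (tcur n).
Proof.
apply: cartan_centralI => [s s0||]; apply: commr_sym.
- exact: comm_b_tcur.
- exact: (central_tcur _ central_psip0).
exact: (central_tcur _ central_psim0).
Qed.
Lemma cartan_central_scur n : cartan_central (scur n).
Proof.
apply: cartan_centralI => [s s0||]; apply: commr_sym.
- exact: comm_b_scur.
- exact: (central_scur _ central_psip0).
exact: (central_scur _ central_psim0).
Qed.

(** ** Normal ordering factors *)

Let exch_has_log (f c : fps E) (x : int -> E) F : has_log f c -> c 0%N = 0 ->
  (forall i n, (0 < i)%N -> c i * x n - x n * c i = (i%:R^-1 * F i) *: x (n - i%:Z)) ->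
  exch f x (sexpn F).
Proof.
move=> [Ef f0] c0 Hc.
apply: (exch_exp char0 (kap := pos_series (fun n => n%:R^-1 * F n)) Ef f0) => //.
- by rewrite theta_pos_series //; apply: logder_sexpn.
- exact: sexpn0.
by move=> [|i] n i0 //; apply: Hc.
Qed.

Let log_betaV : has_log betaV (fdil gamma (- cb)).
Proof. by apply/has_log_dil/(has_logV log_beta)/fcomm_exp. Qed.
Let log_alphaV : has_log alphaV (fdil gamma (- ca)).
Proof. by apply/has_log_dil/(has_logV log_alpha)/fcomm_exp. Qed.

Let cbE i : (0 < i)%N -> cb i = inv_sub i *: b i. Proof. by case: i. Qed.
Let cbVE i : (0 < i)%N -> fdil gamma (- cb) i = (- (gamma ^+ i * inv_sub i)) *: b i.
Proof. by case: i => // i _; rewrite /= scalerN scalerA scaleNr. Qed.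

Let brZ (k l : P) (y x z : E) : y * x - x * y = l *: z ->
  (k *: y) * x - x * (k *: y) = (k * l) *: z.
Proof. by move=> H; rewrite -scalerAl -scalerAr -scalerBr H scalerA. Qed.

Let exch_tt : exch beta xpc (h_tt P).
Proof.
apply: (exch_has_log log_beta) => // i n i0.
have s0 : i%:Z != 0 by clear -i0; lia.
rewrite (cbE i0) (brZ _ (b_xp n s0)) absz_nat; congr (_ *: _).
by rewrite /rr; ring.
Qed.
Let exch_ts : exch beta xmc (h_ts P).
Proof.
apply: (exch_has_log log_beta) => // i n i0.
have s0 : i%:Z != 0 by clear -i0; lia.
rewrite (cbE i0) (brZ _ (b_xm n s0)) absz_nat; congr (_ *: _).
by rewrite /rr; ring.
Qed.
Let exch_st : exch betaV xpc (h_ts P).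
Proof.
apply: (exch_has_log log_betaV) => [|i n i0]; first by rewrite /= oppr0 scaler0.
have s0 : i%:Z != 0 by clear -i0; lia.
rewrite (cbVE i0) (brZ _ (b_xp n s0)) absz_nat; congr (_ *: _).
rewrite /rr; have := expf_neq0 i (gamma_neq0 gh0); move: (gamma ^+ i) => G G0.
transitivity ((G / G) * (i%:R^-1 * (inv_sub i * gg i))); first by rewrite mulrNN; ring.
by rewrite divff // mul1r.
Qed.
Let exch_ss : exch betaV xmc (h_ss P).
Proof.
apply: (exch_has_log log_betaV) => [|i n i0]; first by rewrite /= oppr0 scaler0.
have s0 : i%:Z != 0 by clear -i0; lia.
rewrite (cbVE i0) (brZ _ (b_xm n s0)) absz_nat; congr (_ *: _).
by rewrite /rr; ring.
Qed.

Let fcomm_alpha : fcomm alpha alpha.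
Proof. exact: (fcomm_exp ca0 (fcommC (fcomm_exp ca0 fcomm_ca))). Qed.
Let fcomm_beta : fcomm beta beta.
Proof. exact: (fcomm_exp cb0 (fcommC (fcomm_exp cb0 fcomm_cb))). Qed.
Let fcomm_alphaV : fcomm alpha alphaV.
Proof. by move=> i j; apply/commZ/(fcomm_inv alpha0 fcomm_alpha). Qed.
Let fcomm_betaV : fcomm beta betaV.
Proof. by move=> i j; apply/commZ/(fcomm_inv beta0 fcomm_beta). Qed.
Let fcomm_alphaVV : fcomm alphaV alphaV.
Proof. exact/fcomm_fdil/(fcomm_inv alpha0)/fcommC/(fcomm_inv alpha0 fcomm_alpha). Qed.
Let fcomm_betaVV : fcomm betaV betaV.
Proof. exact/fcomm_fdil/(fcomm_inv beta0)/fcommC/(fcomm_inv beta0 fcomm_beta). Qed.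

Let tcur_alpha m j : GRing.comm (tcur m) (alpha j).
Proof. by case: (cartan_central_tcur m) => H _ _ _; apply: H. Qed.
Let tcur_alphaV m j : GRing.comm (tcur m) (alphaV j).
Proof. by apply/commZ/(comm_inv alpha0) => n; apply: tcur_alpha. Qed.
Let scur_alpha m j : GRing.comm (scur m) (alpha j).
Proof. by case: (cartan_central_scur m) => H _ _ _; apply: H. Qed.
Let scur_alphaV m j : GRing.comm (scur m) (alphaV j).
Proof. by apply/commZ/(comm_inv alpha0) => n; apply: scur_alpha. Qed.

(** ** t and t^* as dressed currents *)

Lemma tcE : tc J U b = tcur. Proof. by []. Qed.

Let c0 := p^-1 * gamma^-1.
Let c0_neq0 : c0 != 0.
Proof. by rewrite mulf_neq0 ?invr_eq0 ?p_neq0 ?gamma_neq0. Qed.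

Lemma tscE : tsc J U b = dil c0 scur.
Proof.
have p0 := p_neq0 q0 t0; have ga0 := gamma_neq0 gh0.
have e1 : c0 * gamma = p^-1 by rewrite /c0 mulfVK.
have e2 : c0^-1 * gamma = (gamma ^- 2 * p^-1)^-1 by rewrite /c0 !invfM !invrK mulrC mulrCA -expr2 mulrC.
rewrite /scur /dress !dil_cmul // dil_cur_z dil_cur_zV !fdil_fdil e1 e2.
by rewrite -dil_cur_z -(dil_cur_zV (gamma ^- 2 * p^-1)).
Qed.

Let comm2_eq0 (x y : int -> E) : (forall m n, GRing.comm (x m) (y n)) ->
  forall m n, comm2 x y m n = 0.
Proof. by move=> H m n; rewrite /comm2 H subrr. Qed.

Theorem t_commutes_with_cartan :
  [/\ forall m n, comm2 (tc J U b) (alphac b) m n = 0,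
      forall m n, comm2 (tc J U b) (betac b) m n = 0,
      forall m n, comm2 (tsc J U b) (alphac b) m n = 0 &
      forall m n, comm2 (tsc J U b) (betac b) m n = 0] /\
  [/\ forall m n, comm2 (tc J U b) (psipc U) m n = 0,
      forall m n, comm2 (tc J U b) (psimc U) m n = 0,
      forall m n, comm2 (tsc J U b) (psipc U) m n = 0 &
      forall m n, comm2 (tsc J U b) (psimc U) m n = 0].
Proof.
have H x m : x = tc J U b \/ x = tsc J U b -> cartan_central (x m).
  case=> ->; first exact: cartan_central_tcur.
  rewrite tscE; have [Ha Hb Hp Hm] := cartan_central_scur m.
  by split=> n; apply/commr_sym/commZ/commr_sym.
split; split; apply: comm2_eq0 => m n;
  [have [K _ _ _] := H _ m (or_introl erefl)|have [_ K _ _] := H _ m (or_introl erefl)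
  |have [K _ _ _] := H _ m (or_intror erefl)|have [_ K _ _] := H _ m (or_intror erefl)
  |have [_ _ K _] := H _ m (or_introl erefl)|have [_ _ _ K] := H _ m (or_introl erefl)
  |have [_ _ K _] := H _ m (or_intror erefl)|have [_ _ _ K] := H _ m (or_intror erefl)];
  exact: (cur_z_comm K).
Qed.

(** ** The quadratic relations *)

Hypotheses (q1 : q != 1) (t1 : t != 1) (p1 : p != 1) (p2 : p ^+ 2 != 1).

Theorem tt_relation m n :
  mulwz J (cur_z (Aseries P)) (zw (tc J U b) (tc J U b)) m n -
  mulzw J (cur_z (Aseries P)) (wz (tc J U b) (tc J U b)) m n =
  ((1 - q) * (1 - t^-1) / (1 - p)) *:
    (mulwz J (delta p^-1) (in_z (t2c J U b)) m n -
     mulwz J (delta p) (in_w (t2c J U b)) m n).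
Proof.
have rel : mulzw J (cur_z (fps_of_poly (Gpol q^-1 t^-1))) (zw xpc xpc) =
           mulzw J (cur_z (fps_of_poly (Gpol q t))) (wz xpc xpc).
  by rewrite -GmE -GpE; apply/funext => i; apply/funext => j; apply: xp_xp.
rewrite tcE (dress_commutator _ small_beta small_beta sxp sxp spp spp tcur_alpha
  tcur_alpha fcomm_alpha fcomm_beta exch_tt exch_tt) A_h_tt //.
have -> : (fun m n => mulwz J (cur_z (poles q t * fps_of_poly (Gpol q t))) (zw xpc xpc) m n
    - mulzw J (cur_z (poles q t * fps_of_poly (Gpol q t))) (wz xpc xpc) m n) =
   (fun m n => ((1 - q) * (1 - t^-1) / (1 - p)) *: (line 1 p^-1 (fuse J (Gm P) p xpc) m n -
           line p^-1 1 (fuse J (Gm P) p xpc) m n)).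
  apply/funext => i; apply/funext => j; rewrite GmE.
  exact: (quadratic_delta char0 q0 t0 q1 t1 p1 p2 spp rel).
rewrite dress2Z; congr (_ *: _).
apply: dress2_lines => //; [exact: p_neq0| |exact: small_beta].
by rewrite GmE; apply: (smooth1_fuse q0 t0 spp rel).
Qed.

(** The current x^- satisfies the quadratic relation of x^+ with q and t
    inverted. *)
Theorem ss_relation m n :
  mulwz J (cur_z (Aseries P)) (zw (tsc J U b) (tsc J U b)) m n -
  mulzw J (cur_z (Aseries P)) (wz (tsc J U b) (tsc J U b)) m n =
  ((1 - q^-1) * (1 - t) / (1 - p^-1)) *:
    (mulwz J (delta p) (in_z (ts2c J U b)) m n -
     mulwz J (delta p^-1) (in_w (ts2c J U b)) m n).
Proof.
have qV0 : q^-1 != 0 by rewrite invr_eq0.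
have tV0 : t^-1 != 0 by rewrite invr_eq0.
have qV1 : q^-1 != 1 by rewrite invr_eq1.
have tV1 : t^-1 != 1 by rewrite invr_eq1.
have pE : q^-1 / t^-1 = p^-1 by rewrite /Defs.p invfM.
have pV1 : q^-1 / t^-1 != 1 by rewrite pE invr_eq1.
have pV2 : (q^-1 / t^-1) ^+ 2 != 1 by rewrite pE exprVn invr_eq1.
have rel : mulzw J (cur_z (fps_of_poly (Gpol q^-1^-1 t^-1^-1))) (zw xmc xmc) =
           mulzw J (cur_z (fps_of_poly (Gpol q^-1 t^-1))) (wz xmc xmc).
  by rewrite !invrK -GmE -GpE; apply/funext => i; apply/funext => j; apply: xm_xm.
have p0 := p_neq0 q0 t0.
rewrite tscE mulwz_dil2 //.
have -> : mulzw J (cur_z (Aseries P)) (wz (dil c0 scur) (dil c0 scur)) m n =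
    c0 ^ (m + n) *: mulzw J (cur_z (Aseries P)) (wz scur scur) m n.
  by rewrite !mulzwE /swap (addrC m); apply: mulwz_dil2.
rewrite -scalerBr (dress_commutator _ small_betaV' small_betaV' sxm sxm smm smm scur_alphaV
  scur_alphaV fcomm_alphaVV fcomm_betaVV exch_ss exch_ss) A_h_ss //.
set X := fuse J (Gp P) p^-1 xmc.
have -> : (fun m n => mulwz J (cur_z (poles q^-1 t^-1 * fps_of_poly (Gpol q^-1 t^-1))) (zw xmc xmc) m n
    - mulzw J (cur_z (poles q^-1 t^-1 * fps_of_poly (Gpol q^-1 t^-1))) (wz xmc xmc) m n) =
   (fun m n => ((1 - q^-1) * (1 - t) / (1 - p^-1)) *:
     (line 1 p^-1^-1 X m n - line p^-1^-1 1 X m n)).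
  apply/funext => i; apply/funext => j.
  have := quadratic_delta char0 qV0 tV0 qV1 tV1 pV1 pV2 smm rel i j.
  by rewrite pE !invrK -GpE.
rewrite dress2Z scalerA [c0 ^ _ * _]mulrC -[LHS]scalerA; congr (_ *: _).
have pVn : p^-1 != 0 by rewrite invr_eq0.
have sX : smooth1 J X.
  have := smooth1_fuse qV0 tV0 smm rel.
  by rewrite pE !invrK -GpE.
rewrite (dress2_lines m n pVn sX small_betaV' fcomm_alphaVV fcomm_betaVV).
rewrite invrK !mulwz_delta_in_z !mulwz_delta_in_w /ts2c -/X.
have -> : dil (gamma * p^-1) (alphaVc b) = dil p^-1 (cur_z alphaV).
  by rewrite /alphaVc !dil_cur_z fdil_fdil mulrC.
have -> : dil gamma (alphaVc b) = cur_z alphaV by rewrite /alphaVc dil_cur_z.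
have -> : dil (gamma^-1 * p^-1) (betaVc b) = dil p^-1 (cur_zV betaV).
  by rewrite /betaVc !dil_cur_zV fdil_fdil invfM !invrK mulrC.
have -> : dil gamma^-1 (betaVc b) = cur_zV betaV by rewrite /betaVc dil_cur_zV invrK.
rewrite scalerBr /dil !scalerA /c0.
by congr (_ *: _ - _ *: _); rewrite mulrC.
Qed.

(** ** The currents of psi cancel against the dressing *)

Let fdil_const (k : P) (u : E) : fdil k (fps_const u) = fps_const u.
Proof. by apply: fpsP => -[|i] /=; rewrite ?expr0 ?scale1r ?scaler0. Qed.

Let has_log_eq0 (f c : fps E) : has_log f c -> (forall n, (0 < n)%N -> c n = 0) ->
  c 0%N = 0 -> f = 1.
Proof.
move=> fc cn c00; apply: (has_log0 char0); have <- // : c = 0.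
by apply: fpsP => -[|i]; rewrite coefs0 // cn.
Qed.

Let comm_bp_cb n : (0 < n)%N -> forall i, GRing.comm (b n) (cb i).
Proof. by move=> n0; apply: comm_cb => i i0; apply: comm_bp. Qed.
Let fcomm_cb_exp : fcomm cb (fps_exp cp).
Proof.
move=> [|i]; apply: comm_exp => // j; first exact/commr_sym/commr0.
by case: j => [|j]; [apply: commr0|apply/commZ/commr_sym/comm_bp_cb].
Qed.
Let fcomm_ca_exp : fcomm ca (fps_exp cm).
Proof.
move=> [|i]; apply: comm_exp => // j; first exact/commr_sym/commr0.
case: j => [|j]; [exact: commr0|apply/commrN/commZ].
by apply/commr_sym/comm_ca => l l0; apply: comm_bm.
Qed.
Let fcomm_psim_alpha : fcomm psim alpha.
Proof.
move=> i; apply: comm_alpha => n n0; rewrite (bm_cm n0); apply: commZ.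
exact: (fcomm_psi_cartan umP pum psimE cm0 fcomm_mm).
Qed.

Let fcommDl (f g h : fps E) : fcomm f h -> fcomm g h -> fcomm (f + g) h.
Proof. by move=> fh gh i j; apply/commr_sym/commrD; apply: commr_sym. Qed.
Let fcommNl (f h : fps E) : fcomm f h -> fcomm (- f) h.
Proof. by move=> fh i j; apply/commr_sym/commrN/commr_sym. Qed.

Let gammah_pow n : gammah ^- n * gammah ^+ n = 1.
Proof. by rewrite mulVf // expf_neq0. Qed.

(** This product is what multiplies delta(z / (gamma w)) in the commutator, after
    the cancellation of alpha.  The exponents add up to
    b_n - (gamma^n - gamma^-n) b_n / (gamma^n - gamma^-n) = 0. *)
Let plus_vacuum : fdil gammah^-1 psip * (fdil gamma^-1 beta * betaV) = fps_const (psip 0%N).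
Proof.
rewrite {1}psipE fdilM fdil_const -mulrA [X in _ * X](_ : _ = 1) ?mulr1 //.
have L := has_log_exp char0 cp0 fcomm_cp.
have H1 : fcomm (fdil gamma (- cb)) (fdil gamma^-1 beta).
  by apply/fcomm_fdil/fcommNl/(fcomm_exp cb0).
have H2 : fcomm (fdil gamma^-1 cb + fdil gamma (- cb)) (fdil gammah^-1 (fps_exp cp)).
  apply: fcommDl; first exact: fcomm_fdil.
  by apply/fcomm_fdil/fcommNl.
have Lb := has_logM (has_log_dil gamma^-1 log_beta) log_betaV H1.
apply: (has_log_eq0 (has_logM (has_log_dil gammah^-1 L) Lb H2)).
- move=> [|n] // _; rewrite !coefsD /= scalerN !scalerA -scalerBl -scalerDl.
  rewrite !exprVn gammah_pow -mulrBl -(opprB (gamma ^+ _)) mulNr mulrC inv_subE //.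
  by rewrite subrr scale0r.
by rewrite !coefsD /= oppr0 !scaler0 !addr0.
Qed.

(** Here it is beta that has cancelled. *)
Let minus_vacuum : alphaV * fdil gamma^-1 alpha * fdil gammah^-1 psim = fps_const (psim 0%N).
Proof.
have c1 : fdil gamma^-1 alpha * fdil gammah^-1 psim = fdil gammah^-1 psim * fdil gamma^-1 alpha.
  by apply/esym/mulfC/fcomm_fdil.
have c2 : alphaV * fdil gammah^-1 psim = fdil gammah^-1 psim * alphaV.
  apply/esym/mulfC/fcomm_fdil => i; apply: comm_inv => // j; exact: fcomm_psim_alpha.
rewrite -mulrA c1 mulrA c2 {1}psimE fdilM fdil_const -!mulrA [X in _ * X](_ : _ = 1) ?mulr1 //.
have L := has_log_exp char0 cm0 fcomm_cm.
have H1 : fcomm (fdil gamma^-1 ca) alphaV.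
  by apply: fcomm_fdil; apply/(fcomm_inv alpha0)/(fcomm_exp ca0).
have H2 : fcomm (fdil gamma (- ca) + fdil gamma^-1 ca) (fdil gammah^-1 (fps_exp cm)).
  apply: fcommDl; last exact: fcomm_fdil.
  by apply/fcomm_fdil/fcommNl.
have La := has_logM log_alphaV (has_log_dil gamma^-1 log_alpha) H1.
apply: (has_log_eq0 (has_logM (has_log_dil gammah^-1 L) La H2)).
- move=> [|n] // _; rewrite !coefsD /= !scalerN opprK !scalerA -scalerBl -scaleNr -scalerDl.
  rewrite !exprVn gammah_pow -mulrBl mulrC inv_subE //.
  by rewrite addNr scale0r.
by rewrite !coefsD /= oppr0 !scaler0 !addr0.
Qed.

Theorem ts_relation m n :
  mulwz J (cur_z (Bseries P)) (zw (tc J U b) (tsc J U b)) m n -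
  mulzw J (cur_z (fps_scale (gamma ^+ 2 * p ^+ 2) (Bseries P)))
    (wz (tsc J U b) (tc J U b)) m n =
  ((1 - q) * (1 - t^-1) / (1 - p)) *:
    (mulwz J (delta p^-1) (in_z (cur_z (fps_const (psip 0%N)))) m n -
     mulwz J (delta (gamma ^- 2 * p^-1)) (in_z (cur_z (fps_const (psim 0%N)))) m n).
Proof.
have p0 := p_neq0 q0 t0; have ga0 := gamma_neq0 gh0.
have c0E : c0^-1 = p * gamma by rewrite /c0 invfM !invrK.
rewrite tcE tscE mulwz_zw_dil // mulzw_wz_dil // fps_scale_scale.
have -> : c0 * (gamma ^+ 2 * p ^+ 2) = p * gamma.
  by rewrite /c0; move: (p) (gamma) p0 ga0 => x y x0 y0; field; rewrite x0 y0.
rewrite c0E -scalerBr.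
rewrite (dress_commutator _ small_beta small_betaV' sxp sxm spm smp tcur_alphaV
  scur_alpha fcomm_alphaV fcomm_betaV exch_ts exch_st) B_h_ts //.
have -> : (fun m n => mulwz J (cur_z 1) (zw xpc xmc) m n -
     mulzw J (cur_z 1) (wz xmc xpc) m n) =
  (fun m n => ((1 - q) * (1 - t^-1) / (1 - p)) *:
     (line gamma^-1 1 (dil gammah (psipc U)) m n -
      line gamma 1 (dil gammah^-1 (psimc U)) m n)).
  apply/funext => i; apply/funext => j; rewrite mulzwE !mulwz1.
  have := xp_xm DI i j; rewrite !mulzw_delta_in_w /comm2 /line !exp1rz !mulr1.
  by move=> <-.
have sd (k : P) (x : int -> E) : smooth1 J x -> smooth1 J (dil k x).
  by move=> sx N; have [D HD] := sx N; exists D => i iD; apply/nbhdZ/HD.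
have sp := sd gammah _ smooth1_psip; have sm := sd gammah^-1 _ smooth1_psim.
rewrite dress2Z scalerA [c0 ^ _ * _]mulrC -[LHS]scalerA; congr (_ *: _).
rewrite (@dress2B _ _ _ false) //; [|exact: small_beta|exact: smooth_line|exact: smooth_line].
have gV0 : gamma^-1 != 0 by rewrite invr_eq0.
have sp' : smooth1 J (cur_zV (fdil gammah^-1 psip)) by rewrite -dil_cur_zV.
have sm' : smooth1 J (cur_z (fdil gammah^-1 psim)) by rewrite -dil_cur_z.
rewrite !dress2_line ?oner_neq0 // invrK invr1 !dil1 !dil_cur_z !dil_cur_zV !invrK.
have sb (k : P) : small_fps J (fdil k beta) by apply/small_fdil/small_beta.
rewrite !cmulA_left // (cmulA_right _ small_betaV' (sb gamma^-1)).
rewrite (cmulA_right _ small_betaV' (sb gamma)).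
have dil1E (k : P) : fdil k 1 = 1 :> fps E.
  apply: fpsP => i; rewrite /fdil /= ; case: i => [|i]; by rewrite ?expr0 ?scale1r ?scaler0.
have a1 : alphaV * fdil gamma alpha = 1 by rewrite /alphaV -fdilM mulVfps ?dil1E.
have b1 : fdil gamma beta * betaV = 1 by rewrite /betaV -fdilM mulfpsV ?dil1E.
rewrite a1 b1 cmul1_z cmul1_zV cmul_cur_z cmul_cur_zV plus_vacuum minus_vacuum.
rewrite cur_zV_const mulwz_delta_in_z mulwz_delta_in_z /line !exp1rz !mulr1.
have [mn|mn] := eqVneq (m + n) 0; last first.
  have z (u : E) : cur_z (fps_const u) (m + n) = 0.
    by case: (m + n) mn => // -[].
  by rewrite !z !scaler0 subrr scaler0.
have -> : m = - n by apply/eqP; rewrite -addr_eq0 mn.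
rewrite scalerBr !scalerA exprz_inv opprK /c0; congr (_ *: _ - _ *: _).
  by rewrite -expfzMl mulfVK.
rewrite -exprz_inv -expfzMl; congr (_ ^ n).
by move: (gamma) p^-1 => x y; rewrite expr2 invfM; ring.
Qed.

End Representation.

(** * The formal scalars *)

Section FormalScalars.

Lemma tofrac_natr_eq0 (R : idomainType) n :
  (n%:R == 0 :> {fraction R}) = (n%:R == 0 :> R).
Proof. by rewrite -(rmorph_nat (@FracField.tofrac R)) tofrac_eq0. Qed.

Lemma polyC_natr_eq0 (R : nzRingType) n : (n%:R == 0 :> {poly R}) = (n%:R == 0 :> R).
Proof. by rewrite -polyC_natr polyC_eq0. Qed.

Lemma base_field_char0 n : n.+1%:R != 0 :> base_field.
Proof.
Transparent base_field.
have : n.+1%:R != 0 :> {fraction {poly {fraction {poly rat}}}}.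
  by rewrite !(tofrac_natr_eq0, polyC_natr_eq0) pnatr_eq0.
by [].
Opaque base_field.
Qed.

Lemma fps_natr_eq0 (F : fieldType) n : n%:R = 0 :> fps F -> n%:R = 0 :> F.
Proof.
by move=> /(congr1 (fun f : fps F => f 0%N)); rewrite coefsMn coefs1 coefs0.
Qed.

Lemma fps_const_inj (F : fieldType) : injective (@fps_const F).
Proof. by move=> x y /(congr1 (fun f : fps F => f 0%N)). Qed.

Lemma laurent_inj : injective laurent.
Proof. by move=> f g /eqP; rewrite -subr_eq0 -rmorphB laurent_eq0 subr_eq0 => /eqP. Qed.

Lemma formal_char0 n : n.+1%:R != 0 :> formal_scalars.
Proof.
have -> : (n.+1%:R : formal_scalars) = laurent n.+1%:R by rewrite rmorph_nat.
rewrite laurent_eq0; apply/eqP => /fps_natr_eq0/eqP.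
by rewrite (negbTE (base_field_char0 n)).
Qed.

Lemma tofrac_inj (R : idomainType) : injective (@FracField.tofrac R).
Proof.
move=> x y /eqP; rewrite -subr_eq0 -(rmorphB (@FracField.tofrac R)) tofrac_eq0.
by rewrite subr_eq0 => /eqP.
Qed.

Lemma t_half_pow_neq n m : q_half0 ^+ n != t_half0 ^+ m.+1.
Proof.
Transparent base_field.
rewrite /q_half0 /t_half0 -!(rmorphXn (@FracField.tofrac _)) /=.
apply/eqP => /tofrac_inj; rewrite -rmorphXn /= => /(congr1 (fun f : {poly _} => size f)).
rewrite size_polyXn => E; have := size_polyC_leq1 (FracField.tofrac ('X : {poly rat}) ^+ n).
by rewrite E.
Opaque base_field.
Qed.

Lemma q_half_pow_neq1 n : q_half0 ^+ n.+1 != 1.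
Proof.
Transparent base_field.
rewrite /q_half0 -!(rmorphXn (@FracField.tofrac _)) -(rmorph1 (@FracField.tofrac _)) /=.
apply/eqP => /tofrac_inj; rewrite -rmorphXn -(rmorph1 (@polyC _)) /= => /polyC_inj.
rewrite -rmorphXn -(rmorph1 (@FracField.tofrac _)) => /tofrac_inj.
by move=> /(congr1 (fun f : {poly _} => size f)); rewrite size_polyXn size_poly1.
Opaque base_field.
Qed.

Lemma formal_const_inj : injective (fun x : base_field => laurent (fps_const x)).
Proof. by move=> x y /laurent_inj/fps_const_inj. Qed.

Lemma formal_q_neq1 : q formal_scalars != 1.
Proof.
apply/eqP => E; apply: (elimN eqP (q_half_pow_neq1 1)); apply: formal_const_inj.
by rewrite -[LHS]/(q formal_scalars) E -(rmorph1 laurent).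
Qed.

Lemma formal_t_neq1 : t formal_scalars != 1.
Proof.
apply/eqP => E; apply: (elimN eqP (t_half_pow_neq 0 1)); apply: formal_const_inj.
by rewrite -[RHS]/(t formal_scalars) E -(rmorph1 laurent).
Qed.

Lemma formal_p_pow_neq1 n : p formal_scalars ^+ n.+1 != 1.
Proof.
rewrite /p expr_div_n -subr_eq0 -[X in _ - X](divff (expf_neq0 n.+1 t_neq0)) -mulrBl.
rewrite mulf_neq0 ?invr_eq0 ?expf_neq0 ?t_neq0 // subr_eq0 /=.
have lX (x : base_field) : laurent (fps_const x) ^+ n.+1 = laurent (fps_const (x ^+ n.+1)).
  rewrite -rmorphXn; congr laurent; elim: n.+1 => [|k IH]; first by rewrite !expr0.
  by rewrite !exprS IH fps_constM.
rewrite !lX; apply/eqP => /formal_const_inj; rewrite -!exprM => /eqP.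
by rewrite mulSn; apply/negP/t_half_pow_neq.
Qed.

End FormalScalars.

Theorem proposition2p9 (E : algType formal_scalars) (J : linear_topology E)
    (U : modes E) (b : int -> E) :
  let q := q formal_scalars in
  let t := t formal_scalars in
  let p := p formal_scalars in
  let gamma := gamma formal_scalars in
  let A := Aseries formal_scalars in
  let B := Bseries formal_scalars in
  let tz := tc J U b in
  let tsz := tsc J U b in
  ding_iohara J U -> cartan_modes U b ->
  [/\ forall m n, comm2 tz (alphac b) m n = 0,
      forall m n, comm2 tz (betac b) m n = 0,
      forall m n, comm2 tsz (alphac b) m n = 0 &
      forall m n, comm2 tsz (betac b) m n = 0] /\
  [/\ forall m n, comm2 tz (psipc U) m n = 0,
      forall m n, comm2 tz (psimc U) m n = 0,
      forall m n, comm2 tsz (psipc U) m n = 0 &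
      forall m n, comm2 tsz (psimc U) m n = 0] /\
  (forall m n,
     mulwz J (cur_z A) (zw tz tz) m n - mulzw J (cur_z A) (wz tz tz) m n =
     ((1 - q) * (1 - t^-1) / (1 - p)) *:
       (mulwz J (delta p^-1) (in_z (t2c J U b)) m n -
        mulwz J (delta p) (in_w (t2c J U b)) m n)) /\
  (forall m n,
     mulwz J (cur_z A) (zw tsz tsz) m n - mulzw J (cur_z A) (wz tsz tsz) m n =
     ((1 - q^-1) * (1 - t) / (1 - p^-1)) *:
       (mulwz J (delta p) (in_z (ts2c J U b)) m n -
        mulwz J (delta p^-1) (in_w (ts2c J U b)) m n)) /\
  (forall m n,
     mulwz J (cur_z B) (zw tz tsz) m n -
       mulzw J (cur_z (fps_scale (gamma ^+ 2 * p ^+ 2) B)) (wz tsz tz) m n =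
     ((1 - q) * (1 - t^-1) / (1 - p)) *:
       (mulwz J (delta p^-1) (in_z (cur_z (fps_const (psip U 0%N)))) m n -
        mulwz J (delta (gamma ^- 2 * p^-1))
          (in_z (cur_z (fps_const (psim U 0%N)))) m n)).
Proof.
move=> q t p gamma A B tz tsz DI CM.
have ch := formal_char0; have q0 := q_neq0; have t0 := t_neq0; have gh0 := gammah_neq0.
have iS := inv_gamma_subE; have iO := inv_one_subE.
have q1 := formal_q_neq1; have t1 := formal_t_neq1.
have p1 : Defs.p formal_scalars != 1 by rewrite -[X in X != _]expr1 formal_p_pow_neq1.
have p2 := formal_p_pow_neq1 1.
have [comm_ab comm_psi] := t_commutes_with_cartan ch q0 t0 gh0 iS DI CM.
split; [exact: comm_ab|split; [exact: comm_psi|split; [|split]]].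
- exact: (tt_relation ch q0 t0 gh0 iS iO DI CM q1 t1 p1 p2).
- exact: (ss_relation ch q0 t0 gh0 iS iO DI CM q1 t1 p1 p2).
exact: (ts_relation ch q0 t0 gh0 iS iO DI CM).
Qed.
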